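(* Let $n$ be an integer and let $H$ be a complex Hilbert space (possibly infinite-dimensional) with $\dim H > n \geq 2$. Let $\varphi\colon P_n(H) \to P_n(H)$ be a (not necessarily bijective) map satisfying $$\operatorname{Tr} \varphi(P)\varphi(Q) = \operatorname{Tr} PQ \qquad \text{for all } P,Q \in P_n(H).$$ Then at least one of the following holds: (i) there exists a linear or conjugate-linear isometry $V\colon H\to H$ such that $$\varphi(P) = VPV^* \qquad \text{for all } P \in P_n(H);$$ (ii) $\dim H = 2n$ and there exists a linear or conjugate-linear isometry $V\colon H\to H$ such that $$\varphi(P) = I - VPV^* \qquad \text{for all } P \in P_n(H).$$
   Context: For a complex Hilbert space $H$ and a positive integer $n$, $P_n(H)$ denotes the set of all rank-$n$ self-adjoint (i.e. orthogonal) projections on $H$. $I$ denotes the identity operator on $H$, and $\operatorname{Tr}$ the trace. An isometry $V\colon H\to H$ is a norm-preserving linear or conjugate-linear map, not necessarily surjective. For a bounded conjugate-linear operator $V$, the adjoint $V^*$ is the conjugate-linear operator determined by $\langle Vx,y\rangle = \overline{\langle x, V^*y\rangle}$ for all $x,y\in H$; for linear $V$ it is the usual adjoint. In both cases $VPV^*$ is the orthogonal projection onto $V(\operatorname{Im} P)$. *)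

(* Defs.v *)
From HB Require Import structures.
From mathcomp Require Import all_boot all_order all_algebra.
From mathcomp Require Import complex.
From mathcomp Require Import boolp classical_sets reals topology normedtype.

Set Implicit Arguments.
Unset Strict Implicit.
Unset Printing Implicit Defensive.

Import Order.TTheory GRing.Theory Num.Theory.
Import numFieldNormedType.Exports.

Local Open Scope classical_set_scope.
Local Open Scope ring_scope.

(* The inner product is linear in its first argument and conjugate-linear in
   the second one; the norm takes its values in R[i], as for every normed
   module over R[i]. *)
HB.mixin Record CompleteNormedModule_isHilbert (R : realType) H
    of CompleteNormedModule R[i] H := {
  inner : {dot H for Num.conj};
  sqr_normE : forall x : H, `|x| ^+ 2 = inner x x
}.

#[short(type="hilbertType")]
HB.structure Definition Hilbert (R : realType) :=
  {H of CompleteNormedModule_isHilbert R H & CompleteNormedModule R[i] H}.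

Section FiniteDimension.
Context {R : realType} {H : hilbertType R}.
Implicit Types (A : set H) (n : nat).

Definition lin_indep n (e : 'I_n -> H) : Prop :=
  forall c : 'I_n -> R[i], \sum_i c i *: e i = 0 -> forall i, c i = 0.

Definition lin_span n (e : 'I_n -> H) : set H :=
  [set \sum_i c i *: e i | c in [set: 'I_n -> R[i]]].

Definition basis_of A n (e : 'I_n -> H) : Prop :=
  lin_indep e /\ A = lin_span e.

Definition has_dim A n : Prop := exists e : 'I_n -> H, basis_of A e.

(* The trace of a finite-rank linear operator T is the trace of the
   endomorphism that T induces on its finite-dimensional range. The chosen
   basis is irrelevant, see op_traceE; the value 0 is junk, taken when T has
   infinite rank. *)
Definition op_trace (T : H -> H) : R[i] :=
  xget 0 [set t | exists n (e : 'I_n -> H) (M : 'M[R[i]]_n),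
    [/\ basis_of (range T) e,
        forall j, T (e j) = \sum_i M i j *: e i
      & t = \tr M]].

Let lin_comb m n (e : 'I_m -> H) (M : 'M[R[i]]_(m, n)) (j : 'I_n) : H :=
  \sum_i M i j *: e i.

Let lin_comb_mul m n p (e : 'I_m -> H) (M : 'M_(m, n)) (N : 'M_(n, p)) :
  lin_comb (lin_comb e M) N =1 lin_comb e (M *m N).
Proof.
move=> j; rewrite /lin_comb.
under eq_bigr do rewrite scaler_sumr.
rewrite exchange_big; apply: eq_bigr => i _ /=.
rewrite mxE scaler_suml; apply: eq_bigr => k _.
by rewrite scalerA mulrC.
Qed.

Let lin_comb_inj m n (e : 'I_m -> H) (M N : 'M_(m, n)) :
  lin_indep e -> lin_comb e M =1 lin_comb e N -> M = N.
Proof.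
move=> ie eMN; apply/matrixP => i j; apply/eqP; rewrite -subr_eq0; apply/eqP.
apply: (ie (fun i => M i j - N i j)).
under eq_bigr do rewrite scalerBl.
by rewrite sumrB; apply/eqP; rewrite subr_eq0; apply/eqP/eMN.
Qed.

Let lin_comb1 n (e : 'I_n -> H) : lin_comb e 1%:M =1 e.
Proof.
move=> j; rewrite /lin_comb (bigD1 j)//= mxE eqxx scale1r big1 ?addr0//.
by move=> i /negbTE ij; rewrite mxE ij scale0r.
Qed.

Let basis_coord A m n (e : 'I_m -> H) (f : 'I_n -> H) :
  basis_of A e -> basis_of A f -> exists S : 'M_(m, n), f =1 lin_comb e S.
Proof.
move=> [_ ->] [indf /seteqP[_ fe]].
have /choice[c cE] : forall j, exists c : 'I_m -> R[i], \sum_i c i *: e i = f j.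
  move=> j; have [|c _ cE] := fe (f j); last by exists c.
  by exists (fun i => (1%:M : 'M_n) i j); last exact: (lin_comb1 f j).
exists (\matrix_(i, j) c j i) => j; rewrite -cE.
by apply: eq_bigr => i _; rewrite mxE.
Qed.

Lemma op_traceE (T : {linear H -> H}) n (e : 'I_n -> H) (M : 'M_n) :
  basis_of (range T) e -> (forall j, T (e j) = \sum_i M i j *: e i) ->
  op_trace T = \tr M.
Proof.
move=> be TeM; apply: xget_unique; first by exists n, e, M.
move=> _ [m [f [N [bf TfN ->]]]].
have [S fS] := basis_coord be bf; have [U eU] := basis_coord bf be.
have T_comb p q (g : 'I_p -> H) (W : 'M_(p, q)) j :
    T (lin_comb g W j) = lin_comb (T \o g) W j.
  by rewrite /lin_comb linear_sum; apply: eq_bigr => i _; rewrite linearZ.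
have comb_ext p q (g h : 'I_p -> H) (W : 'M_(p, q)) :
    g =1 h -> lin_comb g W =1 lin_comb h W.
  by move=> gh j; apply: eq_bigr => i _; rewrite gh.
have US : U *m S = 1%:M.
  apply: (lin_comb_inj bf.1) => j.
  by rewrite -lin_comb_mul lin_comb1 fS; apply: comb_ext => i; rewrite eU.
have SNM : S *m N = M *m S.
  apply: (lin_comb_inj be.1) => j.
  rewrite -!lin_comb_mul.
  transitivity (T (f j)).
    by rewrite TfN; apply: comb_ext => i; rewrite fS.
  by rewrite fS T_comb; apply: comb_ext => i; exact: TeM.
have SU : S *m U = 1%:M.
  apply: (lin_comb_inj be.1) => j.
  by rewrite -lin_comb_mul lin_comb1 eU; apply: comb_ext => i; rewrite fS.
by rewrite -[N]mul1mx -US -mulmxA SNM mulmxA mxtrace_mulC mulmxA SU mul1mx.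
Qed.

End FiniteDimension.

Section Operators.
Context {R : realType} {H : hilbertType R}.

(* Continuity is not required: an everywhere defined self-adjoint idempotent
   is a contraction. *)
Record projection (n : nat) := Projection {
  proj_op :> {linear H -> H};
  proj_idem : forall x, proj_op (proj_op x) = proj_op x;
  proj_self_adjoint : forall x y, inner (proj_op x) y = inner x (proj_op y);
  proj_rank : has_dim (range proj_op) n
}.

Definition is_linear (V : H -> H) : Prop := linear V.

Definition is_conj_linear (V : H -> H) : Prop :=
  linear_for (Num.conj \; *:%R) V.

Definition is_isometry (V : H -> H) : Prop :=
  (is_linear V \/ is_conj_linear V) /\ forall x, `|V x| = `|x|.

(* W is the adjoint V^* of V. *)
Definition is_adjoint (V W : H -> H) : Prop :=
  [/\ is_linear V, is_linear W
    & forall x y, inner (V x) y = inner x (W y)]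
  \/ [/\ is_conj_linear V, is_conj_linear W
    & forall x y, inner (V x) y = (inner x (W y))^*].

End Operators.

Arguments projection {R} H n.

(* Main.v *)
Require Import Defs.
From HB Require Import structures.
From mathcomp Require Import all_boot all_order all_algebra.
From mathcomp Require Import complex.
From mathcomp Require Import boolp classical_sets reals topology normedtype.
From mathcomp Require Import zify ring.

Set Implicit Arguments.
Unset Strict Implicit.
Unset Printing Implicit Defensive.

Import Order.TTheory GRing.Theory Num.Theory.
Import numFieldNormedType.Exports.

Local Open Scope classical_set_scope.
Local Open Scope ring_scope.

(** A map that preserves [Tr (P Q)] extends to a complex-linear map Phi on the
span of the projections: the Hilbert-Schmidt norm of a combination is a
quadratic expression in the numbers [Tr (P Q)], so a combination equal to 0 has
an image equal to 0 ([ev_map_ext]). As the dimension exceeds n, this span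
contains every operator [dyad u v], written [u v^*] below ([formal_dom_dyad]);
[Bop phi u v] is the image of [u v^*] under Phi. The point is to show that Phi
maps the projections [u u^*] on lines to projections on lines. Wigner's theorem
then gives a linear or conjugate-linear isometry V with
[Phi (u u^* ) = (V u) (V u)^*] ([wigner_dyads]), and summing over an orthonormal
basis of the range of P gives [phi P = V P V^*]. The adjoint [V^*] exists by
completeness ([inner_preserving_adjoint]).

Let [F i = Phi (e_i e_i^* )] for an orthonormal family e. The sum of any n of
the [F i] is a projection, and sums over disjoint index sets are orthogonal
because the trace of their product vanishes. With at least 2n + 1 indices, each
[F i] is a combination of sums that avoid any n given indices other than i;
hence different [F i] annihilate each other, and so every [F i] is idempotent
([hermitian_family_idem]). This settles dimensions above 2n ([Bop_idem_large]).
If the dimension N is finite and less than 2n, then [Phi 1 = 1], and the same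
argument applies to sums of N - n terms, the complements of projections of rank
n ([Bop_idem_small]).

In dimension 2n disjoint sums are complementary and the argument breaks down, as
it must: [u u^* |-> 1/n - u u^*] is compatible with all the hypotheses. Let
[N a b = Phi (e_a e_b^* )]. Rotating one vector of the range of a projection in
each of two orthogonal planes shows that [Phi (u v^* )] and [Phi (u' v'^* )]
anticommute for orthonormal u, v, u', v' and that [Phi (u v^* )] has square 0
([torus_idem]). Applied to rotated bases, this gives the anticommutation
relations of [half_dim_relations]. Since the trace form is nondegenerate, they
imply [{N a a - N b b, N c a} = tau N c a] with a scalar tau that does not
depend on the indices. Idempotency of the projections of rank n leaves tau = 0,
1 or -1; the value 0 would turn Phi into a representation of a Clifford algebra
with too many generators. For tau = 1 the [N a a] are idempotent, for tau = -1
the [1/n - N a a] are ([half_dim_idem]). The sign is the same for all bases,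
since any two unit vectors are orthogonal to a common one ([half_dim_cases]),
and the two signs correspond to the two forms of phi. *)

(** * Idempotent sums over subsets *)

Lemma subset_of_card (I : finType) (D : {set I}) (i : I) k :
  i \in D -> (k < #|D|)%N ->
  exists C : {set I}, [/\ C \subset D, i \in C & #|C| = k.+1].
Proof.
move=> iD kD; pose s := take k (enum (D :\ i)).
have us : uniq s by rewrite take_uniq ?enum_uniq.
have sD x : x \in s -> x \in D :\ i by move=> /mem_take; rewrite mem_enum.
have ss : size s = k.
  rewrite size_takel // -cardE.
  by move: kD; rewrite (cardsD1 i) iD.
exists (i |: [set x in s]); split.
- apply/fintype.subsetP => x; rewrite !inE => /orP[/eqP->//|/sD].
  by rewrite !inE => /andP[].
- by rewrite setU11.
rewrite cardsU1 inE; have -> : i \notin s.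
  by apply/negP => /sD; rewrite !inE eqxx.
by rewrite cardsE (card_uniqP us) ss.
Qed.

(** In a set of [n.+1] indices the sum of all terms equals each single term,
because the other [n] terms add up to 0; adding these equalities shows that
[n] times the sum of all terms is 0. *)
Lemma eq0_of_subset_sums (V : zmodType) (I : finType) (G : I -> V) n
    (C : {set I}) i :
  (forall x : V, x *+ n = 0 -> x = 0) -> (n < #|C|)%N -> i \in C ->
  (forall A : {set I}, A \subset C -> #|A| = n -> \sum_(j in A) G j = 0) ->
  G i = 0.
Proof.
move=> tf nC iC GA.
have [C' [sC' iC' cC']] := subset_of_card iC nC.
have S0 k : k \in C' -> \sum_(j in C') G j = G k.
  move=> kC'; rewrite (bigD1 k) //= -[RHS]addr0; congr (_ + _).
  apply: etrans (GA (C' :\ k) _ _).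
  - by apply: eq_bigl => j; rewrite !inE andbC.
  - by rewrite (fintype.subset_trans _ sC') // subsetDl.
  - by move: cC'; rewrite (cardsD1 k) kC' => -[].
have : \sum_(k in C') \sum_(j in C') G j = \sum_(k in C') G k.
  by apply: eq_bigr => k; apply: S0.
rewrite sumr_const cC' mulrS => /eqP.
rewrite -subr_eq0 addrAC subrr add0r => /eqP /tf.
by rewrite (S0 i).
Qed.

(** For a set [B] of [n] indices and [i] outside [B] there are [n.+1] indices
outside [B], among them [i], so [F i] annihilates the sum over [B]. The sets [B]
that avoid [i] then show that [F i] annihilates every other [F j]. *)
Lemma idem_of_subset_sums (T : pzRingType) (I : finType) (F : I -> T) n :
  (0 < n)%N -> (2 * n < #|I|)%N ->
  (forall x : T, x *+ n = 0 -> x = 0) ->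
  (forall A : {set I}, #|A| = n ->
     (\sum_(i in A) F i) * (\sum_(i in A) F i) = \sum_(i in A) F i) ->
  (forall A B : {set I}, #|A| = n -> #|B| = n -> A \subset ~: B ->
     (\sum_(i in A) F i) * (\sum_(i in B) F i) = 0) ->
  forall i, F i * F i = F i.
Proof.
move=> n_gt0 nI tf Pid P0.
have FP i (B : {set I}) : #|B| = n -> i \notin B ->
    F i * (\sum_(j in B) F j) = 0.
  move=> cB iB.
  apply: (@eq0_of_subset_sums _ _ (fun i => F i * (\sum_(j in B) F j)) n (~: B)).
  - exact: tf.
  - move: nI; rewrite -(cardsC B) cB; lia.
  - by rewrite inE.
  - by move=> A AB cA; rewrite -mulr_suml P0.
have FF i j : i != j -> F i * F j = 0.
  move=> ij.
  apply: (@eq0_of_subset_sums _ _ (fun j => F i * F j) n (~: [set i])).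
  - exact: tf.
  - move: nI; rewrite -(cardsC [set i]) cards1; lia.
  - by rewrite !inE eq_sym.
  - move=> A AB cA; rewrite -mulr_sumr FP //.
    by apply/negP => /(fintype.subsetP AB); rewrite !inE eqxx.
move=> i; apply/eqP; rewrite -subr_eq0; apply/eqP.
apply: (@eq0_of_subset_sums _ _ (fun i => F i * F i - F i) n [set: I]%SET) => //.
- by rewrite cardsT; lia.
- move=> A _ /Pid; rewrite sumrB => PA.
  apply/eqP; rewrite subr_eq0 -[X in _ == X]PA; apply/eqP.
  rewrite mulr_suml; apply: eq_bigr => k kA.
  rewrite mulr_sumr (bigD1 k) //= big1 ?addr0 //.
  by move=> j /andP[_ jk]; rewrite FF // eq_sym.
Qed.

(** * Anticommutators of matrices *)

Section MatrixEntries.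
Context {C : comNzRingType} {m p : nat}.
Lemma mxDE (A B : 'M[C]_(m, p)) i j : (A + B) i j = A i j + B i j.
Proof. by rewrite mxE. Qed.
Lemma mxNE (A : 'M[C]_(m, p)) i j : (- A) i j = - A i j.
Proof. by rewrite mxE. Qed.
Lemma mxZE a (A : 'M[C]_(m, p)) i j : (a *: A) i j = a * A i j.
Proof. by rewrite mxE. Qed.
Lemma mx0E i j : (0 : 'M[C]_(m, p)) i j = 0.
Proof. by rewrite mxE. Qed.
End MatrixEntries.

(** Linear identities between matrices in which products occur as atoms: in
terms of entries they are identities of a commutative ring. *)
Ltac mxentries := apply/matrixP => ? ?; rewrite ?(mxDE, mxNE, mxZE, mx0E, mulr2n).
Ltac mxring := mxentries; ring.
Ltac mxfield := mxentries; field.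

Definition acomm (T : pzRingType) (x y : T) := x * y + y * x.

Section Acomm.
Context {C : comNzRingType} {d : nat}.
Local Notation T := 'M[C]_d.+1.
Implicit Types x y z : T.
Lemma acommC x y : acomm x y = acomm y x.
Proof. by rewrite /acomm addrC. Qed.
Lemma acommDl x y z : acomm (x + y) z = acomm x z + acomm y z.
Proof. by rewrite /acomm mulrDl mulrDr; mxring. Qed.
Lemma acommDr x y z : acomm z (x + y) = acomm z x + acomm z y.
Proof. by rewrite /acomm mulrDl mulrDr; mxring. Qed.
Lemma acommNl x z : acomm (- x) z = - acomm x z.
Proof. by rewrite /acomm mulrN mulNr opprD. Qed.
Lemma acommNr x z : acomm z (- x) = - acomm z x.
Proof. by rewrite /acomm mulrN mulNr opprD. Qed.
Lemma acommZl a x z : acomm (a *: x) z = a *: acomm x z.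
Proof. by rewrite /acomm -scalerAl -scalerAr scalerDr. Qed.
Lemma acommZr a x z : acomm z (a *: x) = a *: acomm z x.
Proof. by rewrite /acomm -scalerAl -scalerAr scalerDr. Qed.
Lemma acomm0l x : acomm 0 x = 0.
Proof. by rewrite /acomm mul0r mulr0 addr0. Qed.
Lemma acomm_sumr I (r : seq I) (P : pred I) (F : I -> T) x :
  acomm x (\sum_(i <- r | P i) F i) = \sum_(i <- r | P i) acomm x (F i).
Proof. by rewrite /acomm mulr_sumr mulr_suml -big_split. Qed.
Lemma acomm_suml I (r : seq I) (P : pred I) (F : I -> T) x :
  acomm (\sum_(i <- r | P i) F i) x = \sum_(i <- r | P i) acomm (F i) x.
Proof. by rewrite /acomm mulr_sumr mulr_suml -big_split. Qed.
Lemma acommxx x : acomm x x = (x * x) *+ 2.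
Proof. by rewrite /acomm mulr2n. Qed.
Lemma acomm1l x : acomm 1 x = x *+ 2.
Proof. by rewrite /acomm mulr1 mul1r mulr2n. Qed.
(** The trace of [x y z + y x z] is symmetric in its three arguments. *)
Lemma mxtrace_acomm x y z : \tr (acomm x y * z) = \tr (x * acomm y z).
Proof.
rewrite /acomm mulrDl mulrDr !linearD /= !mulrA; congr (_ + _).
by rewrite -mulrA -[RHS]mxtrace_mulC.
Qed.
Lemma acomm_sqr x y : (x + y) * (x + y) = x * x + acomm x y + y * y.
Proof. by rewrite /acomm mulrDl !mulrDr; mxring. Qed.
End Acomm.

Definition acommE := (@acommDl, @acommDr, @acommNl, @acommNr, @acommZl, @acommZr).

Section Torus.
Context {C : numClosedFieldType} {d : nat}.
Local Notation T := 'M[C]_d.+1.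

Lemma addsub_eq0 (V : lmodType C) (a b : V) :
  a + b = 0 -> a - b = 0 -> a = 0 /\ b = 0.
Proof.
move=> ab0 /eqP; rewrite subr_eq0 => /eqP ab; move: ab0.
rewrite ab -mulr2n -scaler_nat => /eqP; rewrite scaler_eq0 pnatr_eq0 /= => /eqP.
by split.
Qed.

(** The hypotheses say that [Q + (z *: q - z^* *: p) = X] for [z] equal to 1,
-1 and ['i]. *)
Lemma sqr_of_rotations (Q X p q : T) :
  Q + (q - p) - X = 0 -> Q + (- q + p) - X = 0 -> Q + ('i *: q + 'i *: p) - X = 0 ->
  Q = X /\ p = 0.
Proof.
move=> h1 h2 h3.
have QX : Q - X = 0.
  have -> : Q - X = 2^-1 *: ((Q + (q - p) - X) + (Q + (- q + p) - X)) by mxfield.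
  by rewrite h1 h2 addr0 scaler0.
split; first by apply/eqP; rewrite -subr_eq0 QX.
have qp : q + p = 0.
  apply/eqP; rewrite -(inj_eq (scalerI (neq0Ci C))) scaler0 scalerDr.
  have -> : 'i *: q + 'i *: p = (Q + ('i *: q + 'i *: p) - X) - (Q - X) by mxring.
  by rewrite h3 QX subrr.
have [//|_ ->//] := addsub_eq0 qp; rewrite (_ : q - p = (Q + (q - p) - X) - (Q - X)).
  by rewrite h1 QX subrr.
by mxring.
Qed.

(** Adding the two hypotheses cancels every anticommutator that is odd under
the change of sign of [P], [Q] and [Y]. *)
Lemma acomm_of_opposite (D P Q X Y : T) :
  acomm (D - P + Q) (X - Y) = 0 -> acomm (D + P - Q) (X + Y) = 0 ->
  acomm P Y = 0 -> acomm D X = acomm Y Q.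
Proof.
rewrite !acommE => h1 h2 PY; rewrite PY in h1 h2; apply/eqP; rewrite -subr_eq0.
rewrite (acommC Y).
have -> : acomm D X - acomm Q Y = 2^-1 *:
   ((acomm D X - acomm D Y + (- acomm P X - - 0) + (acomm Q X - acomm Q Y)) +
    (acomm D X + acomm D Y + (acomm P X + 0) + (- acomm Q X - acomm Q Y))) by mxfield.
by rewrite h1 h2 addr0 scaler0.
Qed.

(** In the applications [c] is the adjoint of [b], and [s] runs over the unit
circle. *)
Definition circ (b c : T) (s : C) := s *: b + s^* *: c.

Lemma circN b c s : circ b c (- s) = - circ b c s.
Proof. by rewrite /circ rmorphN /=; mxring. Qed.

Lemma circ1 b c : circ b c 1 = b + c.
Proof. by rewrite /circ rmorph1 !scale1r. Qed.

Lemma circi b c : circ b c 'i = 'i *: (b - c).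
Proof. by rewrite /circ conjCi; mxring. Qed.

Lemma circ_acomm_eq0 (b c z : T) :
  (forall s, `|s| = 1 -> acomm (circ b c s) z = 0) -> acomm b z = 0.
Proof.
move=> H; have := H 1 (normr1 _); have := H 'i (normCi _).
rewrite circ1 circi acommZl acommDl acommDl acommNl => /eqP.
rewrite scaler_eq0 (negbTE (neq0Ci _)) /= => /eqP h2 h1.
by case: (addsub_eq0 h1 h2).
Qed.

Lemma circ_sqr (b c : T) (s : C) : `|s| = 1 ->
  circ b c s * circ b c s = s ^+ 2 *: (b * b) + acomm b c + (s ^* ^+ 2) *: (c * c).
Proof.
move=> s1; rewrite /circ acomm_sqr acommZl acommZr scalerA.
rewrite -normCK s1 expr1n scale1r -!scalerAl -!scalerAr !scalerA.
by rewrite -!expr2.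
Qed.

(** The coefficients of [s ^+ 2], [1] and [s^* ^+ 2] in the square are
separated by the values 1, ['i] and [sqrtC 'i] of [s]. *)
Lemma circ_sqr_const (b c k : T) :
  (forall s, `|s| = 1 -> circ b c s * circ b c s = k) -> b * b = 0.
Proof.
move=> H.
have w1 : `|sqrtC ('i : C)| = 1.
  apply/eqP; rewrite -(@pexpr_eq1 _ _ 2) // -normrX sqrtCK normCi //.
have h1 := H 1 (normr1 _); have hi := H 'i (normCi _); have hw := H _ w1.
move: h1 hi hw; rewrite !circ_sqr ?normr1 ?normCi ?w1 //.
rewrite -!rmorphXn /= sqrtCK expr1n rmorph1 sqrCi rmorphN rmorph1 conjCi.
rewrite !scale1r !scaleN1r => h1 hi hw.
have e1 : b * b + c * c = 0.
  suff -> : b * b + c * c = 2^-1 *: ((b * b + acomm b c + c * c)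
                                - (- (b * b) + acomm b c - c * c)).
    by rewrite h1 hi subrr scaler0.
  by mxfield.
have e2 : b * b - c * c = 0.
  suff -> : b * b - c * c = - 'i *: (('i *: (b * b) + acomm b c + - 'i *: (c * c))
     - 2^-1 *: ((b * b + acomm b c + c * c) + (- (b * b) + acomm b c - c * c))).
    rewrite hw h1 hi -mulr2n -[k *+ 2]scaler_nat scalerA mulVf ?pnatr_eq0 //.
    by rewrite scale1r subrr scaler0.
  mxentries.
  have i2 := sqrCi C.
  by field: i2.
by case: (addsub_eq0 e1 e2).
Qed.

(** Changing the signs of [s] and [s'] separates the parts of [y * y = y *+ 2]
that are odd and even in each circle. The part odd in both is the
anticommutator of the two circles; the even part shows that the square of a
point of the first circle does not depend on [s]. *)
Lemma torus_idem (k b c b' c' : T) :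
  (forall s s', `|s| = 1 -> `|s'| = 1 ->
     let y := k + circ b c s + circ b' c' s' in y * y = y *+ 2) ->
  b * b = 0 /\ acomm b b' = 0.
Proof.
move=> H.
have oddpart s s' : `|s| = 1 -> `|s'| = 1 ->
   let A := k + circ b c s in let x' := circ b' c' s' in
    A * A + x' * x' = A *+ 2 /\ acomm A x' = x' *+ 2.
  move=> s1 s1' A x'.
  have h2 : (A + x') * (A + x') = (A + x') *+ 2 := H s s' s1 s1'.
  have h1 : (A - x') * (A - x') = (A - x') *+ 2.
    by have := H s (- s') s1; rewrite normrN circN; apply.
  rewrite (acomm_sqr A x') in h2.
  rewrite (acomm_sqr A (- x')) acommNr mulrNN in h1; split.
    have -> : A * A + x' * x' = 2^-1 *: ((A * A + acomm A x' + x' * x') +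
         (A * A - acomm A x' + x' * x')) by mxfield.
    by rewrite h1 h2; mxfield.
  have -> : acomm A x' = 2^-1 *: ((A * A + acomm A x' + x' * x') -
         (A * A - acomm A x' + x' * x')) by mxfield.
  by rewrite h1 h2; mxfield.
have oddpart2 s s' : `|s| = 1 -> `|s'| = 1 -> acomm (circ b c s) (circ b' c' s') = 0.
  move=> s1 s1'; have [_ h1] := oddpart _ _ s1 s1'.
  have [] := oddpart (- s) s' _ s1'; first by rewrite normrN.
  move=> _; rewrite circN; move: h1.
  set x := circ b c s; set x' := circ b' c' s'.
  rewrite (acommDl k x) (acommDl k (- x)) acommNl => h1 h2.
  have -> : acomm x x' = 2^-1 *: ((acomm k x' + acomm x x') - (acomm k x' - acomm x x')).
    by mxfield.
  by rewrite h1 h2 subrr scaler0.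
split; last first.
  apply: (@circ_acomm_eq0 _ c) => s s1; rewrite acommC.
  by apply: (@circ_acomm_eq0 _ c') => s' s1'; rewrite acommC oddpart2.
apply: (@circ_sqr_const _ c (k *+ 2 - k * k - (b' + c') * (b' + c'))) => s s1.
set x := circ b c s.
have [h2 _] := oddpart s 1 s1 (normr1 _).
have [|h1 _] := oddpart (- s) 1 _ (normr1 _); first by rewrite normrN.
rewrite circ1 -/x (acomm_sqr k x) in h2.
rewrite circ1 circN -/x (acomm_sqr k (- x)) acommNr mulrNN in h1.
have -> : x * x = 2^-1 *: (
   (k * k + acomm k x + x * x + (b' + c') * (b' + c'))
   + (k * k - acomm k x + x * x + (b' + c') * (b' + c'))
   ) - k * k - (b' + c') * (b' + c') by mxfield.
by rewrite h1 h2; mxfield.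
Qed.
End Torus.

(** * Images of matrix units in twice the rank *)

Lemma exists_notin (I : finType) (s : seq I) : (size s < #|I|)%N ->
  exists x, x \notin s.
Proof.
move=> sI; apply/existsP; apply: contraLR sI => /existsPn sI.
rewrite -leqNgt (leq_trans _ (card_size s)) // subset_leq_card //.
by apply/fintype.subsetP => x _; have := sI x; rewrite negbK.
Qed.

Ltac neq := solve [assumption | rewrite eq_sym; assumption].

Ltac pairneq :=
  first [neq | rewrite xpair_eqE negb_and; apply/orP; first [left; neq | right; neq]].

(** [N a b] is the image of the matrix unit [e_a e_b^*] of an orthonormal basis.
The hypotheses are invariant under the replacement of [N a b] by
[(a == b)%:R / n%:R - N a b], so they cannot tell the two signs of
[half_dim_idem] apart. *)
Section HalfDimension.
Context {C : numClosedFieldType} {n d : nat}.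
Hypothesis n_ge2 : (2 <= n)%N.
Hypothesis dim_double : d.+1 = (2 * n)%N.
Local Notation T := 'M[C]_d.+1.
Variable N : 'I_d.+1 -> 'I_d.+1 -> T.
Let E a := N a a.
Let D a b := E a - E b.
Hypothesis trNN : forall a b c e, \tr (N a b * N c e) = ((a == e) && (b == c))%:R.
Hypothesis trN : forall a b, \tr (N a b) = (a == b)%:R.
Hypothesis sumE : \sum_a E a = 1.
Hypothesis acommNN : forall a b c e, a != b -> c != e -> a != e -> c != b ->
  acomm (N a b) (N c e) = 0.
Hypothesis sqrD : forall a b, a != b -> D a b * D a b = acomm (N a b) (N b a).
Hypothesis acommDab : forall a b, a != b -> acomm (D a b) (N a b) = 0.
Hypothesis acommDdisj : forall a b c e, a != b -> c != e -> a != c -> a != e ->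
  b != c -> b != e -> acomm (D a b) (N c e) = 0.
Hypothesis relR : forall a b c, a != b -> b != c -> a != c ->
  acomm (D a b) (N c a) = acomm (N c b) (N b a).
Hypothesis relL : forall a b c, a != b -> b != c -> a != c ->
  acomm (D c b) (N c a) = acomm (N c b) (N b a).
Hypothesis idemE : forall A : {set 'I_d.+1}, #|A| = n ->
  (\sum_(a in A) E a) * (\sum_(a in A) E a) = \sum_(a in A) E a.

Let card_d : (#|'I_d.+1| >= 4)%N.
Proof. rewrite card_ord dim_double; lia. Qed.

Let pick3 (a b c : 'I_d.+1) : exists x, [/\ x != a, x != b & x != c].
Proof.
have [|x] := @exists_notin 'I_d.+1 [:: a; b; c]; first exact: card_d.
by rewrite !inE !negb_or => /and3P[]; exists x.
Qed.

(** The [N a b] are orthonormal for the trace form, and as many as the matrix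
units. *)
Let span_full (X : T) : exists M : T, X = \sum_a \sum_b M a b *: N a b.
Proof.
pose f (M : T) := \sum_a \sum_b M a b *: N a b.
have fl : linear f.
  move=> k u v; rewrite /f scaler_sumr -big_split; apply: eq_bigr => a _ /=.
  rewrite scaler_sumr -big_split; apply: eq_bigr => b _ /=.
  by rewrite mxDE mxZE scalerDl scalerA.
pose flin := GRing.isLinear.Build _ _ _ _ f fl.
pose F : {linear T -> T} := HB.pack f flin.
have /lker0_limgf/esym fF : lker (linfun F) == 0%VS.
  apply/lker0P => x y; rewrite !lfunE /= => xy.
  apply/matrixP => a b.
  have coord (M : T) : \tr (f M * N b a) = M a b.
    rewrite /f mulr_suml linear_sum /= (bigD1 a) //=.
    rewrite mulr_suml linear_sum /= (bigD1 b) //= -scalerAl linearZ /= trNN !eqxx.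
    rewrite !big1 ?addr0 ?mulr1 // => [c ca|c cb].
      rewrite mulr_suml linear_sum big1 //= => e _.
      by rewrite -scalerAl linearZ /= trNN (negbTE ca) mulr0.
    by rewrite -scalerAl linearZ /= trNN eqxx (negbTE cb) mulr0.
  by rewrite -(coord x) xy coord.
have : X \in limg (linfun F) by rewrite -fF memvf.
by move=> /memv_imgP[M _ ->]; exists M; rewrite lfunE.
Qed.

Let tr_delta (X : T) a b : \tr (X * delta_mx b a) = X a b.
Proof.
rewrite /mxtrace (bigD1 a) //= big1 ?addr0 => [|c ca]; rewrite mxE (bigD1 b) //= mxE eqxx.
  rewrite eqxx mulr1 big1 ?addr0 // => c cb; by rewrite mxE (negbTE cb) mulr0.
rewrite (negbTE ca) /= mulr0 add0r big1 // => e eb; by rewrite mxE (negbTE eb) mulr0.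
Qed.

Let mxtraceB (X Y : T) : \tr (X - Y) = \tr X - \tr Y.
Proof. exact: linearB. Qed.

Let nondeg (X : T) : (forall a b, \tr (X * N a b) = 0) -> X = 0.
Proof.
move=> XN; apply/matrixP => a b; rewrite -tr_delta mx0E.
have [M ->] := span_full (delta_mx b a).
rewrite mulr_sumr linear_sum big1 //= => c _.
rewrite mulr_sumr linear_sum big1 //= => e _.
by rewrite -scalerAr linearZ /= XN mulr0.
Qed.

Let N_neq0 a b : N a b != 0.
Proof.
apply/eqP => N0; have := trNN a b b a; rewrite N0 mul0r linear0 !eqxx.
by move/esym/eqP; rewrite oner_eq0.
Qed.

Let tr_acomm x y : \tr (acomm x y : T) = \tr (x * y) *+ 2.
Proof. by rewrite /acomm linearD /= [\tr (y * x)]mxtrace_mulC mulr2n. Qed.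

(** In the end [G c b a = tau *: N c a]; its trace form with all [N x y] follows
from the two descriptions of [G c b a], by definition and by [GR]. *)
Let G c b a := acomm (N c b) (N b a).

Let GR a b c : a != c -> b != a -> b != c ->
  acomm (D a b) (N c a) = G c b a.
Proof. by move=> ac ba bc; apply: relR; rewrite //; neq. Qed.

Let GL a b c : a != c -> b != a -> b != c ->
  acomm (D c b) (N c a) = G c b a.
Proof. by move=> ac ba bc; apply: relL; rewrite //; neq. Qed.

(** [D a b - D a b' = D b' b] anticommutes with [N c a] because the two pairs of
indices are disjoint. *)
Let G_indep a b b' c : a != c -> b != a -> b != c -> b' != a -> b' != c ->
  G c b a = G c b' a.
Proof.
move=> ac ba bc b'a b'c; have [->//|bb'] := eqVneq b b'.
rewrite -(GR ac ba bc) -(GR ac b'a b'c).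
apply/eqP; rewrite -subr_eq0 -acommNl -acommDl; apply/eqP.
have -> : D a b - D a b' = D b' b by rewrite /D; mxring.
by rewrite acommDdisj //; neq.
Qed.

Let trD_G_offdiag a b c x : a != c -> b != a -> b != c ->
  x != a -> \tr (G c b a * D x a) = 0.
Proof.
move=> ac ba bc xa; have [->|xc] := eqVneq x c.
  rewrite -(GR ac ba bc) mxtrace_acomm acommC.
  by rewrite acommDab 1?eq_sym // mulr0 linear0.
rewrite (G_indep ac ba bc xa xc) /G mxtrace_acomm acommC.
by rewrite acommDab // mulr0 linear0.
Qed.

(** The [E x] sum to 1, so the traces [\tr (X * E x)] vanish if they are all
equal and [X] is traceless. *)
Let tr_diag (X : T) a : \tr X = 0 ->
  (forall x, x != a -> \tr (X * D x a) = 0) -> forall x, \tr (X * E x) = 0.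
Proof.
move=> X0 XD.
have gx z : \tr (X * E z) = \tr (X * E a).
  have [->//|za] := eqVneq z a; apply/eqP; rewrite -subr_eq0 -linearB /= -mulrBr.
  by rewrite XD.
have : \sum_z \tr (X * E z) = 0 by rewrite -linear_sum /= -mulr_sumr sumE mulr1.
under eq_bigr do rewrite gx.
rewrite sumr_const card_ord -mulr_natr => /eqP + x.
by rewrite mulf_eq0 pnatr_eq0 orbF gx => /eqP.
Qed.

(** The freedom in the choice of the middle index makes one of the two factors
of [G] anticommute with [N x y]. *)
Let G_pair a b c x y : a != c -> b != a -> b != c ->
  (x, y) != (a, c) -> \tr (G c b a * N x y) = 0.
Proof.
move=> ac ba bc xyac; have [<-|xy] := eqVneq x y.
  apply: (@tr_diag _ a) => [|z za]; last exact: trD_G_offdiag.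
  by rewrite /G tr_acomm trNN eq_sym (negbTE ac) mul0rn.
have [xa|xa] := eqVneq x a.
  have yc : y != c by move: xyac; rewrite xa xpair_eqE eqxx.
  have ay : a != y by rewrite -xa.
  rewrite /G [acomm (N c b) _]acommC mxtrace_acomm xa acommNN ?mulr0 ?linear0 //; neq.
have [b' [b'a b'c b'y]] := pick3 a c y.
rewrite (G_indep ac ba bc b'a b'c) /G mxtrace_acomm acommNN ?mulr0 ?linear0 //; neq.
Qed.

(** [t c b a] is invariant under cyclic permutations and does not depend on its
middle index; with at least four indices this makes it a constant. *)
Let t c b a := \tr (G c b a * N a c).

Let GE a b c : a != c -> b != a -> b != c -> G c b a = t c b a *: N c a.
Proof.
move=> ac ba bc; apply/eqP; rewrite -subr_eq0; apply/eqP/nondeg => x y.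
rewrite mulrBl linearB /= -scalerAl linearZ /= trNN.
have [[-> ->]|xy] := eqVneq (x, y) (a, c).
  by rewrite !eqxx mulr1 subrr.
rewrite (G_pair ac ba bc xy) [c == y]eq_sym [a == x]eq_sym.
by move: xy; rewrite xpair_eqE andbC => /negbTE ->; rewrite mulr0 subr0.
Qed.

Let t_cyc a b c : t c b a = t b a c.
Proof. by rewrite /t /G mxtrace_acomm mxtrace_mulC. Qed.

Let t_pair a b c b' : a != c -> b != a -> b != c -> b' != a -> b' != c ->
  t c b a = t c b' a.
Proof. by move=> ac ba bc b'a b'c; rewrite /t (G_indep ac ba bc b'a b'c). Qed.


Let t_step x y w u v : x != y -> y != w -> x != w -> u != x -> u != y ->
  v != y -> v != w -> t x u y = t y v w.
Proof.
move=> xy yw xw ux uy vy vw.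
have -> : t x u y = t x w y by apply: t_pair; neq.
by rewrite t_cyc t_cyc; apply: t_pair; neq.
Qed.

(** By [t_step] the scalars of the pairs [(x, y)] and [(y, w)] agree if [x], [y]
and [w] are distinct; a walk of such steps joins any two ordered pairs, also when
there are only four indices. *)
Let t_const x y u p q v : x != y -> p != q -> u != x -> u != y ->
  v != p -> v != q -> t x u y = t p v q.
Proof.
move=> xy pq ux uy vp vq.
have step a b c : a != b -> b != c -> a != c ->
    exists w, [/\ w != b, w != c & forall w', w' != a -> w' != b -> t a w' b = t b w c].
  move=> ab bc ac; have [w [wb wc _]] := pick3 b c c.
  exists w; split=> // w' w'a w'b; exact: t_step.
have walk a b : a != x -> a != y -> b != y -> b != a -> p != a -> p != b -> q != b ->
    t x u y = t p v q.
  move=> ax ay bby ba pa pb qb.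
  have [w1 [w1y w1a e1]] := step x y a xy ltac:(neq) ltac:(neq).
  have [w2 [w2a w2b e2]] := step y a b ltac:(neq) ltac:(neq) ltac:(neq).
  have [w3 [w3b w3p e3]] := step a b p ltac:(neq) ltac:(neq) ltac:(neq).
  have [w4 [w4p w4q e4]] := step b p q ltac:(neq) pq ltac:(neq).
  rewrite e1 // e2 // e3 // e4 //.
  by apply: t_pair; neq.
have [px|px] := boolP (p \in [:: x; y]).
  have [b [bby bp bq]] := pick3 y p q.
  have [a [ax ay ab]] := pick3 x y b.
  have pa : p != a by move: px; rewrite !inE => /orP[]/eqP->; rewrite eq_sym.
  by apply: (walk a b); neq.
move: px; rewrite !inE negb_or => /andP[px py].
have [qx|qx] := eqVneq q x.
  by rewrite qx in pq vq *; symmetry; apply: t_step; neq.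
have [a [ax ay ap]] := pick3 x y p.
by apply: (walk a x); neq.
Qed.

Let acomm_DN : exists tau, forall a b c, a != c -> b != a -> b != c ->
  acomm (D a b) (N c a) = tau *: N c a /\ acomm (D c b) (N c a) = tau *: N c a.
Proof.
have [x _] := @exists_notin 'I_d.+1 [::] (ltac:(by rewrite (leq_trans _ card_d))).
have [y [yx _ _]] := pick3 x x x.
have [u [ux uy _]] := pick3 x y y.
exists (t x u y) => a b c ac ba bc.
rewrite GR // GL // GE //; have -> // : t c b a = t x u y by apply: t_const; neq.
Qed.

Section Scalar.
Variable tau : C.
Hypothesis acommDtau : forall a b c, a != c -> b != a -> b != c ->
  acomm (D a b) (N c a) = tau *: N c a /\ acomm (D c b) (N c a) = tau *: N c a.

(** All [E x] with [x] different from [a] and [c] have the same anticommutator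
with [N c a], which is determined by the sum of the [E x] being 1. *)
Let acommEN a c x : a != c -> acomm (E x) (N c a) =
  ((1 - tau) / n%:R + tau * ((x == a) || (x == c))%:R) *: N c a.
Proof.
move=> ac; have [b [ba bc _]] := pick3 a c c.
pose w := acomm (E b) (N c a).
have Ew y : acomm (E y) (N c a) = w + (tau * ((y == a) || (y == c))%:R) *: N c a.
  have -> : E y = E b + D y b by rewrite /D; mxring.
  rewrite acommDl; congr (_ + _).
  have [->|ya] /= := eqVneq y a; first by rewrite mulr1 (acommDtau ac ba bc).1.
  have [->|yc] /= := eqVneq y c; first by rewrite mulr1 (acommDtau ac ba bc).2.
  have [->|yb] := eqVneq y b.
    by rewrite /D subrr acomm0l mulr0 scale0r.
  by rewrite mulr0 scale0r; apply: acommDdisj; neq.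
have : \sum_y acomm (E y) (N c a) = N c a *+ 2.
  by rewrite -acomm_suml sumE acomm1l.
under eq_bigr do rewrite Ew.
rewrite big_split /= sumr_const card_ord -scaler_suml (bigD1 a) //=.
rewrite (bigD1 c) ?(eq_sym c) //= !eqxx orbT big1 ?addr0; last first.
  by move=> y /andP[/negbTE-> /negbTE->]; rewrite mulr0.
rewrite !mulr1 -[w *+ d.+1]scaler_nat => sw; rewrite Ew scalerDl; congr (_ + _).
have n0 : (n%:R : C) != 0 by rewrite pnatr_eq0 -lt0n; lia.
have d2 : d.+1%:R = 2 * n%:R :> C by rewrite dim_double natrM.
have -> : w = (2 * n%:R)^-1 *: (d.+1%:R *: w + (tau + tau) *: N c a)
              - (tau / n%:R) *: N c a.
  by rewrite d2; mxfield.
by rewrite sw; mxfield.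
Qed.

(** For the projection [P] on [n] basis vectors that include those of indices
[a] and [c], [acomm P M = (1 + tau) *: M] where [M = N c a]; multiplying by [P]
on either side shows that [P] and [M] commute if [tau] is not 0. *)
Let tau_cases : tau = 0 \/ tau ^+ 2 = 1.
Proof.
have [c _] := @exists_notin 'I_d.+1 [::] (ltac:(by rewrite (leq_trans _ card_d))).
have [a [ac _ _]] := pick3 c c c.
have [A [aA cA nA]] : exists A : {set 'I_d.+1}, [/\ a \in A, c \in A & #|A| = n].
  have [||A [sA aA cA]] := @subset_of_card _ [set~ c] a n.-2.
  - by rewrite !inE.
  - by rewrite cardsC1 card_ord; move: dim_double; lia.
  exists (c |: A); rewrite !inE aA orbT eqxx; split=> //.
  rewrite cardsU1 cA; suff -> : c \notin A by lia.
  by apply/negP => /(fintype.subsetP sA); rewrite !inE eqxx.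
pose P := \sum_(x in A) E x; pose M := N c a.
have PP : P * P = P by exact: idemE.
have n0 : (n%:R : C) != 0 by rewrite pnatr_eq0 -lt0n; lia.
have PM : acomm P M = (1 + tau) *: M.
  rewrite acomm_suml; under eq_bigr do rewrite acommEN //.
  rewrite -scaler_suml big_split /= sumr_const nA -mulr_sumr; congr (_ *: _).
  rewrite (bigD1 a) //= (bigD1 c) ?cA ?(eq_sym c) //= !eqxx orbT big1; last first.
    by move=> y /andP[/andP[_ /negbTE->] /negbTE->].
  by rewrite mulr1n -mulr_natl; field.
have [->|t0] := eqVneq tau 0; [by left|right].
have h1 : P * M * P = tau *: (P * M).
  have : P * acomm P M = (1 + tau) *: (P * M) by rewrite PM scalerAr.
  rewrite /acomm mulrDr !mulrA PP => /(congr1 (fun Z => Z - P * M)).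
  by rewrite addrAC subrr add0r => ->; mxring.
have h2 : P * M * P = tau *: (M * P).
  have : acomm P M * P = (1 + tau) *: (M * P) by rewrite PM scalerAl.
  rewrite /acomm mulrDl -(mulrA M) PP => /(congr1 (fun Z => Z - M * P)).
  by rewrite addrK => ->; mxring.
have cPM : P * M = M * P.
  by apply: (scalerI t0); rewrite -h1 -h2.
have h3 : (P * M) *+ 2 = (1 + tau) *: M by rewrite -PM /acomm -cPM mulr2n.
have h4 : (1 - tau) *: (P * M) = 0.
  have : P * ((P * M) *+ 2) = (1 + tau) *: (P * M) by rewrite h3 scalerAr.
  rewrite mulrnAr mulrA PP => h; have -> : (1 - tau) *: (P * M) =
    (P * M) *+ 2 - (1 + tau) *: (P * M) by mxring.
  by rewrite h subrr.
have : (1 - tau ^+ 2) *: M = 0.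
  have -> : (1 - tau ^+ 2) *: M = (1 - tau) *: ((1 + tau) *: M) by mxring.
  rewrite -h3; have -> : (1 - tau) *: (P * M *+ 2) = ((1 - tau) *: (P * M)) *+ 2 by mxring.
  by rewrite h4 mul0rn.
move=> /eqP; rewrite scaler_eq0 (negbTE (N_neq0 _ _)) orbF subr_eq0.
by move=> /eqP.
Qed.

(** If [tau] were 0, every [N a b] would anticommute with every [D x y] and with
every [N x y] other than [N b a], like the generators of a Clifford algebra. The
squares of the [D a b] and of the [N e f + N f e] would be one and the same
nonzero scalar, and [D a b * N a c] would be orthogonal to every [N x y] for the
trace form: some [N e f + N f e] anticommutes with all three factors of the
product whose trace is to vanish. *)
Let tau_neq0 : tau != 0.
Proof.
apply/eqP => tau0.
have EN x c a : c != a -> acomm (E x) (N c a) = n%:R^-1 *: N c a.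
  by move=> ca; rewrite acommEN 1?eq_sym // tau0 mul0r addr0 subr0 mul1r.
have DN x y c a : c != a -> acomm (D x y) (N c a) = 0.
  by move=> ca; rewrite acommDl acommNl !EN // subrr.
have NN p q r s : p != q -> r != s -> (p, q) != (s, r) -> acomm (N p q) (N r s) = 0.
  move=> pq rs pqsr; have [qr|qr] := eqVneq q r.
    subst q; have ps : p != s by move: pqsr; rewrite xpair_eqE eqxx andbT.
    have -> : acomm (N p r) (N r s) = G p r s by [].
    by rewrite -GR ?DN //; neq.
  have [ps|ps] := eqVneq p s; last by apply: acommNN; neq.
  subst p; rewrite acommC; have -> : acomm (N r s) (N s q) = G r s q by [].
  by rewrite -GR ?DN //; neq.
have DD a c : a != c -> D a c * D a c = n%:R^-1 *: 1.
  move=> ac; apply/eqP; rewrite -subr_eq0; apply/eqP/nondeg => x y.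
  rewrite mulrBl linearB /= -scalerAl mul1r linearZ /= trN.
  have [<-|xy] := eqVneq x y.
    rewrite mulr1 sqrD // mxtrace_acomm acommC EN 1?eq_sym //.
    by rewrite -scalerAr linearZ /= trNN !eqxx mulr1 subrr.
  rewrite mulr0 subr0; have := mxtrace_acomm (D a c) (D a c) (N x y).
  rewrite DN // mulr0 linear0 acommxx mulrnAl linearMn => /eqP.
  by rewrite mulrn_eq0 => /eqP.
have zz e f : e != f -> (N e f + N f e) * (N e f + N f e) = n%:R^-1 *: 1.
  move=> ef; rewrite acomm_sqr -sqrD // DD //.
  have sq a b : a != b -> N a b * N a b = 0.
    move=> ab; have := acommNN ab ab ab ab.
    rewrite acommxx -scaler_nat => /eqP; rewrite scaler_eq0 pnatr_eq0 /=.
    by move=> /eqP.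
  by rewrite !sq // 1?eq_sym // add0r addr0.
have n0 : (n%:R : C) != 0 by rewrite pnatr_eq0 -lt0n; lia.
have tr3 e f (X Y Z : T) : e != f -> let z := N e f + N f e in
  acomm X z = 0 -> acomm Y z = 0 -> acomm Z z = 0 -> \tr (X * Y * Z) = 0.
  move=> ef z /eqP; rewrite /acomm addr_eq0 => /eqP Xz.
  move=> /eqP; rewrite addr_eq0 => /eqP Yz /eqP; rewrite addr_eq0 => /eqP Zz.
  have : \tr (X * Y * Z * (z * z)) = - \tr (X * Y * Z * (z * z)).
    rewrite {1}mulrA mxtrace_mulC.
    have -> : z *m (X * Y * Z * z) = - (X * Y * Z * (z * z)).
      rewrite -[_ *m _]/(z * _) !mulrA -[z * X]opprK -Xz.
      rewrite !mulNr -(mulrA X z) -[z * Y]opprK -Yz.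
      rewrite mulrN !mulNr opprK -!mulrA (mulrA z Z) -[z * Z]opprK -Zz.
      by rewrite mulNr !mulrN -!mulrA.
    by rewrite linearN.
  rewrite zz // -scalerAr mulr1 linearZ /= => /eqP.
  rewrite -addr_eq0 -mulr2n mulrn_eq0 /= mulf_eq0 invr_eq0 (negbTE n0).
  by move=> /eqP.
have [c _] := @exists_notin 'I_d.+1 [::] (ltac:(by rewrite (leq_trans _ card_d))).
have [a [ac _ _]] := pick3 c c c.
have [b [ba _ _]] := pick3 a a c.
have W0 : D a b * N a c = 0.
  apply: nondeg => x y; have [<-|xy] := eqVneq x y.
    apply: (@tr_diag _ a).
      have := tr_acomm (D a b) (N a c); rewrite DN // linear0 => /esym/eqP.
      by rewrite mulrn_eq0 => /eqP.
    move=> v va; have [w [wa wc _]] := pick3 a c c.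
    apply: (@tr3 a w); first neq.
    - by rewrite acommDr !DN ?addr0 // eq_sym.
    - by rewrite acommDr !NN ?addr0 //; pairneq.
    - by rewrite acommDr !DN ?addr0 // eq_sym.
  have [w [wa wc wxy]] := pick3 a c (if x == a then y else x).
  apply: (@tr3 a w); first neq.
  - by rewrite acommDr !DN ?addr0 // eq_sym.
  - by rewrite acommDr !NN ?addr0 //; pairneq.
  - have [xa|xa] := eqVneq x a.
      rewrite xa eqxx in wxy; have ay : a != y by rewrite -xa.
      by rewrite xa acommDr !NN ?addr0 //; pairneq.
    rewrite (negbTE xa) in wxy.
    by rewrite acommDr !NN ?addr0 //; pairneq.
have : D a b * (D a b * N a c) = 0 by rewrite W0 mulr0.
rewrite mulrA DD 1?eq_sym // -scalerAl mul1r => /eqP.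
by rewrite scaler_eq0 invr_eq0 (negbTE n0) (negbTE (N_neq0 _ _)).
Qed.

Let tau_sqr : tau ^+ 2 = 1.
Proof. by case: tau_cases => // t0; move: tau_neq0; rewrite t0 eqxx. Qed.

Let k : C := (1 - tau) / d.+1%:R.
(** For [tau = -1], [F a = n%:R^-1 - E a]. *)
Let F a : T := tau *: E a + k%:M.

Let dk : d.+1%:R * k = 1 - tau.
Proof. by rewrite /k mulrC divfK // pnatr_eq0. Qed.

Let EF a : E a = tau *: (F a - k%:M).
Proof. by rewrite /F addrK scalerA -expr2 tau_sqr scale1r. Qed.

Let FB a c : F a - F c = tau *: D a c.
Proof. by rewrite /F /D; mxring. Qed.

Let scalarE (a : C) : a%:M = a *: 1 :> T.
Proof. by rewrite -scalemx1. Qed.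

Let sumF : \sum_a F a = 1.
Proof.
rewrite big_split /= -scaler_sumr sumE sumr_const card_ord -[k%:M *+ _]scaler_nat.
rewrite [_ *: k%:M]scale_scalar_mx dk scalarE.
by rewrite -scalerDl addrC subrK scale1r.
Qed.

Let trF a : \tr (F a) = 1.
Proof.
rewrite /F linearD linearZ /= trN eqxx mxtrace_scalar -[k *+ _]mulr_natl dk.
by rewrite mulr1 addrC subrK.
Qed.

Let trFF a b : \tr (F a * F b) = (a == b)%:R.
Proof.
rewrite {2}/F mulrDr -scalerAr scalarE -scalerAr mulr1 linearD !linearZ /= trF.
rewrite {1}/F mulrDl -scalerAl scalarE -scalerAl mul1r linearD !linearZ /= trNN trN.
rewrite !eqxx andbb !mulr1.
have -> : tau * (tau * (a == b)%:R + k) + k = tau ^+ 2 * (a == b)%:R + (tau + 1) * k.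
  by ring.
have -> : (tau + 1) * k = (1 - tau ^+ 2) / d.+1%:R by rewrite /k; ring.
by rewrite tau_sqr subrr mul0r addr0 mul1r.
Qed.

Let acommFN a c x : a != c ->
  acomm (F x) (N c a) = ((x == a) || (x == c))%:R *: N c a.
Proof.
move=> ac; rewrite /F acommDl acommZl acommEN // scalarE acommZl acomm1l.
rewrite -[N c a *+ 2]scaler_nat !scalerA -scalerDl; congr (_ *: _).
have n0 : (n%:R : C) != 0 by rewrite pnatr_eq0 -lt0n; lia.
have -> : k = (1 - tau) / (2 * n%:R) by rewrite /k dim_double natrM.
set e := (_ || _)%:R; have -> : tau * ((1 - tau) / n%:R + tau * e) =
  (tau - tau ^+ 2) / n%:R + tau ^+ 2 * e by ring.
by rewrite tau_sqr; field.
Qed.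

Let trFN a x y : x != y -> \tr (F a * N x y) = 0.
Proof.
move=> xy; rewrite /F mulrDl -scalerAl scalarE -scalerAl mul1r linearD !linearZ /=.
rewrite trNN trN (negbTE xy) mulr0 addr0.
have [ay|] := eqVneq a y; last by rewrite mulr0.
by rewrite ay eq_sym (negbTE xy) mulr0.
Qed.

(** Both sides have the same trace form with every [N x y]; on the diagonal this
uses [sqrD] for the left-hand side. *)
Let sqrFB a c : a != c -> (F a - F c) * (F a - F c) = F a + F c.
Proof.
move=> ac; have DD : (F a - F c) * (F a - F c) = acomm (N a c) (N c a).
  by rewrite FB -scalerAl -scalerAr scalerA -expr2 tau_sqr scale1r sqrD.
apply/eqP; rewrite -subr_eq0; apply/eqP/nondeg => x y.
have [<-|xy] := eqVneq x y; last first.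
  rewrite mulrBl linearB /= (mulrDl (F a) (F c) (N x y)).
  rewrite [\tr (F a * _ + _)]mxtraceD !trFN // addr0 subr0.
  have := mxtrace_acomm (F a - F c) (F a - F c) (N x y).
  rewrite acommxx mulrnAl linearMn /= acommDl acommNl !acommFN 1?eq_sym //.
  rewrite -scalerBl -scalerAr linearZ /= (mulrBl (N x y)) mxtraceB !trFN // subr0 mulr0.
  by move/eqP; rewrite mulrn_eq0 => /eqP.
rewrite -/(E x) EF -scalerAr linearZ /= mulrBr linearB /=.
rewrite scalarE -scalerAr mulr1 linearZ /= mxtraceB mxtraceD !trF.
rewrite DD tr_acomm trNN !eqxx -mulr2n subrr mulr0 subr0.
rewrite mulrBl mxtraceB mxtrace_acomm [acomm (N c a) _]acommC acommFN //.
rewrite -scalerAr linearZ /= trNN !eqxx mulr1 mulrDl mxtraceD !trFF.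
rewrite (eq_sym x) (eq_sym x c).
have [<-|_] := eqVneq a x; first by rewrite eq_sym (negbTE ac) addr0 subrr mulr0.
by rewrite add0r subrr mulr0.
Qed.

(** By [sqrFB], the defects [g x = F x * F x - F x] satisfy
[g x + g y = acomm (F x) (F y)] for different [x] and [y]; the sum over [y] and
then over [x] determines them, as the [F y] sum to 1. *)
Let idemF a : F a * F a = F a.
Proof.
pose g x := F x * F x - F x; pose Gs := \sum_x g x.
have gg x y : x != y -> g x + g y = acomm (F x) (F y).
  move=> /sqrFB; rewrite acomm_sqr mulrNN acommNr => h.
  have -> : g x + g y = (F x * F x - acomm (F x) (F y) + F y * F y) +
      acomm (F x) (F y) - (F x + F y) by rewrite /g; mxring.
  by rewrite h; mxring.
have gG x : d.+1%:R *: g x + Gs = 0.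
  have : \sum_(y | y != x) (g x + g y) = \sum_(y | y != x) acomm (F x) (F y).
    by apply: eq_bigr => y yx; apply: gg; rewrite eq_sym.
  have -> : \sum_(y | y != x) acomm (F x) (F y) = - (g x *+ 2).
    rewrite -acomm_sumr; have -> : \sum_(y | y != x) F y = 1 - F x.
      by rewrite -sumF [in RHS](bigD1 x) //= addrAC subrr add0r.
    by rewrite acommDr acommNr acommxx acommC acomm1l /g; mxring.
  rewrite big_split /= sumr_const cardC1 card_ord.
  have -> : \sum_(y | y != x) g y = Gs - g x.
    by rewrite /Gs [in RHS](bigD1 x) //= addrAC subrr add0r.
  move=> h; have -> : d.+1%:R *: g x + Gs = (g x *+ d + (Gs - g x)) + g x *+ 2.
    by rewrite -[g x *+ d]scaler_nat (mulrS 1 d); mxring.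
  by rewrite h addNr.
have G0 : Gs = 0.
  have : \sum_x (d.+1%:R *: g x + Gs) = 0 by rewrite big1.
  rewrite big_split /= -scaler_sumr -/Gs sumr_const card_ord -[Gs *+ _]scaler_nat.
  rewrite -scalerDl => /eqP; rewrite scaler_eq0 -natrD pnatr_eq0 /=.
  by move=> /eqP.
have := gG a; rewrite G0 addr0 => /eqP; rewrite scaler_eq0 pnatr_eq0 /=.
by rewrite /g subr_eq0 => /eqP.
Qed.

Lemma half_dim_scalar_idem : (tau = 1 \/ tau = -1) /\
  forall a, let F := tau *: N a a + ((1 - tau) / d.+1%:R)%:M in F * F = F.
Proof.
split; last exact: idemF.
have := eqf_sqr tau 1; rewrite expr1n tau_sqr eqxx => /esym/orP[]/eqP; first by left.
by right.
Qed.
End Scalar.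

Lemma half_dim_idem : exists2 tau : C, tau = 1 \/ tau = -1 &
  forall a, let F := tau *: N a a + ((1 - tau) / d.+1%:R)%:M in F * F = F.
Proof.
by have [tau /half_dim_scalar_idem[]] := acomm_DN; exists tau.
Qed.
End HalfDimension.

(** * Orthonormal sequences *)

Section Inner.
Context {R : realType} {H : hilbertType R}.
Local Notation C := R[i].
Implicit Types (x y z u v : H) (a b : C).

Lemma innerDl x y z : inner (x + y) z = inner x z + inner y z.
Proof. exact: linearDl. Qed.
Lemma innerDr x y z : inner x (y + z) = inner x y + inner x z.
Proof. exact: linearDr. Qed.
Lemma innerZl a x y : inner (a *: x) y = a * inner x y.
Proof. exact: linearZl_LR. Qed.
Lemma innerZr a x y : inner x (a *: y) = a^* * inner x y.
Proof. exact: linearZr_LR. Qed.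
Lemma inner0l x : inner 0 x = 0. Proof. exact: linear0l. Qed.
Lemma inner0r x : inner x 0 = 0. Proof. exact: linear0r. Qed.
Lemma innerNl x y : inner (- x) y = - inner x y.
Proof. exact: linearNl. Qed.
Lemma innerNr x y : inner x (- y) = - inner x y.
Proof. exact: linearNr. Qed.
Lemma innerBl x y z : inner (x - y) z = inner x z - inner y z.
Proof. exact: linearBl. Qed.
Lemma innerBr x y z : inner x (y - z) = inner x y - inner x z.
Proof. exact: linearBr. Qed.
Lemma inner_suml I (r : seq I) (P : pred I) (F : I -> H) y :
  inner (\sum_(i <- r | P i) F i) y = \sum_(i <- r | P i) inner (F i) y.
Proof. exact: linear_sumlz. Qed.
Lemma inner_sumr I (r : seq I) (P : pred I) (F : I -> H) y :
  inner y (\sum_(i <- r | P i) F i) = \sum_(i <- r | P i) inner y (F i).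
Proof. exact: linear_sumr. Qed.
Lemma innerC x y : inner x y = (inner y x)^*.
Proof. by rewrite hermC expr0 mul1r. Qed.
Lemma inner_ge0 x : 0 <= inner x x. Proof. exact: dnorm_ge0. Qed.
Lemma inner_eq0 x : (inner x x == 0) = (x == 0). Proof. exact: dnorm_eq0. Qed.
Lemma inner_orthC x y : inner x y = 0 -> inner y x = 0.
Proof. by move=> xy; rewrite innerC xy rmorph0. Qed.
End Inner.

Definition innerE := (@innerDl, @innerDr, @innerNl, @innerNr, @innerZl, @innerZr).

Lemma indep_le_gen (R : realType) (H : hilbertType R) m k (e : 'I_m -> H)
    (f : 'I_k -> H) (A : 'M[R[i]]_(m, k)) :
  lin_indep e -> (forall i, e i = \sum_j A i j *: f j) -> (m <= k)%N.
Proof.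
move=> ie eA; rewrite leqNgt; apply/negP => km.
have : kermx A != 0.
  by rewrite kermx_eq0 /row_free neq_ltn (leq_ltn_trans (rank_leq_col A)).
move=> /rowV0Pn[u /sub_kermxP uA u0].
move/eqP: u0; apply; apply/rowP => i; rewrite mxE.
apply: (ie (fun i => u 0 i)).
under eq_bigr do rewrite eA scaler_sumr.
rewrite exchange_big big1 //= => j _.
under eq_bigr do rewrite scalerA.
rewrite -scaler_suml; move/rowP: uA => /(_ j); rewrite !mxE => ->.
by rewrite scale0r.
Qed.

Section OrthonormalSequences.
Context {R : realType} {H : hilbertType R}.
Local Notation C := R[i].
Implicit Types (x y z : H) (s t : seq H) (a b : C).

Fixpoint orthonormal s : Prop :=
  if s is x :: s' then
    [/\ inner x x = 1, forall y, y \in s' -> inner x y = 0 & orthonormal s']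
  else True.

(** The orthogonal projection on the span of [s] when [s] is orthonormal. *)
Definition oproj s x : H := \sum_(y <- s) inner x y *: y.

Lemma oproj_cons x s y : oproj (x :: s) y = inner y x *: x + oproj s y.
Proof. by rewrite /oproj big_cons. Qed.

Lemma oproj_is_linear s : linear (oproj s).
Proof.
move=> a x y; rewrite /oproj scaler_sumr -big_split; apply: eq_bigr => z _ /=.
by rewrite innerDl innerZl scalerDl scalerA.
Qed.
HB.instance Definition _ s := GRing.isLinear.Build C H H _ (oproj s) (oproj_is_linear s).

Lemma inner_oproj s x y : inner (oproj s x) y = inner x (oproj s y).
Proof.
rewrite inner_suml inner_sumr; apply: eq_bigr => z _.
by rewrite innerZl innerZr -innerC mulrC.
Qed.

Lemma inner_oproj_mem s x y : orthonormal s -> y \in s ->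
  inner (oproj s x) y = inner x y.
Proof.
elim: s => // z s IH [zz zs os]; rewrite inE oproj_cons innerDl innerZl.
move=> /orP[/eqP->|ys]; last by rewrite zs // mulr0 add0r IH.
rewrite zz mulr1 inner_suml big_seq big1 ?addr0 // => w ws.
by rewrite innerZl (inner_orthC (zs _ ws)) mulr0.
Qed.

Lemma oproj_mem s y : orthonormal s -> y \in s -> oproj s y = y.
Proof.
elim: s => // z s IH [zz zs os]; rewrite inE oproj_cons.
move=> /orP[/eqP->|ys].
  rewrite zz scale1r /oproj big_seq big1 ?addr0 // => w ws.
  by rewrite zs // scale0r.
by rewrite (inner_orthC (zs _ ys)) scale0r add0r IH.
Qed.

Lemma oproj_idem s x : orthonormal s -> oproj s (oproj s x) = oproj s x.
Proof.
move=> os; rewrite {2 3}/oproj linear_sum /=; apply: eq_big_seq => y ys.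
by rewrite linearZ /= oproj_mem.
Qed.

Lemma oproj_orth s x : (forall y, y \in s -> inner x y = 0) -> oproj s x = 0.
Proof.
by move=> xs; rewrite /oproj big_seq big1 // => y ys; rewrite xs // scale0r.
Qed.

Lemma orthonormal_extend s y : orthonormal s -> oproj s y != y ->
  exists a, let x := a *: (y - oproj s y) in
    orthonormal (x :: s) /\ oproj (x :: s) y = y.
Proof.
move=> os sy; pose r := y - oproj s y; pose a := (sqrtC (inner r r))^-1.
exists a => x.
have r0 : inner r r != 0 by rewrite inner_eq0 subr_eq0 eq_sym.
have a_ge0 : 0 <= a by rewrite invr_ge0 sqrtC_ge0 inner_ge0.
have a2 : a * a = (inner r r)^-1 by rewrite -expr2 exprVn sqrtCK.
have xx : inner x x = 1.
  by rewrite innerZl innerZr geC0_conj // mulrA a2 mulVf.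
have xs z : z \in s -> inner x z = 0.
  by move=> zs; rewrite innerZl innerBl inner_oproj_mem // subrr mulr0.
split; first by split.
rewrite oproj_cons; have -> : inner y x = inner r x.
  by rewrite innerBl inner_oproj oproj_orth // inner0r subr0.
by rewrite innerZr geC0_conj // scalerA mulrAC a2 mulVf // scale1r subrK.
Qed.

Definition subspace (K : H -> Prop) : Prop :=
  K 0 /\ forall a x y, K x -> K y -> K (a *: x + y).

Lemma subspaceZ K a x : subspace K -> K x -> K (a *: x).
Proof. by move=> [K0 KP] Kx; rewrite -[_ *: _]addr0; apply: KP. Qed.

Lemma subspace_oproj K s x : subspace K -> (forall y, y \in s -> K y) -> K (oproj s x).
Proof.
move=> KK Ks; rewrite /oproj big_seq; case: KK => K0 KP.
by elim/big_rec: _ => // y z ys Kz; apply: KP => //; apply: Ks.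
Qed.

Lemma oproj_extend x s y : orthonormal (x :: s) -> oproj s y = y -> oproj (x :: s) y = y.
Proof.
move=> [xx xs os] sy; rewrite oproj_cons sy -[in inner y x]sy.
rewrite inner_suml big_seq big1 ?scale0r ?add0r // => w ws.
by rewrite innerZl (inner_orthC (xs _ ws)) mulr0.
Qed.

(** Extends [s] by vectors that lie in every subspace containing [s] and [t]. *)
Lemma gram_schmidt s t : orthonormal s -> exists u,
  [/\ orthonormal (u ++ s), forall y, y \in t ++ s -> oproj (u ++ s) y = y
    & forall K, subspace K -> (forall y, y \in t ++ s -> K y) ->
        forall y, y \in u -> K y].
Proof.
move=> os; elim: t => [|y t [u [ou tu Ku]]].
  by exists [::]; split=> // y ys; apply: oproj_mem.
have [uy|uy] := eqVneq (oproj (u ++ s) y) y.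
  exists u; split=> // [z|K KK Kt z zu].
    by rewrite inE => /orP[/eqP->|/tu].
  by apply: Ku zu => // w wt; apply: Kt; rewrite inE wt orbT.
have [a /=] := orthonormal_extend ou uy; set x := _ *: _ => -[ox xy].
exists (x :: u); split=> // [z|K KK Kt z].
  by rewrite inE => /orP[/eqP->|/tu zu] //; apply: oproj_extend.
have Ku' w : w \in u -> K w.
  by apply: Ku => // v vt; apply: Kt; rewrite inE vt orbT.
rewrite inE => /orP[/eqP->|]; last exact: Ku'.
apply: subspaceZ => //; rewrite addrC -scaleN1r; apply: KK.2.
  apply: subspace_oproj => // w; rewrite mem_cat => /orP[/Ku'//|ws].
  by apply: Kt; rewrite inE mem_cat ws !orbT.
by apply: Kt; rewrite inE eqxx.
Qed.

Lemma orthonormal_nth s (i j : 'I_(size s)) : orthonormal s ->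
  inner (s`_i) (s`_j) = (i == j)%:R.
Proof.
suff os t p q : orthonormal t -> (p < size t)%N -> (q < size t)%N ->
    inner (t`_p) (t`_q) = (p == q)%:R by move=> /os ->.
elim: t p q => // x t IH [|p] [|q] [xx xs os] //= ps qs.
- by rewrite xs // mem_nth.
- by apply: inner_orthC; rewrite xs // mem_nth.
- by rewrite IH.
Qed.

Lemma orthonormalP s : orthonormal s <->
  [/\ uniq s, forall x, x \in s -> inner x x = 1 &
      forall x y, x \in s -> y \in s -> x != y -> inner x y = 0].
Proof.
elim: s => [|z s IH] /=; first by split.
split=> [[zz zs /IH[us ss os]]|[/andP[zs us] ss os]].
  split=> [|x|x y].
  - rewrite us andbT; apply/negP => /zs; rewrite zz => /eqP.
    by rewrite oner_eq0.
  - by rewrite inE => /orP[/eqP->//|/ss].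
  - rewrite !inE => /orP[/eqP->|xs] /orP[/eqP->|ys] xy.
    + by rewrite eqxx in xy.
    + exact: zs.
    + by apply/inner_orthC/zs.
    + exact: os.
split.
- by apply: ss; rewrite mem_head.
- move=> y ys; apply: os; rewrite ?inE ?eqxx ?ys ?orbT //.
  by apply: contraNneq zs => ->.
- apply/IH; split=> // [x xs|x y xs ys].
    by apply: ss; rewrite inE xs orbT.
  by apply: os; rewrite inE ?xs ?ys orbT.
Qed.

Lemma orthonormal_sub s t : uniq t -> {subset t <= s} -> orthonormal s -> orthonormal t.
Proof.
move=> ut ts /orthonormalP[_ ss os]; apply/orthonormalP; split=> // [x /ts/ss//|x y xt yt].
by apply: os; apply: ts.
Qed.

Lemma orthonormal_perm s t : perm_eq s t -> orthonormal s -> orthonormal t.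
Proof.
move=> st os; have /orthonormalP[us _ _] := os.
by apply: orthonormal_sub os; [rewrite -(perm_uniq st)|move=> x; rewrite (perm_mem st)].
Qed.

Lemma orthonormal_map (I : eqType) (f : I -> H) (r : seq I) :
  (forall i j, inner (f i) (f j) = (i == j)%:R) -> uniq r -> orthonormal (map f r).
Proof.
move=> of_; elim: r => //= i r IH /andP[ir ur]; split; last exact: IH.
  by rewrite of_ eqxx.
move=> _ /mapP[j jr ->]; rewrite of_; case: eqP => // ij.
by rewrite ij jr in ir.
Qed.

Lemma orthonormal_rem (s : seq H) y : orthonormal s -> orthonormal (rem y s).
Proof.
elim: s => //= x s IH [xx xs os]; case: ifP => // _.
by split=> // [z /mem_rem/xs|]; last exact: IH.
Qed.

Lemma orthonormal_drop k s : orthonormal s -> orthonormal (drop k s).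
Proof. by elim: s k => [|x s IH] [|k] // [_ _ /IH]; apply. Qed.

Lemma oproj_ord s x : oproj s x = \sum_(i < size s) inner x (s`_i) *: s`_i.
Proof. by rewrite /oproj (big_nth 0) big_mkord. Qed.

Lemma orthonormal_indep s : orthonormal s ->
  lin_indep (fun i : 'I_(size s) => s`_i).
Proof.
move=> os c c0 i; have := congr1 (inner^~ s`_i) c0.
rewrite inner0l inner_suml (bigD1 i) //= innerZl orthonormal_nth // eqxx mulr1.
rewrite big1 ?addr0 // => j ji.
by rewrite innerZl orthonormal_nth // (negbTE ji) mulr0.
Qed.

Lemma indep_le_orthonormal s m (e : 'I_m -> H) : lin_indep e ->
  (forall i, oproj s (e i) = e i) -> (m <= size s)%N.
Proof.
move=> ie es.
apply: (@indep_le_gen _ _ _ _ e (fun j : 'I_(size s) => s`_j)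
          (\matrix_(i, j) inner (e i) s`_j)) => // i.
by rewrite -[LHS]es oproj_ord; apply: eq_bigr => j _; rewrite mxE.
Qed.

Lemma lin_span_subspace n (e : 'I_n -> H) : subspace (lin_span e).
Proof.
split=> [|a x y [c _ <-] [c' _ <-]].
  by exists (fun=> 0) => //; rewrite big1 // => i _; rewrite scale0r.
exists (fun i => a * c i + c' i) => //.
rewrite scaler_sumr -big_split; apply: eq_bigr => i _ /=.
by rewrite scalerDl scalerA.
Qed.

Lemma lin_span_mem n (e : 'I_n -> H) i : lin_span e (e i).
Proof.
exists (fun j => (j == i)%:R) => //; rewrite (bigD1 i) //= eqxx scale1r.
by rewrite big1 ?addr0 // => j /negbTE->; rewrite scale0r.
Qed.

Lemma orthonormal_basis n (e : 'I_n -> H) : lin_indep e -> exists s,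
  [/\ orthonormal s, size s = n, forall i, oproj s (e i) = e i &
     forall y, y \in s -> lin_span e y].
Proof.
move=> ie; pose t := [seq e i | i <- enum 'I_n].
have [s] := @gram_schmidt [::] t I; rewrite !cats0 => -[os ts Ks].
have es i : oproj s (e i) = e i by apply: ts; rewrite map_f // mem_enum.
have sl y : y \in s -> lin_span e y.
  apply: Ks; first exact: lin_span_subspace.
  by move=> _ /mapP[i _ ->]; apply: lin_span_mem.
exists s; split=> //; apply/eqP; rewrite eqn_leq (indep_le_orthonormal ie) // andbT.
have /choice[c cE] (i : 'I_(size s)) : exists c : 'I_n -> C, \sum_j c j *: e j = s`_i.
  by have [|c _ <-] := sl s`_i; [rewrite mem_nth|exists c].
apply: (@indep_le_gen _ _ _ _ _ e (\matrix_(i, j) c i j) (orthonormal_indep os)) => i.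
by rewrite -cE; apply: eq_bigr => j _; rewrite mxE.
Qed.

(** A sequence shorter than [t] cannot span all vectors of [t], and the component
of such a vector orthogonal to the sequence extends it. *)
Lemma orthonormal_grow s t : orthonormal s -> orthonormal t ->
  (size s <= size t)%N -> exists u, orthonormal (u ++ s) /\ size (u ++ s) = size t.
Proof.
move=> os ot st.
suff : forall k, (k <= size t - size s)%N -> exists u, orthonormal (u ++ s) /\ size u = k.
  move=> /(_ _ (leqnn _))[u [ou su]]; exists u; split=> //.
  by rewrite size_cat su subnK.
elim=> [|k IH] kst; first by exists [::].
have [u [ou su]] := IH (ltnW kst).
have [/allP tu|/allPn[y yt /eqP uy]] := boolP (all (fun y => oproj (u ++ s) y == y) t).
  have := @indep_le_orthonormal (u ++ s) _ _ (orthonormal_indep ot).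
  rewrite size_cat su => H1; have : (size t <= k + size s)%N.
    by apply: H1 => i; apply/eqP/tu; rewrite mem_nth.
  lia.
have /eqP/(orthonormal_extend ou)[a /= [ox _]] := uy.
by exists (a *: (y - oproj (u ++ s) y) :: u); rewrite /= su.
Qed.
End OrthonormalSequences.

(** * Operators in orthonormal coordinates *)

Definition adjmx (C : numClosedFieldType) d (A : 'M[C]_d) : 'M[C]_d :=
  \matrix_(i, j) (A j i)^*.

Lemma mxtrace_mul_adjmx_eq0 (C : numClosedFieldType) d (A : 'M[C]_d) :
  \tr (A *m adjmx A) = 0 -> A = 0.
Proof.
have -> : \tr (A *m adjmx A) = \sum_i \sum_j `|A i j| ^+ 2.
  apply: eq_bigr => i _; rewrite mxE; apply: eq_bigr => j _.
  by rewrite mxE normCK.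
move=> tr0; apply/matrixP => i j; rewrite mxE; apply/eqP.
rewrite -normr_eq0 -sqrf_eq0.
have ge0 k l : 0 <= `|A k l| ^+ 2 by rewrite exprn_ge0.
move: tr0 => /psumr_eq0P; move/(_ (fun k _ => sumr_ge0 _ (fun l _ => ge0 k l))).
move/(_ i isT)/psumr_eq0P; move/(_ (fun l _ => ge0 i l))/(_ j isT) => ->.
by [].
Qed.

Section Coordinates.
Context {R : realType} {H : hilbertType R}.
Local Notation C := R[i].
Implicit Types (x y z u v : H) (a b : C).

Definition orthofam d (e : 'I_d -> H) : Prop :=
  forall i j, inner (e i) (e j) = (i == j)%:R.

Definition famproj d (e : 'I_d -> H) x : H := \sum_i inner x (e i) *: e i.

Lemma orthofam_nth s : orthonormal s -> orthofam (fun i : 'I_(size s) => s`_i).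
Proof. by move=> os i j; apply: orthonormal_nth. Qed.

(** The operator [u v^*]. *)
Definition dyad u v : H -> H := fun x => inner x v *: u.

Definition opmx d (e : 'I_d -> H) (M : 'M[C]_d) : H -> H :=
  fun x => \sum_i \sum_j (M i j * inner x (e j)) *: e i.

Definition mxop d (e : 'I_d -> H) (Y : H -> H) : 'M[C]_d :=
  \matrix_(i, j) inner (Y (e j)) (e i).

Lemma opmx_is_linear d (e : 'I_d -> H) M : linear (opmx e M).
Proof.
move=> a x y; rewrite /opmx scaler_sumr -big_split; apply: eq_bigr => i _ /=.
rewrite scaler_sumr -big_split; apply: eq_bigr => j _ /=.
by rewrite innerDl innerZl scalerA -scalerDl; congr (_ *: _); ring.
Qed.
HB.instance Definition _ d (e : 'I_d -> H) M :=
  GRing.isLinear.Build C H H _ (opmx e M) (opmx_is_linear e M).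

Lemma opmx_sum d (e : 'I_d -> H) I (r : seq I) (P : pred I) (F : I -> 'M_d) x :
  opmx e (\sum_(i <- r | P i) F i) x = \sum_(i <- r | P i) opmx e (F i) x.
Proof.
rewrite /opmx; under [RHS]eq_bigr do under eq_bigr do rewrite -scaler_suml.
rewrite [RHS]exchange_big; apply: eq_bigr => i _ /=; rewrite -scaler_suml.
rewrite -scaler_suml; congr (_ *: _); rewrite exchange_big; apply: eq_bigr => j _ /=.
by rewrite -mulr_suml summxE.
Qed.

Lemma opmxZ d (e : 'I_d -> H) a M x : opmx e (a *: M) x = a *: opmx e M x.
Proof.
rewrite /opmx scaler_sumr; apply: eq_bigr => i _; rewrite scaler_sumr.
by apply: eq_bigr => j _; rewrite mxE scalerA mulrA.
Qed.

Lemma opmxB d (e : 'I_d -> H) (A B : 'M_d) x :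
  opmx e (A - B) x = opmx e A x - opmx e B x.
Proof.
have -> : A - B = \sum_(b : bool) (if b then A else -1 *: B).
  by rewrite big_bool /= scaleN1r.
by rewrite opmx_sum big_bool /= opmxZ scaleN1r.
Qed.

Section Frame.
Context {d : nat} {e : 'I_d -> H}.
Hypothesis one : orthofam e.

Lemma inner_lincomb (c : 'I_d -> C) k : inner (\sum_i c i *: e i) (e k) = c k.
Proof.
rewrite inner_suml (bigD1 k) //= innerZl one eqxx mulr1 big1 ?addr0 // => i ik.
by rewrite innerZl one (negbTE ik) mulr0.
Qed.

Lemma inner_opmx M x i : inner (opmx e M x) (e i) = \sum_j M i j * inner x (e j).
Proof.
rewrite /opmx; under eq_bigr do rewrite -scaler_suml.
by rewrite inner_lincomb.
Qed.

Lemma opmxK M : mxop e (opmx e M) = M.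
Proof.
apply/matrixP => i j; rewrite mxE inner_opmx (bigD1 j) //= one eqxx mulr1.
by rewrite big1 ?addr0 // => k kj; rewrite one eq_sym (negbTE kj) mulr0.
Qed.

Lemma opmxM A B x : opmx e (A *m B) x = opmx e A (opmx e B x).
Proof.
rewrite {1 2}/opmx; apply: eq_bigr => i _; rewrite -!scaler_suml; congr (_ *: _).
under eq_bigr do rewrite mxE mulr_suml.
rewrite exchange_big; apply: eq_bigr => k _ /=.
by rewrite inner_opmx mulr_sumr; apply: eq_bigr => j _; rewrite mulrA.
Qed.

Lemma opmx_adjoint M x y :
  inner (opmx e M x) y = inner x (opmx e (adjmx M) y).
Proof.
rewrite /opmx inner_suml inner_sumr.
under eq_bigr do rewrite inner_suml.
rewrite exchange_big; apply: eq_bigr => j _ /=; rewrite inner_sumr.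
apply: eq_bigr => i _; rewrite innerZl innerZr mxE rmorphM /= conjCK -innerC.
ring.
Qed.

Lemma dyad_opmx u v : famproj e u = u -> famproj e v = v ->
  dyad u v = opmx e (\matrix_(i, j) (inner u (e i) * (inner v (e j))^*)).
Proof.
move=> eu ev; apply/funext => x; rewrite /dyad -[in LHS]eu -[in LHS]ev.
rewrite inner_sumr scaler_sumr; apply: eq_bigr => i _.
rewrite scalerA -scaler_suml; congr (_ *: _); rewrite mulr_suml.
apply: eq_bigr => j _; rewrite mxE innerZr; ring.
Qed.

(** A full-rank factorisation [M = S *m U] provides a basis of the range, namely
the columns of [S]; in it the operator acts by [U *m S], which has the same trace
as [S *m U]. *)
Lemma op_trace_opmx M : op_trace (opmx e M) = \tr M.
Proof.
have [S [U [MSU Sfull Ufree]]] : exists (S : 'M_(d, \rank M)) (U : 'M_(\rank M, d)),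
    [/\ S *m U = M, row_full S & row_free U].
  by exists (col_base M), (row_base M); rewrite mulmx_base col_base_full row_base_free.
pose f (k : 'I_(\rank M)) := \sum_i S i k *: e i.
have fc (c : 'I_(\rank M) -> C) : \sum_k c k *: f k =
    \sum_i (\sum_k S i k * c k) *: e i.
  rewrite /f; under eq_bigr do rewrite scaler_sumr.
  rewrite exchange_big; apply: eq_bigr => i _ /=; rewrite scaler_suml.
  by apply: eq_bigr => k _; rewrite scalerA mulrC.
have Tf x : opmx e M x = \sum_k (\sum_j U k j * inner x (e j)) *: f k.
  rewrite fc; apply: eq_bigr => i _; rewrite -scaler_suml; congr (_ *: _).
  rewrite -{1}MSU; under eq_bigr do rewrite mxE mulr_suml.
  rewrite exchange_big; apply: eq_bigr => k _ /=; rewrite mulr_sumr.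
  by apply: eq_bigr => j _; rewrite mulrA.
have indf : lin_indep f.
  move=> c; rewrite fc => c0 k.
  have : S *m (\col_k c k) = 0.
    apply/matrixP => i z; rewrite !mxE; have := congr1 (inner^~ (e i)) c0.
    rewrite inner0l inner_lincomb; apply: etrans.
    by apply: eq_bigr => l _; rewrite mxE.
  move/(congr1 (mulmx (pinvmx S))); rewrite mulmx0 mulmxA.
  rewrite mulVpmx // mul1mx => /matrixP/(_ k 0).
  by rewrite !mxE.
have bf : Defs.basis_of (range (opmx e M)) f.
  split=> //; apply/seteqP; split=> [_ [x _ <-]|_ [c _ <-]].
    by rewrite Tf; exists (fun k => \sum_j U k j * inner x (e j)).
  pose xi := pinvmx U *m (\col_k c k).
  exists (\sum_j xi j 0 *: e j) => //; rewrite Tf; apply: eq_bigr => k _.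
  congr (_ *: _); have : (U *m xi) k 0 = c k.
    by rewrite mulmxA mulmxVp // mul1mx mxE.
  rewrite mxE => <-; apply: eq_bigr => j _; congr (_ * _).
  by rewrite inner_lincomb.
rewrite (op_traceE (M := U *m S) bf); first by rewrite mxtrace_mulC MSU.
move=> k; rewrite [LHS]Tf; apply: eq_bigr => l _; rewrite mxE; congr (_ *: _).
apply: eq_bigr => j _; congr (_ * _).
by rewrite inner_lincomb.
Qed.
End Frame.

Lemma opmx_inj d (e : 'I_d -> H) (A B : 'M_d) : orthofam e ->
  (forall x, opmx e A x = opmx e B x) -> A = B.
Proof. by move=> oe /funext AB; rewrite -(opmxK oe A) AB opmxK. Qed.

Lemma famproj_opmx d (e : 'I_d -> H) (M : 'M_d) x : orthofam e ->
  famproj e (opmx e M x) = opmx e M x.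
Proof.
move=> oe; rewrite /famproj [RHS]/opmx; apply: eq_bigr => i _.
by rewrite inner_opmx // -scaler_suml.
Qed.

Lemma opmx_scalar d (e : 'I_d -> H) (k : C) x :
  famproj e x = x -> opmx e k%:M x = k *: x.
Proof.
move=> ex; rewrite -[in RHS]ex /famproj scaler_sumr; apply: eq_bigr => i _.
rewrite (bigD1 i) //= mxE eqxx big1 ?addr0 ?scalerA // => j ji.
by rewrite mxE eq_sym (negbTE ji) mul0r scale0r.
Qed.

Lemma orthofam_of_seq (s : seq H) m : orthonormal s -> size s = m ->
  orthofam (fun i : 'I_m => s`_i).
Proof. by move=> os <-; exact: orthofam_nth. Qed.

(** [Y] is linear, maps the span of [e] into itself and vanishes on its orthogonal
complement. *)
Definition in_frame d (e : 'I_d -> H) (Y : H -> H) := Y = opmx e (mxop e Y).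

Lemma in_frame_opmx d (e : 'I_d -> H) M : orthofam e -> in_frame e (opmx e M).
Proof. by move=> oe; rewrite /in_frame opmxK. Qed.
End Coordinates.

(** * Combinations of projections *)

(** Classical equality and choice, to form sequences of projections and to select
one of them. *)
HB.instance Definition _ (R : realType) (H : hilbertType R) n :=
  gen_eqMixin (projection H n).
HB.instance Definition _ (R : realType) (H : hilbertType R) n :=
  gen_choiceMixin (projection H n).

Section Extension.
Context {R : realType} {H : hilbertType R}.
Local Notation C := R[i].
Implicit Types (x y z u v : H) (a b : C).

Lemma oproj_famproj s x : oproj s x = famproj (fun i : 'I_(size s) => s`_i) x.
Proof. exact: oproj_ord. Qed.

Lemma projection_orthonormal n (P : projection H n) :
  exists s, [/\ orthonormal s, size s = n & forall x, P x = oproj s x].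
Proof.
have [e [ie re]] := proj_rank P.
have [s [os ss es se]] := orthonormal_basis ie.
have Pe y : lin_span e y -> P y = y by rewrite -re => -[x _ <-]; exact: proj_idem.
have sP y : range P y -> oproj s y = y.
  rewrite re => -[c _ <-]; rewrite linear_sum; apply: eq_bigr => i _.
  by rewrite linearZ /= es.
exists s; split=> // x; rewrite -[LHS]sP; last by exists x.
by apply: eq_big_seq => y ys; rewrite proj_self_adjoint Pe //; apply: se.
Qed.

Lemma projection_of_orthonormal n s : orthonormal s -> size s = n ->
  exists P : projection H n, forall x, P x = oproj s x.
Proof.
move=> os <-; have rk : has_dim (range (oproj s)) (size s).
  exists (fun i : 'I_(size s) => s`_i); split; first exact: orthonormal_indep.
  apply/seteqP; split=> [_ [x _ <-]|_ [c _ <-]].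
    by exists (fun i => inner x s`_i) => //; rewrite oproj_ord.
  exists (\sum_i c i *: s`_i) => //; rewrite linear_sum; apply: eq_bigr => i _.
  by rewrite linearZ /= oproj_mem // mem_nth.
by exists (@Projection _ _ _ (oproj s) (fun x => oproj_idem x os) (inner_oproj s) rk).
Qed.

Lemma frame_exists (t : seq H) : exists d (e : 'I_d -> H),
  orthofam e /\ forall y, y \in t -> famproj e y = y.
Proof.
have [s] := @gram_schmidt _ _ [::] t I; rewrite !cats0 => -[os ts _].
exists (size s), (fun i => s`_i); split; first exact: orthofam_nth.
by move=> y /ts; rewrite oproj_famproj.
Qed.

Lemma op_trace_dyad u v : op_trace (dyad u v) = inner u v.
Proof.
have [d [e [oe te]]] := frame_exists [:: u; v].
have eu : famproj e u = u by apply: te; rewrite mem_head.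
have ev : famproj e v = v by apply: te; rewrite !inE eqxx orbT.
rewrite (dyad_opmx eu ev) op_trace_opmx // -[in RHS]ev inner_sumr.
by apply: eq_bigr => i _; rewrite mxE innerZr mulrC.
Qed.

Lemma projection_in_frame n (P : projection H n) d (e : 'I_d -> H) s :
  orthofam e -> (forall x, P x = oproj s x) ->
  (forall y, y \in s -> famproj e y = y) -> in_frame e P.
Proof.
move=> oe Ps se.
pose M := \sum_(y <- s) \matrix_(i, j) (inner y (e i) * (inner y (e j))^*).
suff -> : (P : H -> H) = opmx e M by apply: in_frame_opmx.
apply/funext => x; rewrite Ps opmx_sum; apply: eq_big_seq => y ys.
by rewrite -dyad_opmx // se.
Qed.

(** Finitely many projections and vectors live in a common finite-dimensional
subspace, where operators are matrices. *)
Lemma common_frame n (ps : seq (projection H n)) (t : seq H) :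
  exists d (e : 'I_d -> H), [/\ orthofam e,
    forall P, P \in ps -> in_frame e P & forall y, y \in t -> famproj e y = y].
Proof.
have /choice[b bP] (P : projection H n) := projection_orthonormal P.
have [d [e [oe he]]] := frame_exists (flatten (map b ps) ++ t).
exists d, e; split=> // [P Pps|y yt]; last by rewrite he // mem_cat yt orbT.
have [_ _ Pb] := bP P; apply: (projection_in_frame oe Pb) => y yb.
by rewrite he // mem_cat; apply/orP; left; apply/flatten_mapP; exists P.
Qed.

Section Formal.
Variable n : nat.
Local Notation formal := (seq (C * projection H n)).
Implicit Types S : formal.

(** The operator that a formal combination stands for; different combinations
may stand for the same operator. *)
Definition ev S : H -> H := fun x => \sum_(cp <- S) cp.1 *: cp.2 x.

Definition conj_formal S : formal := [seq (cp.1^*, cp.2) | cp <- S].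

Definition mx_formal d (e : 'I_d -> H) S : 'M[C]_d :=
  \sum_(cp <- S) cp.1 *: mxop e cp.2.

Definition formal_in_frame d (e : 'I_d -> H) S :=
  forall P, P \in map snd S -> in_frame e P.

Lemma ev_opmx d (e : 'I_d -> H) S : formal_in_frame e S ->
  ev S = opmx e (mx_formal e S).
Proof.
move=> fS; apply/funext => x; rewrite opmx_sum; apply: eq_big_seq => -[c P] cP.
by rewrite opmxZ /= -fS //; apply/mapP; exists (c, P).
Qed.

Lemma mx_formal_conj d (e : 'I_d -> H) S :
  mx_formal e (conj_formal S) = adjmx (mx_formal e S).
Proof.
apply/matrixP => i j; rewrite mxE /mx_formal !summxE big_map rmorph_sum /=.
apply: eq_bigr => -[c P] _; rewrite !mxE rmorphM /=; congr (_ * _).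
by rewrite -innerC proj_self_adjoint.
Qed.

Lemma op_trace_ev S S' : op_trace (ev S \o ev S') =
  \sum_(cp <- S) \sum_(cp' <- S') cp.1 * cp'.1 * op_trace (cp.2 \o cp'.2).
Proof.
have [d [e [oe fr _]]] := common_frame (map snd S ++ map snd S') [::].
have fS P : P \in map snd S -> in_frame e P by move=> PS; apply: fr; rewrite mem_cat PS.
have fS' P : P \in map snd S' -> in_frame e P.
  by move=> PS; apply: fr; rewrite mem_cat PS orbT.
have op_comp A B : op_trace (opmx e A \o opmx e B) = \tr (A *m B).
  rewrite -(op_trace_opmx oe); congr op_trace; apply/funext => x.
  by rewrite opmxM.
rewrite !(@ev_opmx _ e) // op_comp /mx_formal mulmx_suml linear_sum /=.
apply: eq_big_seq => -[c P] cP; rewrite mulmx_sumr linear_sum.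
apply: eq_big_seq => -[c' P'] cP' /=; rewrite -scalemxAl -scalemxAr !linearZ /=.
rewrite mulrA -op_comp -fS -?fS' //; apply/mapP; first by exists (c', P').
by exists (c, P).
Qed.

(** In coordinates this trace is the sum of the squared moduli of the entries. *)
Lemma ev_eq0 S : op_trace (ev S \o ev (conj_formal S)) = 0 -> forall x, ev S x = 0.
Proof.
have [d [e [oe fr _]]] := common_frame (map snd S) [::].
rewrite !(@ev_opmx _ e) ?mx_formal_conj //; last first.
  by move=> P; rewrite -map_comp; apply: fr.
rewrite (_ : _ \o _ = opmx e (mx_formal e S *m adjmx (mx_formal e S))); last first.
  by apply/funext => x; rewrite opmxM.
rewrite op_trace_opmx // => /mxtrace_mul_adjmx_eq0 -> x.
by rewrite /opmx big1 // => i _; rewrite big1 // => j _; rewrite mxE mul0r scale0r.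
Qed.
End Formal.
End Extension.

(** * The linear extension of a trace-preserving map *)

Section LinearExtension.
Context {R : realType} {H : hilbertType R} {n : nat}.
Local Notation C := R[i].
Local Notation formal := (seq (C * projection H n)).
Implicit Types (x y z u v : H) (a b : C) (S : formal) (X Y : H -> H).
Variable phi : projection H n -> projection H n.
Hypothesis phi_trace : forall P Q : projection H n,
  op_trace (phi P \o phi Q) = op_trace (P \o Q).

Definition map_formal S : formal := [seq (cp.1, phi cp.2) | cp <- S].

Lemma op_trace_ev_map S S' :
  op_trace (ev (map_formal S) \o ev (map_formal S')) = op_trace (ev S \o ev S').
Proof.
rewrite !op_trace_ev big_map; apply: eq_bigr => cp _.
by rewrite big_map; apply: eq_bigr => cp' _; rewrite phi_trace.
Qed.

Lemma map_formal_conj S : map_formal (conj_formal S) = conj_formal (map_formal S).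
Proof. by rewrite /map_formal /conj_formal -!map_comp. Qed.

Lemma op_trace0 : op_trace (fun=> 0 : H) = 0.
Proof.
have e0 : orthofam (fun i : 'I_0 => 0 : H) by case.
have := op_trace_opmx e0 0; rewrite linear0; congr (_ = _).
by congr op_trace; apply/funext => x; rewrite /opmx big_ord0.
Qed.

(** The squared Hilbert-Schmidt norm of a combination is a quadratic expression
in the traces [op_trace (P \o Q)], which [phi] preserves. *)
Lemma ev_map_eq0 S : (forall x, ev S x = 0) -> forall x, ev (map_formal S) x = 0.
Proof.
move=> S0; apply: ev_eq0; rewrite -map_formal_conj op_trace_ev_map -[RHS]op_trace0.
by congr op_trace; apply/funext => x; rewrite /= S0.
Qed.

Lemma ev_cat S S' x : ev (S ++ S') x = ev S x + ev S' x.
Proof. by rewrite /ev big_cat. Qed.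

Definition scale_formal a S : formal := [seq (a * cp.1, cp.2) | cp <- S].

Lemma ev_scale a S x : ev (scale_formal a S) x = a *: ev S x.
Proof.
rewrite /ev big_map scaler_sumr; apply: eq_bigr => cp _.
by rewrite scalerA.
Qed.

Lemma map_formal_cat S S' : map_formal (S ++ S') = map_formal S ++ map_formal S'.
Proof. exact: map_cat. Qed.

Lemma map_formal_scale a S : map_formal (scale_formal a S) = scale_formal a (map_formal S).
Proof. by rewrite /map_formal /scale_formal -!map_comp. Qed.

Lemma ev_map_ext S S' : ev S = ev S' -> ev (map_formal S) = ev (map_formal S').
Proof.
move=> SS'; apply/funext => x; apply/eqP; rewrite -subr_eq0; apply/eqP.
have := @ev_map_eq0 (S ++ scale_formal (-1) S') _ x.
rewrite map_formal_cat map_formal_scale ev_cat ev_scale scaleN1r; apply => y.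
by rewrite ev_cat ev_scale scaleN1r SS' subrr.
Qed.

Definition formal_dom X := exists S, ev S = X.

(** The value does not depend on the chosen combination, see [ext_ev]. *)
Definition ext X : H -> H := ev (map_formal (xget [::] [set S | ev S = X])).

Lemma ext_ev S : ext (ev S) = ev (map_formal S).
Proof. by apply: ev_map_ext; case: xgetP => [//|/(_ S) /=]; case. Qed.

Lemma ev_lin a S S' :
  ev (scale_formal a S ++ S') = (fun x => a *: ev S x + ev S' x).
Proof. by apply/funext => x; rewrite ev_cat ev_scale. Qed.

Lemma formal_dom_lin a X Y : formal_dom X -> formal_dom Y ->
  formal_dom (fun x => a *: X x + Y x).
Proof. by move=> [S <-] [S' <-]; eexists; exact: ev_lin. Qed.

Lemma ext_lin a X Y x : formal_dom X -> formal_dom Y ->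
  ext (fun x => a *: X x + Y x) x = a *: ext X x + ext Y x.
Proof.
move=> [S <-] [S' <-]; rewrite -ev_lin !ext_ev map_formal_cat map_formal_scale.
by rewrite ev_cat ev_scale.
Qed.

Lemma formal_domD X Y : formal_dom X -> formal_dom Y -> formal_dom (fun x => X x + Y x).
Proof.
move=> dX dY; have := @formal_dom_lin 1 X Y dX dY.
by congr formal_dom; apply/funext => x; rewrite scale1r.
Qed.

Lemma formal_dom0 : formal_dom (fun=> 0).
Proof. by exists [::]; apply/funext => x; rewrite /ev big_nil. Qed.

Lemma formal_domZ a X : formal_dom X -> formal_dom (fun x => a *: X x).
Proof.
move=> dX; have := formal_dom_lin a dX formal_dom0.
by congr formal_dom; apply/funext => x; rewrite addr0.
Qed.

Lemma ext_projection (P : projection H n) : ext P = phi P.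
Proof.
have e : ev [:: (1, P)] = P.
  by apply/funext => x; rewrite /ev big_seq1 /= scale1r.
by rewrite -e ext_ev; apply/funext => x; rewrite /ev big_seq1 /= scale1r.
Qed.

Lemma ext_sum I (r : seq I) (F : I -> H -> H) : (forall i, formal_dom (F i)) ->
  forall x, ext (fun x => \sum_(i <- r) F i x) x = \sum_(i <- r) ext (F i) x.
Proof.
move=> dF; suff : formal_dom (fun x => \sum_(i <- r) F i x) /\
  forall x, ext (fun x => \sum_(i <- r) F i x) x = \sum_(i <- r) ext (F i) x by case.
elim: r => [|i r [dr er]].
  have -> : (fun x => \sum_(i <- [::]) F i x) = ev ([::] : formal).
    by apply/funext => x; rewrite /ev !big_nil.
  by split=> [|x]; [exists [::]|rewrite ext_ev /ev !big_nil].
have -> : (fun x => \sum_(j <- i :: r) F j x) = (fun x => 1 *: F i x + \sum_(j <- r) F j x).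
  by apply/funext => x; rewrite big_cons scale1r.
split; first exact: formal_dom_lin.
by move=> x; rewrite ext_lin // scale1r er big_cons.
Qed.

Lemma ext_adjoint X Y : formal_dom X -> formal_dom Y ->
  (forall x y, inner (X x) y = inner x (Y y)) ->
  forall x y, inner (ext X x) y = inner x (ext Y y).
Proof.
have adj S x y : inner (ev S x) y = inner x (ev (conj_formal S) y).
  rewrite /ev big_map inner_suml inner_sumr; apply: eq_bigr => -[c P] _ /=.
  by rewrite innerZl innerZr conjCK proj_self_adjoint.
move=> [S <-] [S' <-] SS' x y.
have <- : ev (conj_formal S) = ev S'.
  apply/funext => z; apply/eqP; rewrite -subr_eq0 -inner_eq0.
  by rewrite innerBr -adj SS' subrr.
by rewrite !ext_ev map_formal_conj adj.
Qed.

Lemma ext_trace2 X Y : formal_dom X -> formal_dom Y ->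
  op_trace (ext X \o ext Y) = op_trace (X \o Y).
Proof. by move=> [S <-] [S' <-]; rewrite !ext_ev op_trace_ev_map. Qed.

Lemma op_trace_ev1 S : op_trace (ev S) = \sum_(cp <- S) cp.1 * op_trace cp.2.
Proof.
have [d [e [oe fr _]]] := common_frame (map snd S) [::].
rewrite (@ev_opmx _ _ _ _ e) // op_trace_opmx // linear_sum.
apply: eq_big_seq => -[c P] cP /=; rewrite linearZ /=; congr (_ * _).
rewrite -(op_trace_opmx oe) -fr //.
by apply/mapP; exists (c, P).
Qed.

Lemma phi_trace1 P : op_trace (phi P) = op_trace P.
Proof.
have PP (Q : projection H n) : op_trace (Q \o Q) = op_trace Q.
  by congr op_trace; apply/funext => x; rewrite /= proj_idem.
by rewrite -PP phi_trace PP.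
Qed.

Lemma ext_trace X : formal_dom X -> op_trace (ext X) = op_trace X.
Proof.
move=> [S <-]; rewrite ext_ev !op_trace_ev1 big_map.
by apply: eq_bigr => cp _; rewrite phi_trace1.
Qed.

Lemma ext_common_frame I (r : seq I) (F : I -> H -> H) :
  (forall i, formal_dom (F i)) ->
  exists d (e : 'I_d -> H), orthofam e /\ forall i, List.In i r -> in_frame e (ext (F i)).
Proof.
move=> /choice[S SF].
have [d [e [oe fr _]]] :=
  common_frame (flatten [seq map snd (map_formal (S i)) | i <- r]) [::].
exists d, e; split=> // i ir.
rewrite -SF ext_ev (@ev_opmx _ _ _ _ e); first exact: in_frame_opmx.
move=> P PS; apply: fr; elim: r ir => //= j r IH [->|ir].
  by rewrite mem_cat PS.
by rewrite mem_cat IH ?orbT.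
Qed.
End LinearExtension.

(** * The extension on operators of rank one *)

Section DyadExtension.
Context {R : realType} {H : hilbertType R} {n : nat}.
Local Notation C := R[i].
Implicit Types (x y z u v w : H) (a b : C) (X Y : H -> H).
Hypothesis n_gt0 : (0 < n)%N.
Variable t0 : seq H.
Hypothesis ot0 : orthonormal t0.
Hypothesis st0 : size t0 = n.+1.
Variable phi : projection H n -> projection H n.
Hypothesis phi_trace : forall P Q : projection H n,
  op_trace (phi P \o phi Q) = op_trace (P \o Q).

Local Notation formal_dom := (@formal_dom R H n).

(** Complete [w] to [n.+1] orthonormal vectors. Leaving out one of them in turn
gives projections of rank [n] whose sum is [n] times the projection on the span
of all. *)
Lemma formal_dom_dyad_unit w : inner w w = 1 -> formal_dom (dyad w w).
Proof.
move=> w1; have ow : orthonormal [:: w] by split.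
have [|u [os su]] := orthonormal_grow ow ot0; first by rewrite st0.
set s := u ++ [:: w] in os su; have ws : w \in s by rewrite mem_cat mem_head orbT.
have /choice[P PE] y : exists P : projection H n, y \in s -> forall x, P x = oproj (rem y s) x.
  have [ys|//] := boolP (y \in s); last first.
    have [|P _] := @projection_of_orthonormal _ _ n (rem w s) (orthonormal_rem w os).
      by rewrite size_rem // su st0.
    by exists P.
  have [|P PE] := @projection_of_orthonormal _ _ n (rem y s) (orthonormal_rem y os).
    by rewrite size_rem // su st0.
  by exists P.
have PyE y x : y \in s -> P y x = oproj s x - inner x y *: y.
  by move=> ys; rewrite PE // /oproj (big_rem y ys) /= addrAC subrr add0r.
exists ((-1, P w) :: [seq (n%:R^-1, P y) | y <- s]).
apply/funext => x; rewrite /ev big_cons big_map /= -scaler_sumr.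
rewrite (eq_big_seq (fun y => oproj s x - inner x y *: y)) => [|y ys]; last exact: PyE.
rewrite sumrB PyE // -/(oproj s x).
rewrite big_const_seq count_predT iter_addr_0 su st0.
rewrite mulrSr addrK -[oproj s x *+ n]scaler_nat scalerA mulVf ?pnatr_eq0 -?lt0n //.
by rewrite scaleN1r scale1r opprB subrK.
Qed.

(** By the polarization identity. *)
Lemma formal_dom_dyad u v : formal_dom (dyad u v).
Proof.
have diag w : formal_dom (dyad w w).
  have [->|w0] := eqVneq w 0.
    have -> : dyad (0 : H) 0 = (fun=> 0).
      by apply/funext => x; rewrite /dyad scaler0.
    exact: formal_dom0.
  pose a := (sqrtC (inner w w))^-1.
  have n0 : sqrtC (inner w w) != 0 by rewrite sqrtC_eq0 inner_eq0.
  have a0 : 0 <= sqrtC (inner w w) by rewrite sqrtC_ge0 inner_ge0.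
  have aa : a * a^* = (inner w w)^-1.
    by rewrite geC0_conj ?invr_ge0 // -expr2 exprVn sqrtCK.
  have := @formal_domZ _ _ n (inner w w) _ (@formal_dom_dyad_unit (a *: w) _).
  rewrite innerZl innerZr mulrA aa mulVf ?inner_eq0 // => /(_ erefl).
  congr formal_dom; apply/funext => x; rewrite /dyad innerZr !scalerA.
  congr (_ *: _); rewrite (_ : _ * a = inner w w * (a * a^*) * inner x w); last by ring.
  by rewrite aa mulfV ?inner_eq0 // mul1r.
have D X Y := @formal_domD _ _ n X Y; have Z a X := @formal_domZ _ _ n a X.
pose g (e : C) := Z (4^-1 * e) _ (diag (u + e *: v)).
have := D _ _ (D _ _ (g 1) (g (-1))) (D _ _ (g 'i) (g (- 'i))).
congr formal_dom; apply/funext => x.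
have h e : (4^-1 * e) *: dyad (u + e *: v) (u + e *: v) x =
    (4^-1 * e * (inner x u + e^* * inner x v)) *: u +
    (4^-1 * e * (inner x u + e^* * inner x v) * e) *: v.
  by rewrite /dyad innerDr innerZr scalerDr !scalerDr !scalerA.
have hh (a b c d : C) : (a *: u + b *: v) + (c *: u + d *: v) = (a + c) *: u + (b + d) *: v.
  by rewrite addrACA -!scalerDl.
rewrite !h !hh !rmorphN /= conjCi rmorph1 /dyad -[RHS]addr0 -(scale0r v).
have i2 := sqrCi C.
by congr (_ *: _ + _ *: _); field: i2.
Qed.

Local Notation ext := (ext phi).
Definition Bop u v : H -> H := ext (dyad u v).

Lemma Bop_linl a u u' v x : Bop (a *: u + u') v x = a *: Bop u v x + Bop u' v x.
Proof.
rewrite /Bop -(ext_lin phi_trace a x (formal_dom_dyad u v) (formal_dom_dyad u' v)).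
congr (ext _ x); apply/funext => y.
by rewrite /dyad scalerDr !scalerA mulrC.
Qed.

Lemma Bop_linr a u v v' x : Bop u (a *: v + v') x = a^* *: Bop u v x + Bop u v' x.
Proof.
rewrite /Bop -(ext_lin phi_trace a^* x (formal_dom_dyad u v) (formal_dom_dyad u v')).
congr (ext _ x); apply/funext => y.
by rewrite /dyad innerDr innerZr scalerDl scalerA.
Qed.

Lemma Bop_adjoint u v x y : inner (Bop u v x) y = inner x (Bop v u y).
Proof.
apply: (ext_adjoint phi_trace); [exact: formal_dom_dyad..|] => {}x {}y.
by rewrite /dyad innerZl innerZr -innerC mulrC.
Qed.

Lemma Bop_trace u v : op_trace (Bop u v) = inner u v.
Proof. by rewrite ext_trace ?op_trace_dyad //; exact: formal_dom_dyad. Qed.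

Lemma Bop_trace2 u v u' v' :
  op_trace (Bop u v \o Bop u' v') = inner u' v * inner u v'.
Proof.
rewrite ext_trace2 //; [|exact: formal_dom_dyad..].
rewrite (_ : _ \o _ = dyad (inner u' v *: u) v').
  by rewrite op_trace_dyad innerZl.
by apply/funext => x; rewrite /dyad /= innerZl !scalerA.
Qed.

Lemma phi_Bop (P : projection H n) s : (forall x, P x = oproj s x) ->
  forall x, phi P x = \sum_(y <- s) Bop y y x.
Proof.
move=> Ps x; rewrite -(ext_projection phi_trace P).
have -> : (P : H -> H) = (fun x => \sum_(y <- s) dyad y y x).
  by apply/funext => y; rewrite Ps.
exact: (ext_sum phi_trace s (fun y => formal_dom_dyad y y)).
Qed.

Lemma Bop_frame (s : seq H) : exists d (e : 'I_d -> H),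
  orthofam e /\ forall y, y \in s -> in_frame e (Bop y y).
Proof.
have [d [e [oe he]]] := ext_common_frame phi_trace s (fun y => formal_dom_dyad y y).
exists d, e; split=> // y ys; apply: he.
by elim: s ys => //= z s IH; rewrite inE => /orP[/eqP->|/IH]; [left|right].
Qed.
End DyadExtension.

(** * Relations from rotations in planes *)

Section PlaneRotation.
Context {R : realType} {H : hilbertType R}.
Local Notation C := R[i].
Implicit Types (x y z u v w : H) (a b : C) (s t : seq H).

(** A scalar of modulus 1 / sqrt 2 without square roots. *)
Definition invsqrt2 : C := (1 + 'i) / 2.

Lemma invsqrt2_norm : invsqrt2 * invsqrt2^* = 2^-1.
Proof.
rewrite /invsqrt2 rmorphM rmorphD /= rmorph1 conjCi fmorphV rmorph_nat.
by have i2 := sqrCi C; field: i2.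
Qed.

Lemma invsqrt2_neq0 : invsqrt2 != 0.
Proof.
apply/eqP => h0; have := invsqrt2_norm; rewrite h0 mul0r => /esym/eqP.
by rewrite invr_eq0 pnatr_eq0.
Qed.

Lemma orthonormal_rot x y s a : `|a| = 1 -> orthonormal (x :: y :: s) ->
  orthonormal (invsqrt2 *: (x + a *: y) :: invsqrt2 *: (x - a *: y) :: s).
Proof.
move=> a1 [xx xys [yy ys os]].
have xy : inner x y = 0 by apply: xys; rewrite mem_head.
have yx : inner y x = 0 := inner_orthC xy.
have xs w : w \in s -> inner x w = 0 by move=> ws; apply: xys; rewrite inE ws orbT.
have aa : a * a^* = 1 by rewrite -normCK a1 expr1n.
have hh := invsqrt2_norm.
split; [|move=> w; rewrite inE => /orP[/eqP->|ws]|split=> // [|w ws]].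
- rewrite !innerE xx yy xy yx.
  have -> : invsqrt2 * (invsqrt2^* * (1 + a^* * 0) + a * (invsqrt2^* * (0 + a^* * 1))) =
    (invsqrt2 * invsqrt2^*) * (1 + a * a^*) by ring.
  by rewrite hh aa; field.
- rewrite !innerE xx yy xy yx; ring: aa.
- by rewrite !innerE xs // ys // !(mulr0, addr0).
- rewrite !innerE xx yy xy yx.
  transitivity ((invsqrt2 * invsqrt2^*) * (1 + a * a^*)); first by ring.
  by rewrite hh aa; field.
- by rewrite !innerE xs // ys // !(mulr0, oppr0, addr0).
Qed.
End PlaneRotation.

(** [B u v] is the image of [u v^*]; [Bplane] comes from rotations in two
orthogonal planes. All relations follow by applying [Bplane] to the vectors [rx]
and [ry] of a plane rotated by a phase, and comparing phases. *)
Section HalfRelations.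
Context {R : realType} {H : hilbertType R} {d : nat}.
Local Notation C := R[i].
Local Notation T := 'M[C]_d.+1.
Implicit Types (x y z u v w : H) (a b : C).
Variable B : H -> H -> T.
Hypothesis Blin : forall a u u' v, B (a *: u + u') v = a *: B u v + B u' v.
Hypothesis Blinr : forall a u v v', B u (a *: v + v') = a^* *: B u v + B u v'.
Hypothesis Bplane : forall u v u' v', orthonormal [:: u; v; u'; v'] ->
  B u v * B u v = 0 /\ acomm (B u v) (B u' v') = 0.
Variable e : 'I_d.+1 -> H.
Hypothesis oe : orthofam e.
Hypothesis d_ge3 : (3 <= d)%N.

Let B0l v : B 0 v = 0.
Proof.
have := Blin 1 0 0 v; rewrite scaler0 addr0 scale1r => /eqP.
by rewrite -subr_eq0 opprD addrA subrr sub0r oppr_eq0 => /eqP.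
Qed.

Let B0r v : B v 0 = 0.
Proof.
have := Blinr 1 v 0 0; rewrite scaler0 addr0 rmorph1 scale1r => /eqP.
by rewrite -subr_eq0 opprD addrA subrr sub0r oppr_eq0 => /eqP.
Qed.

Let BZl a u v : B (a *: u) v = a *: B u v.
Proof. by rewrite -[a *: u]addr0 Blin B0l addr0. Qed.
Let BZr a u v : B u (a *: v) = a^* *: B u v.
Proof. by rewrite -[a *: v]addr0 Blinr B0r addr0. Qed.
Let BDl u u' v : B (u + u') v = B u v + B u' v.
Proof. by rewrite -[u]scale1r Blin !scale1r. Qed.
Let BDr u v v' : B u (v + v') = B u v + B u v'.
Proof. by rewrite -[v]scale1r Blinr rmorph1 !scale1r. Qed.
Let BNl u v : B (- u) v = - B u v.
Proof. by rewrite -scaleN1r BZl scaleN1r. Qed.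
Let BNr u v : B u (- v) = - B u v.
Proof. by rewrite -scaleN1r BZr rmorphN rmorph1 scaleN1r. Qed.
Let BE := (BDl, BDr, BNl, BNr, BZl, BZr).

Lemma orthofam_dim_extend (s : seq H) : orthonormal s -> (size s <= 4)%N ->
  exists p, orthonormal (p ++ s) /\ size (p ++ s) = 4%N.
Proof.
move=> os s4; pose t := take 4 [seq e i | i <- enum 'I_d.+1].
have st : size t = 4%N by rewrite size_takel // size_map size_enum_ord.
have ot : orthonormal t.
  rewrite /t -map_take; apply: orthonormal_map => //.
  by rewrite take_uniq // enum_uniq.
by have := orthonormal_grow os ot; rewrite st; apply.
Qed.

Let Bsqr u v : orthonormal [:: u; v] -> B u v * B u v = 0.
Proof.
move=> o2; have [//|p [ou sp]] := orthofam_dim_extend o2.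
case: p ou sp => [|a [|b [|c p]]] ou; rewrite ?size_cat //= => sp; last by lia.
suff /Bplane[] : orthonormal [:: u; v; a; b] by [].
by apply: orthonormal_perm ou; rewrite (perm_catC [:: a; b] [:: u; v]).
Qed.

(** Polarization of [Bsqr], applied to the sum of [u] and [w]. *)
Let Bpolar_l u w v : orthonormal [:: u; w; v] -> acomm (B u v) (B w v) = 0.
Proof.
move=> o3.
have sq x y : orthonormal [:: x; y; v] -> B x v * B x v = 0.
  move=> [xx xy [yy yv vv]]; apply: Bsqr; split=> //= z; rewrite inE => /eqP->.
  by apply: xy; rewrite !inE eqxx orbT.
have o3' : orthonormal [:: w; u; v].
  by apply: orthonormal_perm o3; rewrite (perm_catCA [:: u] [:: w] [:: v]).
have := sq _ _ (orthonormal_rot (normr1 _) o3).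
rewrite scale1r BZl -scalerAl -scalerAr scalerA => /eqP.
rewrite scaler_eq0 mulf_eq0 (negbTE invsqrt2_neq0) /= BDl acomm_sqr.
by rewrite (sq _ _ o3) (sq _ _ o3') add0r addr0 => /eqP.
Qed.

Let Bpolar_r u w v : orthonormal [:: u; w; v] -> acomm (B v u) (B v w) = 0.
Proof.
move=> o3.
have sq x y : orthonormal [:: x; y; v] -> B v x * B v x = 0.
  move=> [xx xy [yy yv [vv _ _]]]; apply: Bsqr; split=> //= z; rewrite inE => /eqP->.
  by apply: inner_orthC; apply: xy; rewrite !inE eqxx orbT.
have o3' : orthonormal [:: w; u; v].
  by apply: orthonormal_perm o3; rewrite (perm_catCA [:: u] [:: w] [:: v]).
have := sq _ _ (orthonormal_rot (normr1 _) o3).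
rewrite scale1r BZr -scalerAl -scalerAr scalerA => /eqP.
rewrite scaler_eq0 mulf_eq0 conjC_eq0 (negbTE invsqrt2_neq0) /= BDr acomm_sqr.
by rewrite (sq _ _ o3) (sq _ _ o3') add0r addr0 => /eqP.
Qed.

Let N i j := B (e i) (e j).
Let D i j := N i i - N j j.

Let oseq (r : seq 'I_d.+1) : uniq r -> orthonormal [seq e i | i <- r].
Proof. exact: orthonormal_map. Qed.

Let acommNN i j k l : i != j -> k != l -> i != l -> k != j ->
  acomm (N i j) (N k l) = 0.
Proof.
move=> ij kl il kj.
have [<-|ik] := eqVneq i k; have [<-|jl] := eqVneq j l.
- by rewrite acommxx Bsqr ?mul0rn //; apply: (@oseq [:: i; j]); rewrite /= !inE ij.
- apply: Bpolar_r; apply: (@oseq [:: j; l; i]).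
  by rewrite /= !inE !negb_or jl (eq_sym j) ij (eq_sym l) il.
- apply: Bpolar_l; apply: (@oseq [:: i; k; j]).
  by rewrite /= !inE !negb_or ik ij kj.
have /Bplane[//] : orthonormal [:: e i; e j; e k; e l].
apply: (@oseq [:: i; j; k; l]).
by rewrite /= !inE !negb_or ij ik il jl kl (eq_sym j) kj.
Qed.

Let rx i j (a : C) := @invsqrt2 R *: (e i + a *: e j).
Let ry i j (a : C) := @invsqrt2 R *: (e i - a *: e j).

Let Brot i j a : `|a| = 1 -> B (rx i j a) (ry i j a) =
  2^-1 *: (D i j - a^* *: N i j + a *: N j i).
Proof.
move=> a1; rewrite !BE -/(N i i) -/(N j j) -/(N i j) -/(N j i) -invsqrt2_norm /D.
have aa : a * a^* = 1 by rewrite -normCK a1 expr1n.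
mxentries; ring: aa.
Qed.

Let cancel2 (x : T) : 2^-1 *: x = 0 -> x = 0.
Proof. by move=> /eqP; rewrite scaler_eq0 invr_eq0 pnatr_eq0 => /eqP. Qed.

Let cancel_conj_invsqrt2 (x : T) : (@invsqrt2 R)^* *: x = 0 -> x = 0.
Proof. by move=> /eqP; rewrite scaler_eq0 conjC_eq0 (negbTE invsqrt2_neq0) => /eqP. Qed.

Let Nsqr i j : i != j -> N i j * N i j = 0.
Proof. by move=> ij; apply: Bsqr; apply: (@oseq [:: i; j]); rewrite /= inE ij. Qed.

Let rot_sqr i j a : i != j -> `|a| = 1 ->
  D i j * D i j + (a *: acomm (D i j) (N j i) - a^* *: acomm (D i j) (N i j))
  - acomm (N i j) (N j i) = 0.
Proof.
move=> ij a1; pose W := a *: N j i - a^* *: N i j.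
have ouv : orthonormal [:: rx i j a; ry i j a].
  by apply: orthonormal_rot => //; apply: (@oseq [:: i; j]); rewrite /= inE ij.
have := Bsqr ouv; rewrite Brot // -scalerAl -scalerAr => /cancel2/cancel2.
have -> : D i j - a^* *: N i j + a *: N j i = D i j + W by rewrite /W; mxring.
have WW : W * W = - acomm (N i j) (N j i).
  rewrite /W acomm_sqr acommNr acommZl acommZr mulrNN -!scalerAl -!scalerAr.
  rewrite (Nsqr ij) (@Nsqr j i) 1?eq_sym // !scaler0 add0r addr0 scalerA -normCK a1 expr1n.
  by rewrite scale1r acommC.
by rewrite acomm_sqr WW /W acommDr acommNr !acommZr.
Qed.

Let rel_sqr i j : i != j ->
  D i j * D i j = acomm (N i j) (N j i) /\ acomm (D i j) (N i j) = 0.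
Proof.
move=> ij; have ji : j != i by rewrite eq_sym.
have h1 := rot_sqr ij (normr1 _).
have h2 := rot_sqr ij (etrans (normrN _) (normr1 _)).
have h3 := rot_sqr ij (normCi _).
move: h1 h2 h3; rewrite !rmorphN !rmorph1 conjCi !scaleN1r !scale1r !scaleNr !opprK.
exact: sqr_of_rotations.
Qed.

Let rel_disj i j k l : i != j -> k != l -> i != k -> i != l ->
  j != k -> j != l -> acomm (D i j) (N k l) = 0.
Proof.
move=> ij kl ik il jk jl.
have ouv : orthonormal [:: rx i j 1; ry i j 1; e k; e l].
  apply: orthonormal_rot; first exact: normr1.
  by apply: (@oseq [:: i; j; k; l]); rewrite /= !inE !negb_or ij ik il jk jl kl.
have [_] := Bplane ouv; rewrite Brot ?normr1 // acommZl => /cancel2.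
rewrite !acommE rmorph1 -/(N k l).
have -> : acomm (N i j) (N k l) = 0 by apply: acommNN; neq.
have -> : acomm (N j i) (N k l) = 0 by apply: acommNN; neq.
by rewrite !scaler0 subr0 addr0.
Qed.

Let rel_R i j k : i != j -> j != k -> i != k ->
  acomm (D i j) (N k i) = acomm (N k j) (N j i).
Proof.
move=> ij jk ik.
have ouv a : `|a| = 1 -> acomm (D i j - a^* *: N i j + a *: N j i) (N k i - a^* *: N k j) = 0.
  move=> a1; have o4 : orthonormal [:: rx i j a; ry i j a; e k].
    apply: orthonormal_rot => //.
    by apply: (@oseq [:: i; j; k]); rewrite /= !inE !negb_or ij ik jk.
  have /Bpolar_l : orthonormal [:: rx i j a; e k; ry i j a].
    by apply: orthonormal_perm o4; rewrite perm_cons (perm_catC [:: _] [:: _]).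
  rewrite Brot // acommZl => /cancel2.
  rewrite /ry BZr acommZr => /cancel_conj_invsqrt2.
  by rewrite BDr BNr BZr.
have h1 := ouv 1 (normr1 _); have h2 := ouv (-1) (etrans (normrN _) (normr1 _)).
move: h1 h2; rewrite !rmorphN !rmorph1 !scaleN1r !scale1r !opprK => h1 h2.
by apply: (acomm_of_opposite h1 h2); apply: acommNN; neq.
Qed.

Let rel_L i j k : i != j -> j != k -> i != k ->
  acomm (D k j) (N k i) = acomm (N k j) (N j i).
Proof.
move=> ij jk ik.
have ouv a : `|a| = 1 -> acomm (D k j - a^* *: N k j + a *: N j k) (N k i + a *: N j i) = 0.
  move=> a1; have o4 : orthonormal [:: rx k j a; ry k j a; e i].
    apply: orthonormal_rot => //.
    apply: (@oseq [:: k; j; i]).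
    by rewrite /= !inE !negb_or ![k == _]eq_sym jk ik [j == i]eq_sym ij.
  have /Bpolar_r : orthonormal [:: ry k j a; e i; rx k j a].
    by apply: orthonormal_perm o4; rewrite (perm_catC [:: _] [:: _; _]).
  rewrite Brot // acommZl => /cancel2.
  rewrite /rx BZl acommZr => /eqP; rewrite scaler_eq0 (negbTE invsqrt2_neq0) => /eqP.
  by rewrite BDl BZl.
have h1 := ouv 1 (normr1 _); have h2 := ouv (-1) (etrans (normrN _) (normr1 _)).
move: h1 h2; rewrite !rmorphN !rmorph1 !scaleN1r !scale1r !opprK => h1 h2.
rewrite addrAC in h1; rewrite addrAC in h2; rewrite [RHS]acommC.
by apply: (acomm_of_opposite h2 h1); apply: acommNN; neq.
Qed.

Lemma half_dim_relations :
  [/\ forall i j k l, i != j -> k != l -> i != l -> k != j -> acomm (N i j) (N k l) = 0,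
      forall i j, i != j -> D i j * D i j = acomm (N i j) (N j i) /\
        acomm (D i j) (N i j) = 0,
      forall i j k l, i != j -> k != l -> i != k -> i != l -> j != k -> j != l ->
        acomm (D i j) (N k l) = 0,
      forall i j k, i != j -> j != k -> i != k ->
        acomm (D i j) (N k i) = acomm (N k j) (N j i)
    & forall i j k, i != j -> j != k -> i != k ->
        acomm (D k j) (N k i) = acomm (N k j) (N j i)].
Proof.
split; [exact: acommNN|exact: rel_sqr|exact: rel_disj|exact: rel_R|exact: rel_L].
Qed.
End HalfRelations.

(** * Idempotency when the dimension is not twice the rank *)

Section HermitianFamily.
Context {C : numClosedFieldType}.

(** The trace of [P *m Q] is the squared norm of [P *m Q]. *)
Lemma mulmx_eq0_of_trace d (P Q : 'M[C]_d) : adjmx P = P -> adjmx Q = Q ->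
  P *m P = P -> Q *m Q = Q -> \tr (P *m Q) = 0 -> P *m Q = 0.
Proof.
move=> hP hQ PP QQ tr0; apply: mxtrace_mul_adjmx_eq0.
have -> : adjmx (P *m Q) = Q *m P.
  rewrite -[in RHS]hP -[in RHS]hQ; apply/matrixP => i j; rewrite !mxE rmorph_sum.
  by apply: eq_bigr => k _; rewrite !mxE rmorphM mulrC.
by rewrite mulmxA -(mulmxA P) QQ mxtrace_mulC mulmxA PP.
Qed.

Lemma adjmx_sum d I (r : seq I) (P : pred I) (F : I -> 'M[C]_d) :
  (forall i, adjmx (F i) = F i) ->
  adjmx (\sum_(i <- r | P i) F i) = \sum_(i <- r | P i) F i.
Proof.
move=> hF; apply/matrixP => i j; rewrite mxE !summxE rmorph_sum.
by apply: eq_bigr => k _; rewrite -[in RHS]hF mxE.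
Qed.

Lemma hermitian_family_idem d m k (F : 'I_m -> 'M[C]_d) :
  (0 < k)%N -> (2 * k < m)%N -> (forall i, adjmx (F i) = F i) ->
  (forall i j, \tr (F i *m F j) = (i == j)%:R) ->
  (forall A : {set 'I_m}, #|A| = k ->
     (\sum_(i in A) F i) *m (\sum_(i in A) F i) = \sum_(i in A) F i) ->
  forall i, F i *m F i = F i.
Proof.
move=> k0 km hF trF PA.
apply: (@idem_of_subset_sums 'M[C]_d 'I_m F k) => //.
- by rewrite card_ord.
- move=> x /eqP; rewrite -scaler_nat scaler_eq0 pnatr_eq0 -[k == _]negbK -lt0n k0.
  by move=> /eqP.
move=> A B cA cB dAB; apply: mulmx_eq0_of_trace; rewrite ?adjmx_sum ?PA //.
rewrite mulmx_suml linear_sum big1 //= => i iA.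
rewrite mulmx_sumr linear_sum big1 //= => j jB.
rewrite trF; case: eqP => // ij; move: dAB.
by move=> /fintype.subsetP/(_ i iA); rewrite inE ij jB.
Qed.
End HermitianFamily.

Section IdempotentImages.
Context {R : realType} {H : hilbertType R} {n : nat}.
Local Notation C := R[i].
Implicit Types (x y z u v w : H) (a b : C) (X Y : H -> H).
Hypothesis n_gt0 : (0 < n)%N.
Variable t0 : seq H.
Hypothesis ot0 : orthonormal t0.
Hypothesis st0 : size t0 = n.+1.
Variable phi : projection H n -> projection H n.
Hypothesis phi_trace : forall P Q : projection H n,
  op_trace (phi P \o phi Q) = op_trace (P \o Q).

Local Notation B := (Bop phi).

Definition Bmx d (e : 'I_d -> H) u v := mxop e (B u v).

Lemma Bmx_linl d (e : 'I_d -> H) a u u' v :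
  Bmx e (a *: u + u') v = a *: Bmx e u v + Bmx e u' v.
Proof.
apply/matrixP => i j; rewrite !mxE.
by rewrite (Bop_linl n_gt0 ot0 st0 phi_trace) innerDl innerZl.
Qed.

Lemma Bmx_linr d (e : 'I_d -> H) a u v v' :
  Bmx e u (a *: v + v') = a^* *: Bmx e u v + Bmx e u v'.
Proof.
apply/matrixP => i j; rewrite !mxE.
by rewrite (Bop_linr n_gt0 ot0 st0 phi_trace) innerDl innerZl.
Qed.

Lemma Bmx_adj d (e : 'I_d -> H) u v : adjmx (Bmx e u v) = Bmx e v u.
Proof.
apply/matrixP => i j; rewrite !mxE.
by rewrite (Bop_adjoint n_gt0 ot0 st0 phi_trace) -innerC.
Qed.

Lemma Bmx_trace d (e : 'I_d -> H) u v : orthofam e -> in_frame e (B u v) ->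
  \tr (Bmx e u v) = inner u v.
Proof.
move=> oe fr; rewrite -(op_trace_opmx oe) -fr.
exact: (Bop_trace n_gt0 ot0 st0 phi_trace).
Qed.

Lemma Bmx_trace2 d (e : 'I_d -> H) u v u' v' : orthofam e ->
  in_frame e (B u v) -> in_frame e (B u' v') ->
  \tr (Bmx e u v *m Bmx e u' v') = inner u' v * inner u v'.
Proof.
move=> oe fr fr'; rewrite -(op_trace_opmx oe).
rewrite -(Bop_trace2 n_gt0 ot0 st0 phi_trace); congr op_trace.
by apply/funext => x; rewrite opmxM //= [in RHS]fr' [in RHS]fr.
Qed.

Lemma Bmx_idem d (e : 'I_d -> H) s : orthofam e -> orthonormal s -> size s = n ->
  (forall y, y \in s -> in_frame e (B y y)) ->
  (\sum_(y <- s) Bmx e y y) *m (\sum_(y <- s) Bmx e y y) = \sum_(y <- s) Bmx e y y.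
Proof.
move=> oe os sn fr; have [P PE] := projection_of_orthonormal os sn.
have phiP : (phi P : H -> H) = opmx e (\sum_(y <- s) Bmx e y y).
  apply/funext => x; rewrite (phi_Bop n_gt0 ot0 st0 phi_trace PE) opmx_sum.
  by apply: eq_big_seq => y ys; rewrite -fr.
rewrite -[LHS](opmxK oe) -[RHS](opmxK oe); congr mxop; apply/funext => x.
by rewrite opmxM // -phiP proj_idem.
Qed.

Lemma Bmx_family_idem d (e : 'I_d -> H) m (f : 'I_m -> H) (A : {set 'I_m}) :
  orthofam e -> orthofam f -> (forall i, in_frame e (B (f i) (f i))) -> #|A| = n ->
  let P := \sum_(i in A) Bmx e (f i) (f i) in P *m P = P.
Proof.
move=> oe of_ fr cA P.
have := @Bmx_idem _ e [seq f i | i <- enum A] oe.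
rewrite big_map big_enum /=; apply; last by move=> _ /mapP[i _ ->].
- by apply: orthonormal_map => //; exact: enum_uniq.
- by rewrite size_map -cardE.
Qed.

Lemma Bop_idem_of_mx d (e : 'I_d -> H) u : orthofam e -> in_frame e (B u u) ->
  Bmx e u u *m Bmx e u u = Bmx e u u -> forall x, B u u (B u u x) = B u u x.
Proof. by move=> oe -> h x; rewrite -opmxM // -/(Bmx e u u) h. Qed.

Lemma orthonormal_basis_with u (t : seq H) : inner u u = 1 -> orthonormal t -> (0 < size t)%N ->
  exists s, [/\ orthonormal s, size s = size t & u \in s].
Proof.
move=> u1 ot t0'; have ou : orthonormal [:: u] by [].
have [//|p [op sp]] := orthonormal_grow ou ot.
by exists (p ++ [:: u]); rewrite mem_cat mem_head orbT.
Qed.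

(** A unit vector is part of an orthonormal family of [(2 * n).+1] vectors. *)
Lemma Bop_idem_large (t : seq H) : orthonormal t -> size t = (2 * n).+1 ->
  forall u, inner u u = 1 -> forall x, B u u (B u u x) = B u u x.
Proof.
move=> ot st u u1.
have [|s [os ss us]] := orthonormal_basis_with u1 ot; first by rewrite st.
rewrite st in ss.
have [d [e [oe fr]]] := Bop_frame n_gt0 ot0 st0 phi_trace s.
have of_ := orthofam_of_seq os ss; set f := fun i => _ in of_.
have ff i : in_frame e (B (f i) (f i)) by apply: fr; rewrite mem_nth // ss.
apply: (Bop_idem_of_mx oe (fr _ us)).
have ui : (index u s < (2 * n).+1)%N by rewrite -ss index_mem.
have -> : u = f (Ordinal ui) by rewrite /f /= nth_index.
apply: (@hermitian_family_idem _ d _ n (fun i => Bmx e (f i) (f i))) => //.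
- by move=> i; rewrite Bmx_adj.
- by move=> i j; rewrite Bmx_trace2 // !of_ (eq_sym j) -natrM mulnb andbb.
- by move=> A; apply: Bmx_family_idem.
Qed.

Section Finite.
Variables (N : nat) (e : 'I_N -> H).
Hypothesis oe : orthofam e.
Hypothesis efull : forall x, famproj e x = x.

Lemma Bop_linear u v : linear (B u v).
Proof.
have [d [e' [oe' fr]]] := ext_common_frame phi_trace [:: (u, v)]
  (fun p => formal_dom_dyad n_gt0 ot0 st0 p.1 p.2).
have -> : B u v = opmx e' (mxop e' (B u v)) := fr (u, v) (or_introl erefl).
exact: opmx_is_linear.
Qed.

Lemma in_frame_full u v : in_frame e (B u v).
Proof.
pose lin := GRing.isLinear.Build _ _ _ _ (B u v) (Bop_linear u v).
pose F : {linear H -> H} := HB.pack (B u v) lin.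
apply/funext => x; rewrite -[LHS]efull /famproj; apply: eq_bigr => i _.
rewrite -scaler_suml; congr (_ *: _).
rewrite -{1}[x]efull -[B u v _]/(F _) linear_sum inner_suml.
by apply: eq_bigr => j _; rewrite mxE linearZ /= innerZl mulrC.
Qed.

(** The sum [J] has trace [N], and so has [J *m J], so the squared norm of
[J - 1%:M] is 0. *)
Lemma Bmx_sum1 (f : 'I_N -> H) : orthofam f -> \sum_i Bmx e (f i) (f i) = 1%:M.
Proof.
move=> of_; set J := \sum_i _; apply/eqP; rewrite -subr_eq0; apply/eqP.
apply: mxtrace_mul_adjmx_eq0.
have hJ : adjmx (J - 1%:M) = J - 1%:M.
  apply/matrixP => i j; rewrite !mxE rmorphB /= rmorph_nat (eq_sym j).
  congr (_ - _).
  have /matrixP/(_ i j) := adjmx_sum (index_enum _) xpredT (fun i => Bmx_adj e (f i) (f i)).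
  by rewrite mxE.
have trJ : \tr J = N%:R.
  rewrite linear_sum /= (eq_bigr (fun=> 1)) => [|i _].
    by rewrite sumr_const card_ord.
  by rewrite Bmx_trace ?of_ ?eqxx //; exact: in_frame_full.
have trJJ : \tr (J *m J) = N%:R.
  rewrite mulmx_suml linear_sum /= (eq_bigr (fun=> 1)) => [|i _].
    by rewrite sumr_const card_ord.
  rewrite mulmx_sumr linear_sum /= (bigD1 i) //= big1 ?addr0 => [|j ji].
    by rewrite Bmx_trace2 ?of_ ?eqxx ?mulr1 //; exact: in_frame_full.
  by rewrite Bmx_trace2 ?of_ ?(negbTE ji) ?mul0r //; exact: in_frame_full.
rewrite hJ mulmxBl mulmxBr mulmx1 mul1mx !linearB /= trJ trJJ mxtrace1.
by rewrite !subrr addr0.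
Qed.

Lemma size_basis : exists t : seq H, orthonormal t /\ size t = N.
Proof.
exists [seq e i | i <- enum 'I_N]; rewrite size_map size_enum_ord; split=> //.
by apply: orthonormal_map => //; exact: enum_uniq.
Qed.

Lemma unit_in_basis u : inner u u = 1 -> exists (f : 'I_N -> H) i, orthofam f /\ f i = u.
Proof.
move=> u1; have [t [ot st]] := size_basis.
have N0 : (0 < N)%N.
  case: (posnP N) => // N0; move: u1; rewrite -[u]efull /famproj big1.
    by rewrite inner0l => /eqP; rewrite eq_sym oner_eq0.
  by move=> i _; have := ltn_ord i; rewrite [X in (_ < X)%N]N0.
have [|s [os ss us]] := orthonormal_basis_with u1 ot; first by rewrite st.
rewrite st in ss.
have ui : (index u s < N)%N by rewrite -ss index_mem.
exists (fun i => s`_i), (Ordinal ui); split; first exact: orthofam_of_seq.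
by rewrite /= nth_index.
Qed.

(** The complements of projections of rank [n] are sums of [N - n] terms, and
[N] is greater than [2 * (N - n)]. *)
Lemma Bop_idem_small : (n < N < 2 * n)%N ->
  forall u, inner u u = 1 -> forall x, B u u (B u u x) = B u u x.
Proof.
move=> /andP[nN N2n] u u1.
have [f [i [of_ <-]]] := unit_in_basis u1.
apply: (Bop_idem_of_mx oe (in_frame_full _ _)).
apply: (@hermitian_family_idem _ N N (N - n) (fun i => Bmx e (f i) (f i))).
- lia.
- lia.
- by move=> j; rewrite Bmx_adj.
- move=> j k; rewrite Bmx_trace2 // ?of_; try exact: in_frame_full.
  by rewrite (eq_sym k) -natrM mulnb andbb.
move=> A cA.
have cCA : #|~: A| = n by rewrite cardsCs finset.setCK card_ord cA subKn // ltnW.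
have -> : \sum_(i in A) Bmx e (f i) (f i) = 1%:M - \sum_(i in ~: A) Bmx e (f i) (f i).
  rewrite -(Bmx_sum1 of_) [in RHS](bigID (mem A)) /= -addrA.
  rewrite [X in _ + X](_ : _ = 0) ?addr0 //; apply/eqP; rewrite subr_eq0.
  by apply/eqP/eq_bigl => j; rewrite inE.
have /= := Bmx_family_idem oe of_ (fun i => in_frame_full _ _) cCA.
set P := \sum_(_ in _) _ => PP.
by rewrite mulmxBl !mulmxBr !mulmx1 !mul1mx PP subrr subr0.
Qed.
End Finite.
End IdempotentImages.

(** * Idempotency when the dimension is twice the rank *)

Section HalfDimensionalSpace.
Context {R : realType} {H : hilbertType R} {n : nat}.
Local Notation C := R[i].
Implicit Types (x y z u v w : H) (a b : C) (X Y : H -> H).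
Hypothesis n_ge2 : (2 <= n)%N.
Variable t0 : seq H.
Hypothesis ot0 : orthonormal t0.
Hypothesis st0 : size t0 = n.+1.
Variable phi : projection H n -> projection H n.
Hypothesis phi_trace : forall P Q : projection H n,
  op_trace (phi P \o phi Q) = op_trace (P \o Q).
Variables (d : nat) (e : 'I_d.+1 -> H).
Hypothesis dim_double : d.+1 = (2 * n)%N.
Hypothesis oe : orthofam e.
Hypothesis efull : forall x, famproj e x = x.

Let n_gt0 : (0 < n)%N. Proof. exact: ltnW. Qed.
Local Notation B := (Bmx phi e).

Let Blinl a u u' v : B (a *: u + u') v = a *: B u v + B u' v.
Proof. exact: (Bmx_linl n_gt0 ot0 st0 phi_trace). Qed.
Let Blinr a u v v' : B u (a *: v + v') = a^* *: B u v + B u v'.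
Proof. exact: (Bmx_linr n_gt0 ot0 st0 phi_trace). Qed.
Let fr u v : in_frame e (Bop phi u v).
Proof. exact: (in_frame_full n_gt0 ot0 st0 phi_trace efull). Qed.

Let orthonormal_drop2 x y (s : seq H) : orthonormal (x :: y :: s) -> orthonormal (x :: s).
Proof. by move=> [xx xs [_ _ os]]; split=> // z zs; apply: xs; rewrite inE zs orbT. Qed.

(** Up to a factor 2 and a constant, a unit vector that rotates in the plane of
[u] and [v] traces a circle of images. *)
Let B_half a u v : `|a| = 1 -> let f := invsqrt2 *: (v + a *: u) in
  B f f *+ 2 = B u u + B v v + circ (B u v) (B v u) a.
Proof.
move=> a1 f.
have B0l w : B 0 w = 0.
  have := Blinl 1 0 0 w; rewrite scaler0 addr0 scale1r => /eqP.
  by rewrite -subr_eq0 opprD addrA subrr sub0r oppr_eq0 => /eqP.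
have B0r w : B w 0 = 0.
  have := Blinr 1 w 0 0; rewrite scaler0 addr0 rmorph1 scale1r => /eqP.
  by rewrite -subr_eq0 opprD addrA subrr sub0r oppr_eq0 => /eqP.
have -> : B f f = (invsqrt2 * invsqrt2^*) *:
    (B v v + a *: B u v + a^* *: B v u + (a * a^*) *: B u u).
  have BZl w z k : B (k *: w) z = k *: B w z by rewrite -[k *: w]addr0 Blinl B0l addr0.
  have BZr w z k : B w (k *: z) = k^* *: B w z by rewrite -[k *: z]addr0 Blinr B0r addr0.
  by rewrite /f BZl BZr [v + _]addrC Blinl !Blinr; mxring.
rewrite invsqrt2_norm -normCK a1 expr1n scale1r /circ.
set b1 := B u u; set b2 := B u v; set b3 := B v u; set b4 := B v v.
move: b1 b2 b3 b4 => b1 b2 b3 b4.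
by mxfield.
Qed.

(** Add [n - 2] fixed vectors to one rotating vector in each plane. *)
Let Bplane u v u' v' : orthonormal [:: u; v; u'; v'] ->
  B u v * B u v = 0 /\ acomm (B u v) (B u' v') = 0.
Proof.
move=> o4; have [t [ot st]] := size_basis oe.
have [|p [op sp]] := orthonormal_grow o4 ot; first by rewrite st /=; lia.
have pn : (n - 2 <= size p)%N by move: sp; rewrite size_cat st /=; lia.
pose k := (size p - (n - 2))%N; pose r := drop k p.
have sr : size r = (n - 2)%N by rewrite size_drop subKn.
have o4r : orthonormal ([:: v; u; v'; u'] ++ r).
  have := orthonormal_drop k op; rewrite drop_cat.
  have -> : (if (k < size p)%N then drop k p ++ [:: u; v; u'; v']
      else drop (k - size p) [:: u; v; u'; v']) = r ++ [:: u; v; u'; v'].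
    case: ltnP => // pk; rewrite /r [drop k p]drop_oversize //.
    by have -> : (k - size p = 0)%N by rewrite /k; lia.
  apply: orthonormal_perm; rewrite perm_catC perm_cat2r.
  apply: (@perm_trans _ [:: v; u; u'; v']).
    by rewrite (perm_catCA [:: u] [:: v] [:: u'; v']).
  by rewrite !perm_cons (perm_catC [:: u'] [:: v']).
pose R0 := \sum_(y <- r) B y y.
apply: (@torus_idem _ d (R0 *+ 2 + (B u u + B v v) + (B u' u' + B v' v'))
          _ (B v u) _ (B v' u')).
move=> s s' s1 s1' y.
pose f := invsqrt2 *: (v + s *: u); pose f' := invsqrt2 *: (v' + s' *: u').
have of2 : orthonormal [:: f, f' & r].
  have := orthonormal_drop2 (orthonormal_rot s1 o4r); rewrite -/f => of_.
  have : orthonormal [:: v', u', f & r].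
    by apply: orthonormal_perm of_; rewrite (perm_catCA [:: f] [:: v'; u'] r).
  move=> /(orthonormal_rot s1')/orthonormal_drop2; rewrite -/f' => of_'.
  by apply: orthonormal_perm of_'; rewrite (perm_catCA [:: f'] [:: f] r).
have := @Bmx_idem _ _ _ n_gt0 _ ot0 st0 _ phi_trace _ e _ oe of2.
rewrite /= sr !big_cons => h.
have {h} : (B f f + (B f' f' + R0)) * (B f f + (B f' f' + R0)) = B f f + (B f' f' + R0).
  apply: h; first by lia.
  by move=> z _; exact: fr.
have -> : y = (B f f + (B f' f' + R0)) *+ 2.
  by rewrite !mulrnDl !B_half // /y; mxring.
set Q := B f f + _ => QQ; rewrite mulrnAl mulrnAr QQ.
by [].
Qed.

Let pair_scalar (f : 'I_d.+1 -> H) : orthofam f ->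
  exists2 tau : C, tau = 1 \/ tau = -1 &
  forall i, let F := tau *: B (f i) (f i) + ((1 - tau) / d.+1%:R)%:M in F * F = F.
Proof.
move=> of_; pose N i j := B (f i) (f j).
have d3 : (3 <= d)%N by lia.
have [r1 r2 r3 r4 r5] := half_dim_relations Blinl Blinr Bplane of_ d3.
apply: (@half_dim_idem C n d n_ge2 dim_double N).
- move=> i j k l; rewrite /N (Bmx_trace2 n_gt0 ot0 st0 phi_trace oe) //; try exact: fr.
  by rewrite !of_ -natrM mulnb andbC [k == _]eq_sym.
- by move=> i j; rewrite /N (Bmx_trace n_gt0 ot0 st0 phi_trace oe) ?of_ //; exact: fr.
- exact: (Bmx_sum1 n_gt0 ot0 st0 phi_trace oe efull).
- exact: r1.
- by move=> i j /r2[].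
- by move=> i j /r2[].
- exact: r3.
- exact: r4.
- exact: r5.
- move=> A cA; exact: (Bmx_family_idem n_gt0 ot0 st0 phi_trace oe of_ (fun i => fr _ _) cA).
Qed.

(** The line of [u] is of the kind of the sign [tau]. *)
Let typ (tau : C) u := let F := tau *: B u u + ((1 - tau) / d.+1%:R)%:M in F * F = F.

(** Two idempotents whose sum is a scalar [k] different from 1 are both equal to
the scalar [k / 2]; here [k] is [n%:R^-1], so [k / 2] is neither 0 nor 1. *)
Let typ_uniq u : inner u u = 1 -> typ 1 u -> typ (-1) u -> False.
Proof.
move=> u1; rewrite /typ subrr mul0r scale1r raddf0 addr0 scaleN1r opprK.
set E := B u u => EE; set k := _ / _ => kE.
have trE : \tr E = 1 by rewrite /E (Bmx_trace n_gt0 ot0 st0 phi_trace oe) // ?u1 //; exact: fr.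
have n0 : (n%:R : C) != 0 by rewrite pnatr_eq0 -lt0n.
have kE' : k = n%:R^-1 by rewrite /k dim_double natrM; field.
have kM : k%:M = k *: (1 : 'M[C]_d.+1) by rewrite scalemx1.
have e1 : (2 - 2 * k) *: E = (k - k ^+ 2) *: 1.
  have : (- E + k%:M) * (- E + k%:M) = E - (2 * k) *: E + (k ^+ 2) *: 1.
    rewrite kM mulrDl !mulrDr mulrNN EE -!scalerAl -!scalerAr !mulr1 !mul1r.
    by mxring.
  rewrite kE kM => h.
  have -> : (2 - 2 * k) *: E = (E - (2 * k) *: E + (k ^+ 2) *: 1) + E - (k ^+ 2) *: 1.
    by mxring.
  by rewrite -h; mxring.
have e2 : (2 - 2 * k) * (2 - 2 * k) *: E = (k - k ^+ 2) * (k - k ^+ 2) *: 1.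
  have := congr1 (fun Z : 'M[C]_d.+1 => Z * Z) e1.
  by rewrite -!scalerAl -!scalerAr EE mulr1 !scalerA.
move: e2; rewrite -[_ * _ *: E]scalerA e1 scalerA => /(congr1 (fun Z : 'M[C]_d.+1 => Z 0 0)).
rewrite !mxZE mxE !mulr1 => /eqP; rewrite -subr_eq0.
have -> : (2 - 2 * k) * (k - k ^+ 2) - (k - k ^+ 2) * (k - k ^+ 2) =
  k * (1 - k) ^+ 2 * (2 - k) by ring.
have k1 : k != 1 by rewrite kE' invr_eq1 pnatr_eq1; lia.
have k2 : k != 2.
  rewrite kE' -(inj_eq invr_inj) invrK; apply/eqP => h.
  have : (n%:R * 2 : C) = 1 by rewrite h mulVf ?pnatr_eq0.
  by move/eqP; rewrite -natrM pnatr_eq1; lia.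
have k0 : k != 0 by rewrite kE' invr_eq0.
have h1 : 1 - k != 0 by rewrite subr_eq0 eq_sym.
have h2 : 2 - k != 0 by rewrite subr_eq0 eq_sym.
by apply/negP; rewrite mulf_neq0 // mulf_neq0 // expf_neq0.
Qed.

Let typ_orth u v tau : (tau = 1 \/ tau = -1) -> orthonormal [:: u; v] ->
  typ tau u -> typ tau v.
Proof.
move=> tau1 ouv tu; have [t [ot st]] := size_basis oe.
have [|p [op sp]] := orthonormal_grow ouv ot; first by rewrite st /=; lia.
rewrite st in sp.
have of_ := orthofam_of_seq op sp; set f := fun i => _ in of_.
have mem w : w \in p ++ [:: u; v] -> exists i, f i = w.
  move=> wp; have wi : (index w (p ++ [:: u; v]) < d.+1)%N by rewrite -sp index_mem.
  by exists (Ordinal wi); rewrite /f /= nth_index.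
have [i fi] : exists i, f i = u by apply: mem; rewrite mem_cat mem_head orbT.
have [j fj] : exists j, f j = v by apply: mem; rewrite mem_cat !inE eqxx !orbT.
have [tau' tau1' H'] := pair_scalar of_.
have tu' : typ tau' u by rewrite -fi; exact: H'.
have tv' : typ tau' v by rewrite -fj; exact: H'.
have u1 : inner u u = 1 by case: ouv.
case: tau1 tau1' tu tu' tv' => -> [] -> // t1 t2.
  by case: (typ_uniq u1 t1 t2).
by case: (typ_uniq u1 t2 t1).
Qed.

(** Orthogonal unit vectors have the same sign, as both belong to one
orthonormal basis; any two vectors are orthogonal to a third one because the
dimension is at least 4. *)
Lemma half_dim_cases :
  (forall u, inner u u = 1 -> forall x, Bop phi u u (Bop phi u u x) = Bop phi u u x) \/
  (forall u, inner u u = 1 ->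
    let G x := n%:R^-1 *: x - Bop phi u u x in forall x, G (G x) = G x).
Proof.
have [tau tau1 Ht] := pair_scalar oe.
have e1 : inner (e ord0) (e ord0) = 1 by rewrite oe eqxx.
have all_typ u : inner u u = 1 -> typ tau u.
  move=> u1; pose v := e ord0; have ov : orthonormal [:: v] by [].
  have [s [os ss vs us]] : exists s,
      [/\ orthonormal s, (size s <= 2)%N, v \in s & oproj s u = u].
    have [vu|vu] := eqVneq (oproj [:: v] u) u.
      by exists [:: v]; rewrite mem_head.
    have [a [ox xu]] := orthonormal_extend ov vu.
    by eexists; split; [exact: ox|by []|rewrite !inE eqxx orbT|exact: xu].
  have [t [ot st]] := size_basis oe.
  have [|p [op sp]] := orthonormal_grow os ot; first by rewrite st; lia.
  have {sp} : p != [::] by apply/eqP => p0; move: sp; rewrite p0 /= st; lia.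
  case: p op => //= w p [ww ws _] _.
  have wv : inner w v = 0 by apply: ws; rewrite mem_cat vs orbT.
  have wu : inner w u = 0.
    rewrite -us -inner_oproj oproj_orth ?inner0l // => z zs.
    by apply: ws; rewrite mem_cat zs orbT.
  have tw : typ tau w.
    apply: (@typ_orth v w) => //; last exact: Ht.
    split=> // z; rewrite inE => /eqP->; exact: inner_orthC.
  apply: (@typ_orth w u) => //.
  by split=> // z; rewrite inE => /eqP->.
case: tau1 all_typ => -> H1; [left|right] => u u1.
  have := H1 _ u1; rewrite /typ subrr mul0r scale1r raddf0 addr0 => EE.
  exact: (Bop_idem_of_mx oe (fr u u) EE).
have := H1 _ u1; rewrite /typ scaleN1r opprK.
set k := _ / _ => EE.
pose G x := n%:R^-1 *: x - Bop phi u u x.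
have kE' : k = n%:R^-1.
  have n0 : (n%:R : C) != 0 by rewrite pnatr_eq0 -lt0n.
  by rewrite /k dim_double natrM; field.
have GE x : G x = opmx e (- B u u + k%:M) x.
  by rewrite addrC opmxB opmx_scalar // kE' -(fr u u).
suff GG x : G (G x) = G x by exact: GG.
by rewrite !GE -opmxM // -[_ *m _]/(_ * _) EE.
Qed.
End HalfDimensionalSpace.

(** * Wigner's theorem *)

Section RankOne.
Context {R : realType} {H : hilbertType R}.
Local Notation C := R[i].
Implicit Types (x y z u v w : H).

(** Some column of [M] is not 0; its direction [w] is fixed by [M], and the
difference of [M] and the projection on [w] is a self-adjoint idempotent of
trace 0. *)
Lemma idem_trace1_dyad d (e : 'I_d -> H) (M : 'M[C]_d) : orthofam e ->
  adjmx M = M -> M *m M = M -> \tr M = 1 ->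
  exists2 w, inner w w = 1 & opmx e M = dyad w w.
Proof.
move=> oe hM MM tM; pose Y := opmx e M.
have Yself x y : inner (Y x) y = inner x (Y y) by rewrite opmx_adjoint // hM.
have YY x : Y (Y x) = Y x by rewrite /Y -opmxM // MM.
have [k Mk] : exists k, M k k != 0.
  apply/existsP; apply: contraT => /existsPn M0; move/eqP: tM.
  rewrite /mxtrace big1 ?(eq_sym 0) ?oner_eq0 // => i _; apply/eqP.
  by have := M0 i; rewrite negbK.
have Mkk : inner (Y (e k)) (Y (e k)) = M k k.
  rewrite Yself YY -Yself.
  by have := congr1 (fun Z : 'M[C]_d => Z k k) (opmxK oe M); rewrite mxE.
pose a := (sqrtC (M k k))^-1; pose w := a *: Y (e k).
have a0 : 0 <= a by rewrite invr_ge0 sqrtC_ge0 -Mkk inner_ge0.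
have w1 : inner w w = 1.
  rewrite innerZl innerZr geC0_conj // Mkk mulrA -expr2 exprVn sqrtCK.
  by rewrite mulVf.
have YZ c x : Y (c *: x) = c *: Y x by rewrite /Y linearZ.
have YB x y : Y (x - y) = Y x - Y y by rewrite /Y linearB.
have Yw : Y w = w by rewrite /w YZ YY.
have ew : famproj e w = w by rewrite -Yw famproj_opmx.
exists w => //; rewrite (dyad_opmx ew ew); set W := \matrix_(i, j) _.
have WE x : opmx e W x = inner x w *: w by rewrite -(dyad_opmx ew ew).
congr (opmx e _); apply/eqP; rewrite -subr_eq0; apply/eqP.
have hW : adjmx W = W.
  by apply/matrixP => i j; rewrite !mxE rmorphM /= conjCK mulrC.
have hD : adjmx (M - W) = M - W.
  by rewrite -[in RHS]hM -[in RHS]hW; apply/matrixP => i j; rewrite !mxE rmorphB.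
apply: mxtrace_mul_adjmx_eq0; rewrite hD.
have -> : (M - W) *m (M - W) = M - W.
  apply: (opmx_inj oe) => x; rewrite opmxM // !opmxB !WE -/Y.
  rewrite !innerBl innerZl w1 mulr1 Yself Yw subrr scale0r subr0.
  by rewrite YB YZ YY Yw.
by rewrite linearB /= tM -(op_trace_opmx oe) -(dyad_opmx ew ew) op_trace_dyad w1 subrr.
Qed.
End RankOne.

Section Wigner.
Context {R : realType} {H : hilbertType R}.
Local Notation C := R[i].
Implicit Types (x y z w u v : H) (a b c : C).

Lemma normC_inner x y : `|inner x y| = `|inner y x|.
Proof. by rewrite innerC norm_conjC. Qed.

Lemma collinear_of_norm x y : inner x x != 0 ->
  `|inner y x| ^+ 2 = inner x x * inner y y -> y = (inner y x / inner x x) *: x.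
Proof.
move=> x0 yx; apply/eqP; rewrite -subr_eq0 -inner_eq0 !innerE.
have xr : (inner x x)^* = inner x x by rewrite -innerC.
rewrite rmorphM fmorphV /= xr -innerC.
have e1 : inner y x * inner x y = inner x x * inner y y.
  by rewrite [inner x y]innerC -normCK.
apply/eqP; field: e1.
by [].
Qed.

Section InnerPreserving.
Variable s : bool.
(** Treats linear ([s] true) and conjugate-linear maps together. *)
Definition semi (a : C) : C := if s then a else a^*.
Lemma semiD a b : semi (a + b) = semi a + semi b.
Proof. by rewrite /semi; case: s => //; rewrite rmorphD. Qed.
Lemma semiM a b : semi (a * b) = semi a * semi b.
Proof. by rewrite /semi; case: s => //; rewrite rmorphM. Qed.
Lemma semiJ a : semi a^* = (semi a)^*.
Proof. by rewrite /semi; case: s. Qed.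
Lemma semi_norm a : `|semi a| = `|a|.
Proof. by rewrite /semi; case: s => //; rewrite norm_conjC. Qed.

(** The norm of [V (a *: x + y) - (semi a *: V x + V y)] can be expanded in
inner products of values of [V], and these are known. *)
Lemma inner_preserving_semilinear (V : H -> H) :
  (forall x y, inner (V x) (V y) = semi (inner x y)) ->
  forall a x y, V (a *: x + y) = semi a *: V x + V y.
Proof.
move=> HV a x y; apply/eqP; rewrite -subr_eq0 -inner_eq0 !innerE !HV !innerE.
rewrite /semi; case: (s); apply/eqP; first by ring.
by rewrite !(rmorphD, rmorphM) /= !conjCK; ring.
Qed.
End InnerPreserving.

Variable g : H -> H.
Hypothesis g_norm : forall z w, `|inner (g z) (g w)| = `|inner z w|.
Variable e : H.
Hypothesis e1 : inner e e = 1.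

Let g_inner z : inner (g z) (g z) = inner z z.
Proof. by rewrite -[LHS]ger0_norm ?inner_ge0 // g_norm ger0_norm ?inner_ge0. Qed.

Let e' := g e.
Let e'1 : inner e' e' = 1. Proof. by rewrite g_inner. Qed.

Let inner_split a b (t t' : H) : inner t e' = 0 -> inner e' t' = 0 ->
  inner (a *: e' + t) (b *: e' + t') = a * b^* + inner t t'.
Proof. by move=> te et'; rewrite !innerE e'1 te et'; ring. Qed.

Let inner_sub_add (x y z : H) : inner (x - (y + z)) (x - (y + z)) =
  inner x x + inner y y + inner z z - (inner x y + inner y x)
  - (inner x z + inner z x) + (inner y z + inner z y).
Proof. by rewrite !innerE; ring. Qed.

Let perp z := inner z e = 0.

(** The line of [g (e + z)] contains exactly one vector of the form
[e' + T z] with [T z] orthogonal to [e']. *)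
Let phase z := inner (g (e + z)) e'.
Let T z := (phase z)^* *: g (e + z) - e'.

Let phase1 z : perp z -> `|phase z| = 1.
Proof. by move=> ze; rewrite g_norm innerDl e1 ze addr0 normr1. Qed.

Let phaseM z : perp z -> (phase z)^* * phase z = 1.
Proof. by move=> /phase1 p1; rewrite mulrC -normCK p1 expr1n. Qed.

Let T_perp z : perp z -> inner (T z) e' = 0.
Proof. by move=> ze; rewrite innerBl innerZl phaseM // e'1 subrr. Qed.

Let T_perp' z : perp z -> inner e' (T z) = 0.
Proof. by move=> ze; apply/inner_orthC/T_perp. Qed.

Let eT z : e' + T z = (phase z)^* *: g (e + z).
Proof. by rewrite addrC subrK. Qed.

Let inner_eT z w : perp z -> perp w ->
  inner (e' + T z) (e' + T w) = 1 + inner (T z) (T w).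
Proof.
move=> ze we; rewrite -[e' in inner (e' + _)]scale1r -[e' in X in inner _ X]scale1r.
by rewrite inner_split ?T_perp ?T_perp' // rmorph1 mulr1.
Qed.

Let norm_eT z w : perp z -> perp w -> `|1 + inner (T z) (T w)| = `|1 + inner z w|.
Proof.
move=> ze we; rewrite -inner_eT // !eT innerZl innerZr conjCK !normrM.
rewrite norm_conjC !phase1 // !mul1r g_norm !innerE e1 ze (inner_orthC we).
by rewrite add0r addr0.
Qed.

Let T_norm z : perp z -> inner (T z) (T z) = inner z z.
Proof.
move=> ze; have := norm_eT ze ze.
rewrite !ger0_norm ?addr_ge0 ?ler01 ?inner_ge0 // => /addrI.
by [].
Qed.

Let gT z : perp z -> `|inner (T z) (g z)| = inner z z.
Proof.
move=> ze; rewrite /T innerBl innerZl.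
have -> : inner e' (g z) = 0.
  by apply/eqP; rewrite -normr_eq0 g_norm (inner_orthC ze) normr0.
rewrite subr0 normrM norm_conjC phase1 // mul1r g_norm innerDl (inner_orthC ze).
by rewrite add0r ger0_norm ?inner_ge0.
Qed.

(** [T z] and [g z] have equality in the Cauchy-Schwarz inequality. *)
Let T_coll z : perp z -> exists2 c, `|c| = 1 & T z = c *: g z.
Proof.
move=> ze; have [->|z0] := eqVneq z 0.
  exists 1; rewrite ?normr1 // scale1r.
  have g0 : g 0 = 0 by apply/eqP; rewrite -inner_eq0 g_inner inner0l.
  rewrite g0; apply/eqP; rewrite -inner_eq0 T_norm ?inner0l //.
  exact: inner0l.
have zz : inner (g z) (g z) != 0 by rewrite g_inner inner_eq0.
have := @collinear_of_norm (g z) (T z) zz; rewrite gT // g_inner T_norm //.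
move=> /(_ (expr2 _)) ->; eexists; last by [].
by rewrite normrM normfV gT // ger0_norm ?inner_ge0 // divff // inner_eq0.
Qed.

Let T_abs z w : perp z -> perp w -> `|inner (T z) (T w)| = `|inner z w|.
Proof.
move=> /T_coll[c c1 ->] /T_coll[b b1 ->].
by rewrite innerZl innerZr !normrM norm_conjC c1 b1 !mul1r g_norm.
Qed.

Let re2 a := a + a^*.

(** Both [1 + inner (T z) (T w)] and [inner (T z) (T w)] have the modulus of the
corresponding number for [z] and [w], which fixes the real part. *)
Let T_re z w : perp z -> perp w -> re2 (inner (T z) (T w)) = re2 (inner z w).
Proof.
move=> ze we; have := congr1 (fun a => a ^+ 2) (norm_eT ze we).
have := congr1 (fun a => a ^+ 2) (T_abs ze we).
rewrite !normCK !rmorphD rmorph1; set a := inner _ _; set b := inner z w => h1 h2.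
have -> : re2 a = (1 + a) * (1 + a^*) - 1 - a * a^* by rewrite /re2; ring.
by rewrite h1 h2 /re2; ring.
Qed.

Let perpD z w : perp z -> perp w -> perp (z + w).
Proof. by rewrite /perp innerDl => -> ->; rewrite addr0. Qed.
Let perpZ a z : perp z -> perp (a *: z).
Proof. by rewrite /perp innerZl => ->; rewrite mulr0. Qed.

Let re2_inner x y : re2 (inner x y) = inner x y + inner y x.
Proof. by rewrite /re2 -innerC. Qed.

Let T_add z w : perp z -> perp w -> T (z + w) = T z + T w.
Proof.
move=> ze we; have zwe := perpD ze we.
apply/eqP; rewrite -subr_eq0 -inner_eq0; apply/eqP.
have h1 := T_re zwe ze; have h2 := T_re zwe we; have h3 := T_re ze we.
rewrite !re2_inner in h1 h2 h3.
have n1 := T_norm zwe; have n2 := T_norm ze; have n3 := T_norm we.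
rewrite inner_sub_add.
by rewrite h1 h2 h3 n1 n2 n3 !innerE; ring.
Qed.

(** [T ('i *: z)] is a multiple of [T z] by a scalar of modulus 1 with real part
0. *)
Let T_i z : perp z -> T ('i *: z) = 'i *: T z \/ T ('i *: z) = - 'i *: T z.
Proof.
move=> ze; have ize := perpZ 'i ze; have [z0|z0] := eqVneq z 0.
  left; have T0 : T z = 0.
    by apply/eqP; rewrite -inner_eq0 T_norm // z0 inner0l.
  have iz : 'i *: z = z by rewrite z0 scaler0.
  by rewrite iz T0 scaler0.
have zz : inner (T z) (T z) != 0 by rewrite T_norm ?inner_eq0.
have n1 : `|inner (T ('i *: z)) (T z)| = inner z z.
  by rewrite T_abs // innerZl normrM normCi mul1r ger0_norm ?inner_ge0.
have := @collinear_of_norm (T z) (T ('i *: z)) zz.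
rewrite n1 !T_norm // [inner (_ *: z) _]innerZl innerZr conjCi => h.
have {h} -> := h _; last by have i2 := sqrCi C; ring: i2.
set k := _ / _.
have kr : re2 k = 0.
  have := T_re ize ze; rewrite /re2 [inner (_ *: z) z]innerZl rmorphM /= conjCi.
  rewrite -[(inner z z)^*]innerC => h.
  rewrite /re2 /k rmorphM fmorphV /= -[(inner z z)^*]innerC -mulrDl h.
  by rewrite mulNr subrr mul0r.
have kn : k * k^* = 1.
  rewrite -normCK /k normrM n1 normfV ger0_norm ?inner_ge0 //.
  by rewrite divff ?expr1n // inner_eq0.
have kk : k ^+ 2 = 'i ^+ 2.
  rewrite sqrCi; apply/eqP; rewrite -subr_eq0 opprK.
  by rewrite -kn expr2 -mulrDr [k + _]kr mulr0.
by move/eqP: kk; rewrite eqf_sqr => /orP[]/eqP->; [left|right].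
Qed.

(** Additivity of [T] excludes that two vectors have different signs. *)
Let T_sign : exists s : bool, forall z, perp z ->
  T ('i *: z) = (if s then 'i else - 'i) *: T z.
Proof.
have [h|] := pselect (forall z, perp z -> T ('i *: z) = 'i *: T z).
  by exists true.
move=> /existsNP[z /not_implyP[ze zi]]; exists false => w we.
have [|//] := T_i we => wi.
have zi' : T ('i *: z) = - 'i *: T z by case: (T_i ze) => // /zi.
have two (x : H) : 'i *: x = - 'i *: x -> x = 0.
  move/eqP; rewrite -subr_eq0 -scalerBl opprK -mulr2n scaler_eq0 mulrn_eq0.
  by rewrite (negbTE (neq0Ci _)) => /eqP.
have : T ('i *: (z + w)) = - 'i *: T z + 'i *: T w.
  by rewrite scalerDr T_add ?zi' ?wi //; exact: perpZ.
have zwe := perpD ze we.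
case: (T_i zwe) => ->; rewrite T_add // scalerDr.
  by move=> /addIr /two Tz; case: zi; rewrite zi' Tz !scaler0.
by move=> /addrI /esym /two Tw; rewrite wi Tw !scaler0.
Qed.

Let T_inner : exists s : bool, forall z w, perp z -> perp w ->
  inner (T z) (T w) = semi s (inner z w).
Proof.
have [s Hs] := T_sign; exists s => z w ze we.
have h1 := T_re ze we; have h2 := T_re ze (perpZ 'i we).
rewrite Hs // in h2; move: h1 h2; rewrite /re2 !innerZr /semi.
set a := inner (T z) (T w); set b := inner z w; rewrite !rmorphM /=.
have i0 := neq0Ci C; have i2 := sqrCi C.
case: s Hs => Hs; rewrite !conjCK ?rmorphN /= !conjCi ?opprK.
  move: a b (a^*) (b^*) => a b a' b' h1 h2.
  have -> : a = 2^-1 * ((a + a') + 'i * (- 'i * a + 'i * a')) by field: i2.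
  by rewrite h1 h2; field: i2.
move: a b (a^*) (b^*) => a b a' b' h1 h2.
have -> : a = 2^-1 * ((a + a') - 'i * ('i * a + - 'i * a')) by field: i2.
by rewrite h1 h2; field: i2.
Qed.

(** [V] maps [e] to [e'] and acts as [T] on the orthogonal complement of [e]. *)
Lemma wigner_rays : exists (s : bool) (V : H -> H),
  (forall x y, inner (V x) (V y) = semi s (inner x y)) /\
  forall u, inner u u = 1 -> exists2 c, `|c| = 1 & g u = c *: V u.
Proof.
have [s Ts] := T_inner; exists s.
pose p x := x - inner x e *: e.
have pe x : perp (p x) by rewrite /perp innerBl innerZl e1 mulr1 subrr.
pose V x := semi s (inner x e) *: e' + T (p x).
have HV x y : inner (V x) (V y) = semi s (inner x y).
  rewrite inner_split ?T_perp ?T_perp' // Ts // -semiJ -semiM -semiD.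
  by congr (semi _ _); rewrite /p !innerE e1 -innerC; ring.
have HL := inner_preserving_semilinear HV.
exists V; split=> // u u1.
suff gV : `|inner (g u) (V u)| = 1.
  have VV : inner (V u) (V u) = 1 by rewrite HV u1 /semi; case: (s); rewrite ?rmorph1.
  exists (inner (g u) (V u)) => //.
  rewrite -[X in X *: _]divr1 -[in X in _ / X]VV.
  by apply: collinear_of_norm; rewrite ?VV ?oner_eq0 // gV g_inner u1 expr1n mulr1.
have [ue|ue] := eqVneq (inner u e) 0.
  have pu : p u = u by rewrite /p ue scale0r subr0.
  have -> : V u = T u.
    rewrite /V pu ue /semi; case: (s); rewrite ?rmorph0 scale0r add0r //.
  by rewrite normC_inner gT.
pose z := (inner u e)^-1 *: p u.
have ze : perp z by apply: perpZ.
have uz : u = inner u e *: (e + z).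
  by rewrite scalerDr scalerA divff // scale1r addrC subrK.
have Vez : V (e + z) = e' + T z.
  rewrite /V; have pz : p (e + z) = z.
    by rewrite /p innerDl e1 ze addr0 scale1r addrAC subrr add0r.
  rewrite pz innerDl e1 ze addr0 /semi; case: (s); rewrite ?rmorph1 scale1r //.
have V0 : V 0 = 0.
  by apply/eqP; rewrite -inner_eq0 HV inner0l /semi; case: (s); rewrite ?rmorph0.
have -> : V u = semi s (inner u e) *: V (e + z).
  by rewrite {1}uz -[_ *: (e + z)]addr0 HL V0 addr0.
rewrite Vez eT !innerZr !normrM !norm_conjC semi_norm phase1 // mul1r g_norm.
rewrite -normrM.
have -> : inner u e * inner u (e + z) = (inner u e / (inner u e)^*) * inner u u.
  have -> : inner u u = (inner u e)^* * inner u (e + z) by rewrite {2}uz innerZr.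
  by field; rewrite conjC_eq0.
by rewrite u1 mulr1 normrM normfV norm_conjC divff // normr_eq0.
Qed.
End Wigner.

(** * The adjoint of an isometry *)

Section Riesz.
Context {R : realType} {H : hilbertType R}.
Local Notation C := R[i].
Implicit Types (x y z w u v : H) (a b c : C).

Lemma complex_infimum (q : H -> C) : (forall x, 0 <= q x) ->
  exists m : C, (forall x, m <= q x) /\ forall eta, 0 < eta -> exists x, q x < m + eta.
Proof.
move=> q0; have qr x : q x = ((complex.Re (q x))%:C)%C.
  have := q0 x; rewrite lecE => /andP[/eqP + _].
  by case: (q x) => a b /= ->.
pose E := [set complex.Re (q x) | x in [set: H]].
have lbE : has_lbound E.
  by exists 0 => _ [x _ <-]; have := q0 x; rewrite lecE => /andP[].
exists ((inf E)%:C)%C; split=> [x|eta].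
  rewrite qr lecR; apply: (ge_inf lbE); by exists x.
rewrite ltcE => /andP[/eqP Ie Re_gt0].
have infE : has_inf E by split=> //; exists (complex.Re (q 0)), 0.
have [_ [x _ <-] xe] := inf_adherent Re_gt0 infE.
exists x; rewrite qr ltcE /=; move: Ie Re_gt0 xe; case: eta => a b /= -> _ xe.
by rewrite addr0 eqxx.
Qed.

Lemma inner_residual r v : inner v v != 0 ->
  let k := inner r v / inner v v in
  inner (r - k *: v) (r - k *: v) = inner r r - `|inner r v| ^+ 2 / inner v v.
Proof.
move=> v0 k; have vr : (inner v v)^* = inner v v by rewrite -innerC.
rewrite !innerE normCK /k rmorphM fmorphV /= vr -[(inner r v)^*]innerC.
by field.
Qed.

Lemma Cauchy_Schwarz x y : `|inner x y| <= `|x| * `|y|.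
Proof.
rewrite -(@ler_pXn2r _ 2) ?nnegrE ?mulr_ge0 // exprMn !sqr_normE.
have [->|y0] := eqVneq y 0; first by rewrite !inner0r normr0 expr0n mulr0.
have yy : inner y y != 0 by rewrite inner_eq0.
have y_gt0 : 0 < inner y y by rewrite lt_neqAle eq_sym yy inner_ge0.
by rewrite -ler_pdivrMr // -subr_ge0 -inner_residual // inner_ge0.
Qed.

Variables (s : bool) (V : H -> H).
Hypothesis HV : forall x y, inner (V x) (V y) = semi s (inner x y).

Let HL a x y : V (a *: x + y) = semi s a *: V x + V y.
Proof. exact: inner_preserving_semilinear. Qed.

Let semi_nat (r : C) : r^* = r -> semi s r = r.
Proof. by rewrite /semi; case: s. Qed.

Let V_norm x : inner (V x) (V x) = inner x x.
Proof. by rewrite HV semi_nat // -innerC. Qed.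

Let VB x y : V (x - y) = V x - V y.
Proof.
by rewrite addrC -scaleN1r HL semi_nat ?rmorphN ?rmorph1 // scaleN1r addrC.
Qed.

Let V_mid x y : V x + V y = 2 *: V (2^-1 *: x + 2^-1 *: y).
Proof.
have V0 : V 0 = 0 by have := VB 0 0; rewrite !subrr.
have h : semi s (2^-1 : C) = 2^-1 by rewrite semi_nat // fmorphV rmorph_nat.
have Vh z : V (2^-1 *: z) = 2^-1 *: V z by rewrite -[_ *: z]addr0 HL V0 addr0 h.
by rewrite HL h Vh scalerDr !scalerA divff ?pnatr_eq0 // !scale1r.
Qed.

(** The distance of [y] to the range of [V] is attained: by the parallelogram
identity the near-minimizers form a Cauchy filter. *)
Section Minimization.
Variable y : H.
Let q x := inner (y - V x) (y - V x).
Variable m : C.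
Hypothesis m_le : forall x, m <= q x.
Hypothesis m_inf : forall eta, 0 < eta -> exists x, q x < m + eta.

Let A (eta : C) : set H := [set x | q x < m + eta].

Let near_min_close eta x x' : A eta x -> A eta x' ->
  `|x - x'| ^+ 2 <= 4 * eta.
Proof.
move=> Ax Ax'; rewrite sqr_normE.
pose z := 2^-1 *: x + 2^-1 *: x'.
have -> : inner (x - x') (x - x') = 2 * q x + 2 * q x' - 4 * q z.
  have zz : inner (2 *: (y - V z)) (2 *: (y - V z)) = 4 * q z.
    by rewrite innerZl innerZr rmorph_nat mulrA /q; congr (_ * _); ring.
  rewrite -V_norm VB -zz scalerBr -V_mid -[2 *: y]/((1 + 1) *: y) scalerDl scale1r.
  by rewrite /q !innerE; ring.
have h : 2 * q x + 2 * q x' <= 2 * (m + eta) + 2 * (m + eta).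
  by apply: lerD; rewrite ler_pM2l ?ltr0n //; exact: ltW.
have h4 : 4 * m <= 4 * q z by rewrite ler_pM2l ?ltr0n.
apply: le_trans (lerB h h4) _.
by rewrite le_eqVlt; apply/orP; left; apply/eqP; ring.
Qed.

(** At a near-minimizer the residual is almost orthogonal to the range, since
moving along [x] decreases the squared distance by the squared modulus of the
component of the residual along [V x]. *)
Let near_min_orth eta x0 x : A eta x0 ->
  `|inner (y - V x0) (V x)| ^+ 2 <= `|x| ^+ 2 * eta.
Proof.
move=> Ax0; rewrite sqr_normE; have [->|xn0] := eqVneq x 0.
  have V0 : V 0 = 0 by have := VB 0 0; rewrite !subrr.
  by rewrite V0 !inner0r normr0 expr0n mul0r.
have xx : inner (V x) (V x) != 0 by rewrite V_norm inner_eq0.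
have x_gt0 : 0 < inner x x by rewrite lt_neqAle eq_sym inner_eq0 xn0 inner_ge0.
rewrite -ler_pdivrMl // mulrC -{1}V_norm.
set k := inner (y - V x0) (V x) / inner (V x) (V x).
have semiK a : semi s (semi s a) = a by rewrite /semi; case: (s); rewrite ?conjCK.
have := m_le (semi s k *: x + x0).
have -> : q (semi s k *: x + x0) = inner (y - V x0 - k *: V x) (y - V x0 - k *: V x).
  by rewrite /q HL semiK opprD addrA addrAC.
rewrite inner_residual // -/(q x0) => h.
have qe : q x0 - m <= eta by rewrite lerBlDl; exact: ltW.
by apply: le_trans qe; rewrite lerBrDl -lerBrDr.
Qed.

Lemma least_squares : exists w, forall x, inner (y - V w) (V x) = 0.
Proof.
pose F := filter_from [set eta : C | 0 < eta] A.
have FF : Filter F.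
  apply: filter_from_filter; first by exists 1; exact: ltr01.
  move=> a b /= a0 b0; have ab0 : 0 < a + b by rewrite addr_gt0.
  exists (a * b / (a + b)); first by rewrite /= divr_gt0 // mulr_gt0.
  move=> x /= Ax; split; apply: (lt_le_trans Ax); rewrite lerD2l ler_pdivrMr //.
    by rewrite ler_pM2l // lerDr ltW.
  by rewrite mulrC ler_pM2l // lerDl ltW.
have PF : ProperFilter F.
  by apply: filter_from_proper => eta /m_inf[x qx]; exists x.
have cF : cauchy F.
  apply: cauchy_exP => eps eps0.
  have eta0 : 0 < eps ^+ 2 / 8 by rewrite divr_gt0 ?exprn_gt0 ?ltr0n.
  have [x Ax] := m_inf eta0; exists x, (eps ^+ 2 / 8) => // x' Ax'.
  rewrite -ball_normE /=; rewrite -(@ltr_pXn2r _ 2) ?nnegrE ?(ltW eps0) //.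
  apply: le_lt_trans (near_min_close Ax Ax') _.
  have -> : 4 * (eps ^+ 2 / 8) = eps ^+ 2 / 2 by field.
  by rewrite ltr_pdivrMr ?ltr0n // ltr_pMr ?exprn_gt0 // ltr1n.
have /cvg_ex[w Fw] := @cauchy_cvg _ F PF cF.
exists w => x; apply/eqP; rewrite -normr_eq0; apply/eqP.
set a := `|_|; have a0 : 0 <= a := normr_ge0 _.
apply/eqP; rewrite eq_le a0 andbT; apply/contraT => a_gt.
have a_gt0 : 0 < a by rewrite lt_neqAle eq_sym a0 andbT; apply: contra a_gt => /eqP->.
have c0 : 0 < `|x| + 1 by rewrite ltr_wpDl ?ltr01.
pose eps := a / (4 * (`|x| + 1)).
have eps0 : 0 < eps by rewrite divr_gt0 // mulr_gt0 // ltr0n.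
have [eta eta0 Aw] := Fw _ (nbhsx_ballx w eps eps0).
have [x0 Ax0 near0] : exists2 x0, A (eps ^+ 2) x0 & `|w - x0| < eps.
  have [_ [k k0 Ak]] : True /\ F (A (eps ^+ 2)).
    by split=> //; exists (eps ^+ 2) => //=; rewrite exprn_gt0.
  have Fboth : F (A (eps ^+ 2) `&` ball w eps).
    apply: filterI; first by exists (eps ^+ 2) => //=; rewrite exprn_gt0.
    by exists eta.
  have [x0 [h1]] := filter_ex Fboth; rewrite -ball_normE /= => h2.
  by exists x0.
have h1 : `|inner (y - V x0) (V x)| <= `|x| * eps.
  have me : 0 <= `|x| * eps by rewrite mulr_ge0 // ltW.
  rewrite -(@ler_pXn2r _ 2) ?nnegrE // exprMn.
  exact: near_min_orth.
have h2 : `|inner (V x0 - V w) (V x)| <= `|x| * eps.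
  rewrite -VB HV semi_norm; apply: le_trans (Cauchy_Schwarz _ _) _.
  by rewrite mulrC ler_wpM2l // distrC ltW.
have : a <= `|x| * eps + `|x| * eps.
  rewrite /a; have -> : y - V w = (y - V x0) + (V x0 - V w).
    by rewrite addrA subrK.
  by rewrite innerDl; apply: le_trans (ler_normD _ _) _; exact: lerD.
rewrite /eps -mulr2n -[_ *+ 2]mulr_natr.
have -> : `|x| * (a / (4 * (`|x| + 1))) * 2 = a * (`|x| / (2 * (`|x| + 1))).
  by field; rewrite gt_eqF.
rewrite -ler_pdivrMl // mulVf ?gt_eqF // => h.
have : `|x| / (2 * (`|x| + 1)) < 1.
  rewrite ltr_pdivrMr ?mulr_gt0 ?ltr0n // mul1r mulrDr mulr1 mulr_natl mulr2n -addrA.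
  by rewrite ltrDl ltr_wpDl // ltr0n.
by move=> /(le_lt_trans h); rewrite ltxx.
Qed.
End Minimization.

(** The value of the adjoint at [y] is the minimizer of the distance from [y] to
the range of [V]. *)
Lemma inner_preserving_adjoint : exists W : H -> H,
  (forall x y, inner (V x) y = semi s (inner x (W y))) /\
  forall a y z, W (a *: y + z) = semi s a *: W y + W z.
Proof.
have semiK a : semi s (semi s a) = a by rewrite /semi; case: (s); rewrite ?conjCK.
have /choice[W Wy] y : exists w, forall x, inner (V x) y = semi s (inner x w).
  have [m [m_le m_inf]] := complex_infimum (fun x => inner_ge0 (y - V x)).
  have [w Hw] := least_squares m_le m_inf.
  exists w => x; rewrite -HV; apply/eqP; rewrite -subr_eq0 -innerBr; apply/eqP.
  exact/inner_orthC/Hw.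
exists W; split=> // a y z; apply/eqP; rewrite -subr_eq0 -inner_eq0; apply/eqP.
set x := _ - _; suff h : inner x (W (a *: y + z)) = inner x (semi s a *: W y + W z).
  by rewrite {2}/x innerBr h subrr.
apply: (can_inj semiK).
by rewrite -Wy !innerDr !innerZr !Wy semiD semiM semiJ semiK.
Qed.
End Riesz.

(** * From lines to subspaces *)

(** Wigner's theorem for the representatives [f u] of the lines, extended to
all vectors by homogeneity in the norm. *)
Lemma wigner_dyads (R : realType) (H : hilbertType R) (G : H -> H -> H) (e : H) :
  inner e e = 1 ->
  (forall u, inner u u = 1 -> exists2 w, inner w w = 1 & G u = dyad w w) ->
  (forall u v, inner u u = 1 -> inner v v = 1 ->
     op_trace (G u \o G v) = inner v u * inner u v) ->
  exists (s : bool) (V : H -> H),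
    (forall x y, inner (V x) (V y) = semi s (inner x y)) /\
    forall u, inner u u = 1 -> G u = dyad (V u) (V u).
Proof.
move=> e1 Gdyad Gtr.
have /choice[f fE] (u : H) : exists w, inner u u = 1 ->
    inner w w = 1 /\ G u = dyad w w.
  have [u1|u1] := pselect (inner u u = 1); last by exists 0.
  by have [w w1 Gu] := Gdyad _ u1; exists w.
have f_norm u v : inner u u = 1 -> inner v v = 1 -> `|inner (f u) (f v)| = `|inner u v|.
  move=> u1 v1; have [fu1 fu] := fE _ u1; have [fv1 fv] := fE _ v1.
  have := Gtr _ _ u1 v1; rewrite fu fv.
  have -> : dyad (f u) (f u) \o dyad (f v) (f v) = dyad (inner (f v) (f u) *: f u) (f v).
    by apply/funext => x; rewrite /dyad /= innerZl !scalerA.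
  rewrite op_trace_dyad innerZl mulrC [inner (f v) _]innerC -normCK.
  rewrite mulrC [inner v _]innerC -normCK => /eqP.
  by rewrite eqrXn2 // => /eqP.
pose g z := `|z| *: f (`|z|^-1 *: z).
have unit (z : H) : z != 0 -> inner (`|z|^-1 *: z) (`|z|^-1 *: z) = 1.
  move=> z0; rewrite innerZl innerZr geC0_conj ?invr_ge0 // -sqr_normE.
  by rewrite mulrA -expr2 -exprMn mulVf ?expr1n // normr_eq0.
have g_norm z w : `|inner (g z) (g w)| = `|inner z w|.
  have [->|z0] := eqVneq z 0; first by rewrite /g normr0 scale0r !inner0l.
  have [->|w0] := eqVneq w 0; first by rewrite /g normr0 scale0r !inner0r.
  rewrite /g innerZl innerZr !normrM f_norm; try exact: unit.
  rewrite innerZl innerZr !normrM !norm_conjC !normfV !normr_id.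
  by field; rewrite !normr_eq0 z0 w0.
have [s [V [HV gV]]] := wigner_rays g_norm e1; exists s, V; split=> // u u1.
have [c c1 guV] := gV _ u1; have [_ ->] := fE _ u1.
have -> : f u = c *: V u.
  rewrite -guV /g; have -> : `|u| = 1.
    by apply/eqP; rewrite -(@eqrXn2 _ 2) // sqr_normE u1 expr1n.
  by rewrite invr1 !scale1r.
apply/funext => x; rewrite /dyad innerZr scalerA mulrAC.
by rewrite [c^* * c]mulrC -normCK c1 expr1n mul1r.
Qed.

Lemma inner_preserving_isometry (R : realType) (H : hilbertType R) (s : bool)
    (V : H -> H) :
  (forall x y, inner (V x) (V y) = semi s (inner x y)) ->
  exists W : H -> H, [/\ is_isometry V, is_adjoint V W &
    forall t x, V (oproj t (W x)) = \sum_(y <- t) dyad (V y) (V y) x].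
Proof.
move=> HV; have HL := inner_preserving_semilinear HV.
have [W [HW WL]] := inner_preserving_adjoint HV; exists W; split.
- split.
    by case: s HV HL {HW WL} => HV HL; [left|right] => a x y; rewrite HL.
  move=> x; apply/eqP; rewrite -(@eqrXn2 _ 2) // !sqr_normE HV; apply/eqP.
  by rewrite /semi; case: (s); rewrite // -innerC.
- by case: s HV HL HW WL => HV HL HW WL; [left|right]; split.
move=> t x; rewrite /oproj.
have V0 : V 0 = 0.
  by apply/eqP; rewrite -inner_eq0 HV inner0l /semi; case: (s); rewrite ?rmorph0.
elim: t => [|y t IH]; first by rewrite !big_nil.
rewrite !big_cons HL IH; congr (_ *: _ + _).
by rewrite [inner x (V y)]innerC HW -semiJ -innerC.
Qed.

(** Either there are [(2 * n).+1] orthonormal vectors, or a longest orthonormal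
sequence exists, and it spans the space. *)
Lemma orthonormal_dichotomy (R : realType) (H : hilbertType R) n (t0 : seq H) :
  orthonormal t0 -> size t0 = n.+1 -> (0 < n)%N ->
  (exists2 t : seq H, orthonormal t & size t = (2 * n).+1) \/
  exists N (e : 'I_N -> H), [/\ (n < N <= 2 * n)%N, orthofam e &
     forall x, famproj e x = x].
Proof.
move=> ot0 st0 n_gt0.
have [|nolarge] := pselect (exists2 t : seq H, orthonormal t & size t = (2 * n).+1).
  by left.
right; pose P k := `[< exists2 t : seq H, orthonormal t & size t = k >].
have exP : exists k, P k by exists n.+1; apply/asboolP; exists t0.
have ubP k : P k -> (k <= 2 * n)%N.
  move=> /asboolP[t ot st]; rewrite leqNgt; apply/negP => kn; apply: nolarge.
  exists (drop (k - (2 * n).+1) t); first exact: orthonormal_drop.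
  by rewrite size_drop st subKn.
have [N /asboolP[t ot st] maxN] := ex_maxnP exP ubP.
exists (size t), (fun i => t`_i); split; last first.
- move=> x; rewrite -oproj_famproj; apply/eqP/contraT => xt.
  have [a [ox _]] := orthonormal_extend ot xt.
  suff : (N.+1 <= N)%N by rewrite ltnn.
  by apply: maxN; apply/asboolP; eexists; [exact: ox|rewrite /= st].
- exact: orthofam_nth.
rewrite st ubP ?andbT; last by apply/asboolP; exists t.
by apply: maxN; apply/asboolP; exists t0.
Qed.

Section Assembly.
Context {R : realType} {H : hilbertType R} {n : nat}.
Local Notation C := R[i].
Hypothesis n_ge2 : (2 <= n)%N.
Variable t0 : seq H.
Hypothesis ot0 : orthonormal t0.
Hypothesis st0 : size t0 = n.+1.
Variable phi : projection H n -> projection H n.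
Hypothesis phi_trace : forall P Q : projection H n,
  op_trace (phi P \o phi Q) = op_trace (P \o Q).

Let n_gt0 : (0 < n)%N. Proof. exact: ltnW. Qed.
Local Notation B := (Bop phi).

Let unit_exists : exists e : H, inner e e = 1.
Proof.
by case: t0 ot0 st0 => //= e t [e1 _ _] _; exists e.
Qed.

Lemma isometry_of_idem :
  (forall u, inner u u = 1 -> forall x, B u u (B u u x) = B u u x) ->
  exists V W : H -> H, [/\ is_isometry V, is_adjoint V W
     & forall (P : projection H n) (x : H), phi P x = V (P (W x))].
Proof.
move=> idemB; have [e0 e01] := unit_exists.
have [||s [V [HV VB]]] := @wigner_dyads R H (fun u => B u u) e0 e01.
- move=> u u1; have [d [e [oe fr]]] := Bop_frame n_gt0 ot0 st0 phi_trace [:: u].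
  have fru : in_frame e (B u u) by apply: fr; rewrite mem_head.
  rewrite fru; apply: idem_trace1_dyad => //.
  + exact: (Bmx_adj n_gt0 ot0 st0 phi_trace).
  + by apply: (opmx_inj oe) => x; rewrite opmxM // -fru idemB.
  + by rewrite -u1; exact: (Bmx_trace n_gt0 ot0 st0 phi_trace).
- by move=> u v _ _; exact: (Bop_trace2 n_gt0 ot0 st0 phi_trace).
have [W [isoV adjV VW]] := inner_preserving_isometry HV.
exists V, W; split=> // P x.
have [s' [os' _ Ps']] := projection_orthonormal P.
rewrite (phi_Bop n_gt0 ot0 st0 phi_trace Ps') Ps' VW.
apply: eq_big_seq => y ys; rewrite VB //.
by have /orthonormalP[_ + _] := os'; apply.
Qed.

(** The operators [1/n - Phi (u u^* )] are projections on lines, and a projection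
of rank [n] is the sum of [n] of the [u u^*]. *)
Lemma complement_of_idem d (e : 'I_d.+1 -> H) : d.+1 = (2 * n)%N -> orthofam e ->
  (forall x, famproj e x = x) ->
  (forall u, inner u u = 1 ->
    let G x := n%:R^-1 *: x - B u u x in forall x, G (G x) = G x) ->
  exists V W : H -> H, [/\ is_isometry V, is_adjoint V W
     & forall (P : projection H n) (x : H), phi P x = x - V (P (W x))].
Proof.
move=> dn oe efull idemG; have [e0 e01] := unit_exists.
pose G u x := n%:R^-1 *: x - B u u x.
have n0 : (n%:R : C) != 0 by rewrite pnatr_eq0 -lt0n.
pose k : C := n%:R^-1; pose M u := k%:M - Bmx phi e u u.
have fr u : in_frame e (B u u) by exact: (in_frame_full n_gt0 ot0 st0 phi_trace efull).
have GM u : G u = opmx e (M u).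
  by apply/funext => x; rewrite /G opmxB opmx_scalar // -(fr u).
have trk : \tr (k%:M : 'M[C]_d.+1) = 2.
  by rewrite mxtrace_scalar dn -[_ *+ (2 * n)]mulr_natr natrM /k; field.
have trB u : \tr (Bmx phi e u u) = inner u u.
  exact: (Bmx_trace n_gt0 ot0 st0 phi_trace).
have [||s [V [HV VG]]] := @wigner_dyads R H G e0 e01.
- move=> u u1; rewrite GM; apply: idem_trace1_dyad => //.
  + rewrite /M -[in RHS](Bmx_adj n_gt0 ot0 st0 phi_trace).
    apply/matrixP => i j; rewrite !mxE rmorphB rmorphMn /= (eq_sym j).
    by rewrite /k fmorphV rmorph_nat.
  + by apply: (opmx_inj oe) => x; rewrite opmxM // -GM; exact: idemG.
  + by rewrite /M linearB /= trk trB u1 -[2]/(1 + 1) addrK.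
- move=> u v u1 v1; rewrite !GM.
  have -> : opmx e (M u) \o opmx e (M v) = opmx e (M u *m M v).
    by apply/funext => x; rewrite opmxM.
  rewrite op_trace_opmx // /M mulmxBl !mulmxBr -scalar_mxM !mul_scalar_mx mul_mx_scalar.
  rewrite !linearB !linearZ /= !trB u1 v1 (Bmx_trace2 n_gt0 ot0 st0 phi_trace) //.
  have -> : \tr ((k * k)%:M : 'M[C]_d.+1) = 2 * k.
    by rewrite mxtrace_scalar dn -[_ *+ (2 * n)]mulr_natr natrM /k; field.
  by rewrite -[k *: _]/(k * _); ring.
have [W [isoV adjV VW]] := inner_preserving_isometry HV.
exists V, W; split=> // P x.
have [s' [os' ss' Ps']] := projection_orthonormal P.
rewrite (phi_Bop n_gt0 ot0 st0 phi_trace Ps') Ps' VW.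
have xs : \sum_(y <- s') n%:R^-1 *: x = x.
  rewrite big_const_seq count_predT iter_addr_0 ss' -scaler_nat scalerA divff //.
  by rewrite scale1r.
rewrite -[in X in X - _]xs -sumrB; apply: eq_big_seq => y ys.
have y1 : inner y y = 1 by have /orthonormalP[_ + _] := os'; apply.
by rewrite -(VG y y1) /G opprB addrCA subrr addr0.
Qed.
End Assembly.

Theorem mainTheorem1 (R : realType) (H : hilbertType R) (n : nat)
    (n_ge2 : (2 <= n)%N)
    (dimH : exists e : 'I_n.+1 -> H, lin_indep e)
    (phi : projection H n -> projection H n)
    (phi_trace : forall P Q : projection H n,
       op_trace (phi P \o phi Q) = op_trace (P \o Q)) :
  (exists V W : H -> H, [/\ is_isometry V, is_adjoint V W
     & forall (P : projection H n) (x : H), phi P x = V (P (W x))])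
  \/
  (has_dim [set: H] (2 * n)%N /\
   exists V W : H -> H, [/\ is_isometry V, is_adjoint V W
     & forall (P : projection H n) (x : H), phi P x = x - V (P (W x))]).
Proof.
have [e ie] := dimH; have [t0 [ot0 st0 _ _]] := orthonormal_basis ie.
have n_gt0 : (0 < n)%N by exact: ltnW.
have [[t ot st]|[N [f [nN of_ ffull]]]] := orthonormal_dichotomy ot0 st0 n_gt0.
  left; apply: (isometry_of_idem n_ge2 ot0 st0 phi_trace).
  exact: (Bop_idem_large n_gt0 ot0 st0 phi_trace ot st).
have [N2n|N2n] := eqVneq N (2 * n)%N; last first.
  left; apply: (isometry_of_idem n_ge2 ot0 st0 phi_trace).
  apply: (Bop_idem_small n_gt0 ot0 st0 phi_trace of_ ffull); lia.
case: N f nN of_ ffull N2n => [|d] f nN of_ ffull N2n; first by lia.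
have [h|h] := half_dim_cases n_ge2 ot0 st0 phi_trace N2n of_ ffull.
  by left; exact: (isometry_of_idem n_ge2 ot0 st0 phi_trace h).
right; split; last exact: (complement_of_idem n_ge2 ot0 st0 phi_trace N2n of_ ffull h).
rewrite -N2n; exists f; split.
  move=> c c0 i; have := inner_lincomb of_ c i.
  by rewrite c0 inner0l.
apply/seteqP; split=> // x _; exists (fun i => inner x (f i)) => //.
exact: ffull.
Qed.
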